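(* Let $(\mathcal{A},\tau)$ be a non-commutative probability space with a tracial weight $\omega$, with domain $\operatorname{D}(\omega)\subset\mathcal{A}$. Let $n,k\geq 1$ and consider matrices $A_p=\big(a_{ij}^{(p)}\big)_{i,j=1}^n\in M_n(\operatorname{D}(\omega))$ for $p=1,\ldots,k$ and $B_q=\big(b_{ij}^{(q)}\big)_{i,j=1}^n\in M_n(\mathcal{A})$ for $q=0,\ldots,k$. Assume that the family $\big(a_{ij}^{(p)}\big)_{1\le i,j\le n,\,1\le p\le k}$ is trace class with respect to $\omega$, and that the pair $$\left(\left\{a_{ij}^{(p)} : p=1,\ldots,k,\ i,j=1,\ldots,n\right\},\ \left\{b_{ij}^{(q)} : q=0,\ldots,k,\ i,j=1,\ldots,n\right\}\right)$$ is cyclically monotone with respect to $(\omega,\tau)$. Assume that $B_0A_1B_1\cdots A_kB_k$ is trace class with respect to $\operatorname{Tr}_n\otimes\,\omega$, so that its eigenvalues are defined. Then $$\operatorname{EV}(B_0A_1B_1\cdots A_kB_k)=\operatorname{EV}(A_1B_1'A_2B_2'\cdots A_{k-1}B_{k-1}'A_k(B_kB_0)'),$$ where for $M=(m_{ij})\in M_n(\mathcal{A})$ we write $M'=(\operatorname{id}_n\otimes\tau)(M)=(\tau(m_{ij}))_{i,j=1}^n\in M_n(\mathbb{C})$.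
   Context: A non-commutative probability space is a pair $(\mathcal{A},\tau)$ with $\mathcal{A}$ a unital $*$-algebra over $\mathbb{C}$ and $\tau:\mathcal{A}\to\mathbb{C}$ linear with $\tau(1_{\mathcal{A}})=1$; throughout $\tau$ is tracial: $\tau(xy)=\tau(yx)$. A tracial weight on $\mathcal{A}$ is a linear functional $\omega:\operatorname{D}(\omega)\to\mathbb{C}$ on a $*$-subalgebra $\operatorname{D}(\omega)\subset\mathcal{A}$ with $\omega(xy)=\omega(yx)$, $\omega(x^* )=\overline{\omega(x)}$ and $\omega(x^*x)\ge 0$ for all $x,y\in\operatorname{D}(\omega)$. A finite family $(a_1,\ldots,a_k)$ in $\operatorname{D}(\omega)$ is trace class with respect to $\omega$ if there are a separable Hilbert space $H$ and trace class operators $x_1,\ldots,x_k$ on $H$ with $\omega(a_{i_1}^{\epsilon_1}\cdots a_{i_m}^{\epsilon_m})=\operatorname{Tr}_H(x_{i_1}^{\epsilon_1}\cdots x_{i_m}^{\epsilon_m})$ for all $m\ge1$, all indices $i_j$ and all $\epsilon_j\in\{1,*\}$ (i.e. $(x_1,\dots,x_k)$ has the same distribution as $(a_1,\dots,a_k)$). If a single element $a$ is trace class with respect to $\omega$, $\operatorname{EV}(a)$ is the multiset of eigenvalues (counted with algebraic multiplicity) of any trace class operator $x$ with the same distribution as $a$. The multiplicity of the eigenvalue $0$ is not determined by the distribution, so equalities of such multisets are understood up to the multiplicity of $0$. The algebra $M_n(\mathcal{A})=M_n(\mathbb{C})\otimes\mathcal{A}$ carries the tracial weight $\operatorname{Tr}_n\otimes\,\omega$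 with domain $M_n(\operatorname{D}(\omega))$, $(\operatorname{Tr}_n\otimes\,\omega)((m_{ij}))=\sum_i\omega(m_{ii})$; trace class and $\operatorname{EV}$ for elements of $M_n(\operatorname{D}(\omega))$ refer to this weight. Cyclic monotonicity: let $\mathcal{S},\mathcal{B}\subset\mathcal{A}$ be $*$-subalgebras with $1_{\mathcal{A}}\in\mathcal{B}$, and let $\operatorname{I}_{\mathcal{B}}(\mathcal{S})=\operatorname{span}\{b_0s_1b_1\cdots s_mb_m: m\ge1,\ s_i\in\mathcal{S},\ b_i\in\mathcal{B}\}$. The pair $(\mathcal{S},\mathcal{B})$ is cyclically monotone with respect to $(\omega,\tau)$ if $\operatorname{I}_{\mathcal{B}}(\mathcal{S})\subset\operatorname{D}(\omega)$ and $\omega(s_1b_1\cdots s_mb_m)=\omega(s_1\cdots s_m)\tau(b_1)\cdots\tau(b_m)$ for all $m\ge1$, $s_i\in\mathcal{S}$, $b_i\in\mathcal{B}$. A pair of sets $(X,Y)$ with $X\subset\operatorname{D}(\omega)$, $Y\subset\mathcal{A}$ is cyclically monotone if $(\operatorname{alg}(X),\operatorname{alg}(\{1_{\mathcal{A}}\}\cup Y))$ is, where $\operatorname{alg}$ denotes the generated $*$-subalgebra (the unit is not adjoined to $\operatorname{alg}(X)$). *)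

(* Defs.v *)
From mathcomp Require Import all_boot all_order all_algebra.
From mathcomp Require Export complex.
From mathcomp Require Import all_classical all_reals all_analysis.

Set Implicit Arguments.
Unset Strict Implicit.
Unset Printing Implicit Defensive.

Import Order.TTheory GRing.Theory Num.Theory.
Import numFieldNormedType.Exports.

Local Open Scope classical_set_scope.
Local Open Scope ring_scope.

(* The inner product is linear in the first argument.  Finite-dimensional
   spaces are allowed. *)
Record separable_hilbert (R : realType) := SeparableHilbert {
  hilbert_space :> completeNormedModType R[i];
  hdot : {dot hilbert_space for Num.conj};
  hdot_norm : forall v : hilbert_space, `|v| ^+ 2 = hdot v v;
  hilbert_separable : exists2 S : set hilbert_space, countable S & dense S
}.

Section Operators.
Context {R : realType} (H : separable_hilbert R).

(* A countable orthonormal basis, enumerated by nat with the zero vector as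
   padding: <e_i, e_i> is 0 or 1, so that finite and infinite dimensions are
   treated uniformly.  Padding contributes nothing to traces. *)
Definition orthonormal_basis (e : nat -> H) : Prop :=
  [/\ forall i, e i = 0 \/ hdot H (e i) (e i) = 1,
      forall i j, i <> j -> hdot H (e i) (e j) = 0
    & forall v, (forall i, hdot H v (e i) = 0) -> v = 0].

(* For trace class f, and for positive f, the sum does not depend on e. *)
Definition is_trace (f : H -> H) (t : R[i]) : Prop :=
  exists2 e, orthonormal_basis e &
    series (fun i => hdot H (f (e i)) (e i) : R[i]^o) @ \oo --> (t : R[i]^o).

Definition is_adjoint (x xs : H -> H) : Prop :=
  forall u v, hdot H (x u) v = hdot H u (xs v).

Definition positive_op (p : H -> H) : Prop := forall v, 0 <= hdot H (p v) v.

(* x is bounded and |x| = (x^* x)^(1/2), here p, has finite trace. *)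
Definition trace_class_op (x : {linear H -> H}) : Prop :=
  continuous x /\
  exists xs p : {linear H -> H},
    [/\ is_adjoint x xs,
        continuous p /\ positive_op p,
        forall v, p (p v) = xs (x v)
      & exists t, is_trace p t].

Definition generalized_eigenspace (x : {linear H -> H}) (l : R[i]) : set H :=
  [set v | exists m, iter m (fun u => x u - l *: u) v = 0].

Definition has_dim (V : set H) (d : nat) : Prop :=
  exists b : 'I_d -> H,
    [/\ forall i, V (b i),
        forall c : 'I_d -> R[i], \sum_i c i *: b i = 0 -> forall i, c i = 0
      & forall v, V v -> exists c : 'I_d -> R[i], v = \sum_i c i *: b i].

Definition alg_mult (x : {linear H -> H}) (l : R[i]) (d : nat) : Prop :=
  has_dim (generalized_eigenspace x l) d.

(* x_{i_1}^{eps_1} o ... o x_{i_m}^{eps_m} for s = [:: (i_1, eps_1); ...],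
   where eps = true stands for the adjoint. *)
Definition op_word (I : Type) (x xs : I -> {linear H -> H})
    (s : seq (I * bool)) : H -> H :=
  foldr (fun p (f : H -> H) v => (if p.2 then xs p.1 else x p.1) (f v)) id s.

End Operators.

(* Distributions make sense in any ring with an involution and a partially
   defined functional (omega is only meaningful on its domain D); this covers
   both A itself and the matrices over A. *)
Section Distributions.
Context {R : realType} (A : pzRingType) (star : A -> A)
  (D : set A) (omega : A -> R[i]).

Definition star_word (I : Type) (a : I -> A) (s : seq (I * bool)) : A :=
  \prod_(p <- s) (if p.2 then star (a p.1) else a p.1).

Definition realizes (I : Type) (a : I -> A) (H : separable_hilbert R)
    (x : I -> {linear H -> H}) : Prop :=
  (forall i, trace_class_op (x i)) /\
  exists2 xs : I -> {linear H -> H},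
    forall i, is_adjoint (x i) (xs i) &
    forall s : seq (I * bool), (0 < size s)%N ->
      is_trace (op_word x xs s) (omega (star_word a s)).

Definition trace_class (I : Type) (a : I -> A) : Prop :=
  (forall i, D (a i)) /\
  exists (H : separable_hilbert R) (x : I -> {linear H -> H}), realizes a x.

(* mu is the eigenvalue multiset of a, given by its multiplicity function.
   It is prescribed only away from 0, and required of every operator x with
   the distribution of a. *)
Definition is_EV (a : A) (mu : R[i] -> nat) : Prop :=
  trace_class (fun _ : unit => a) /\
  forall (H : separable_hilbert R) (x : {linear H -> H}),
    realizes (fun _ : unit => a) (fun _ : unit => x) ->
    forall l, l != 0 -> alg_mult x l (mu l).

End Distributions.

Section StarAlgebras.
Context {R : realType} (A : algType R[i]).

Definition is_star (star : A -> A) : Prop :=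
  [/\ forall (c : R[i]) x y, star (c *: x + y) = Num.conj c *: star x + star y,
      forall x y, star (x * y) = star y * star x
    & forall x, star (star x) = x].

Definition tracial_state (tau : A -> R[i]) : Prop :=
  tau 1 = 1 /\ forall x y, tau (x * y) = tau (y * x).

(* Not necessarily unital. *)
Definition star_subalgebra (star : A -> A) (S : set A) : Prop :=
  [/\ S 0,
      forall (c : R[i]) x y, S x -> S y -> S (c *: x + y),
      forall x y, S x -> S y -> S (x * y)
    & forall x, S x -> S (star x)].

Definition star_alg (star : A -> A) (X : set A) : set A :=
  smallest (star_subalgebra star) X.

Definition tracial_weight (star : A -> A) (D : set A) (omega : A -> R[i]) : Prop :=
  star_subalgebra star D /\
  [/\ forall (c : R[i]) x y, D x -> D y ->
        omega (c *: x + y) = c * omega x + omega y,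
      forall x y, D x -> D y -> omega (x * y) = omega (y * x),
      forall x, D x -> omega (star x) = Num.conj (omega x)
    & forall x, D x -> 0 <= omega (star x * x)].

Definition linear_span (X : set A) : set A :=
  [set x | exists r (c : 'I_r -> R[i]) (v : 'I_r -> A),
     (forall i, X (v i)) /\ x = \sum_i c i *: v i].

(* The empty word is excluded, so b_0 alone is not in the span. *)
Definition ideal_span (B S : set A) : set A :=
  linear_span [set x | exists m (s b : 'I_m -> A) b0,
    [/\ (0 < m)%N, B b0, forall i, S (s i), forall i, B (b i)
      & x = b0 * \prod_(i < m) (s i * b i)]].

Definition cyclically_monotone_alg (tau : A -> R[i]) (D : set A)
    (omega : A -> R[i]) (S B : set A) : Prop :=
  ideal_span B S `<=` D /\
  forall m (s b : 'I_m -> A), (0 < m)%N ->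
    (forall i, S (s i)) -> (forall i, B (b i)) ->
    omega (\prod_(i < m) (s i * b i)) =
    omega (\prod_(i < m) s i) * \prod_(i < m) tau (b i).

Definition cyclically_monotone (star : A -> A) (tau : A -> R[i]) (D : set A)
    (omega : A -> R[i]) (X Y : set A) : Prop :=
  cyclically_monotone_alg tau D omega
    (star_alg star X) (star_alg star ([set 1] `|` Y)).

Definition mx_star (star : A -> A) n (M : 'M[A]_n) : 'M[A]_n :=
  map_mx star M^T.

Definition mx_dom (D : set A) n : set 'M[A]_n :=
  [set M | forall i j, D (M i j)].

Definition mx_weight (omega : A -> R[i]) n (M : 'M[A]_n) : R[i] :=
  \tr (map_mx omega M).

Definition id_tau (tau : A -> R[i]) n (M : 'M[A]_n) : 'M[R[i]]_n :=
  map_mx tau M.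

Definition scalar_entries n (M : 'M[R[i]]_n) : 'M[A]_n :=
  map_mx (fun c => c%:A) M.

End StarAlgebras.

Arguments mx_star {R A} star {n} M.
Arguments mx_dom {R A} D {n}.
Arguments mx_weight {R A} omega {n} M.
Arguments scalar_entries {R} A {n} M.

(* Main.v *)
Require Import Defs.
From HB Require Import structures.
From mathcomp Require Import all_boot all_order all_algebra.
From mathcomp Require Import all_classical all_reals all_analysis.
From mathcomp Require Import ring lra zify.

(** Write [M] for the product [B_0 A_1 B_1 .. A_k B_k] and [N] for the product
    [A_1 B_1' .. A_k (B_k B_0)'].  Three facts give the theorem.

    The nonzero eigenvalues of a trace class operator [x], with their algebraic
    multiplicities, are determined by the numbers [Tr (x ^ m)], [m >= 2]
    (trace_moments_mult).  Fix [l != 0] and put [r = |l| / 2].  Consider finite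
    orthonormal sequences in which [x] is triangular with diagonal entries of
    modulus at least [r].  Their length is bounded, because the moduli of the
    diagonal entries sum to at most the trace norm.  A longest sequence with all
    diagonal entries equal to [l] spans the generalized eigenspace of [l]
    (max_eigenflag_ge); lengthened to a longest sequence with entries of modulus
    at least [r], it acquires no further entry [l] (max_eigenflag_ext).  Let [Q]
    be the projection onto the orthogonal complement of the span.  Then [Q x] is
    compact without eigenvalues of modulus at least [r], so that
    [|(Q x) ^ m| = O (r ^ m)] (power_bound), and the triangular form gives
    [Tr (x ^ m) = sum of (diagonal entry) ^ m + O (r ^ m)]
    (max_eigenflag_estimate).  If two operators have the same moments, the
    difference of their power sums is [O (r ^ m)]; a polynomial vanishing at all
    diagonal entries but [l] then shows that [l] occurs equally often in both
    (power_sums_mult).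

    The moments of [M] and [N] agree for [m >= 2] (rotated_moments).  Cyclic
    monotonicity replaces, one after the other, the entries of the [B_q] standing
    between entries of the [A_p] by their values under [tau]; the factor [B_0]
    must first be moved from the front to the back by traciality.  Since [omega]
    is tracial only on its domain, the two factors exchanged must both lie in the
    domain, that is, both must contain a factor [A_p].  For [k = 1] this needs
    [m >= 2], and so the first moment is left out.

    [N] is trace class (mx_represents_trace_class): its entries are linear
    combinations of words in the [A_p i j].  The same linear combinations of the
    operators realizing the family form an [n * n] matrix of trace class operators
    on [H], that is, an operator on [H ^ n] whose star moments are those of [N].
    To see that it is trace class, and that traces do not depend on the
    orthonormal basis, trace class operators are compared with nuclear ones, given
    by series [sum_i <., a_i> b_i] with [sum_i |a_i| |b_i|] finite
    (trace_class_nuclear, nuclear_trace).  The property passed on to sums,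
    products and matrices is a bound on diagonal sums (trace_bounded), which gives
    back a trace class operator by trace_bounded_trace_class.  Both comparisons
    use the operators [x (q + e)^-1] for small [e > 0]: with [q = |x|] they
    approximate the partial isometry of the polar decomposition, and with
    [q = sqrt |x|] they converge to a [y] such that [x = y (sqrt |x|)]. *)

Set Implicit Arguments.
Unset Strict Implicit.
Unset Printing Implicit Defensive.

Import Order.TTheory GRing.Theory Num.Theory.
Import numFieldNormedType.Exports.

Local Open Scope classical_set_scope.
Local Open Scope ring_scope.
Local Open Scope complex_scope.

Local Notation "''[' u , v ]" := (hdot _ u v) : ring_scope.

(** * Real-valued norms and sequences *)

Section RealNorm.
Context {R : realType}.
Local Notation C := R[i].

(** A norm over [R[i]] takes its values in [R[i]], where the order is partial;
    estimates are made with this real number instead. *)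
Definition nm (V : normedZmodType C) (v : V) : R := complex.Re `|v|.

Section Zmod.
Context {V : normedZmodType C}.
Implicit Types v w : V.

Lemma nmE v : `|v| = (nm v)%:C.
Proof.
rewrite /nm; have := normr_ge0 v; rewrite lecE => /andP[/eqP/= h _].
by case: (`|v|) h => a b /= ->.
Qed.

Lemma nm_ge0 v : 0 <= nm v.
Proof. by rewrite -lecR -nmE normr_ge0. Qed.

Lemma nmD v w : nm (v + w) <= nm v + nm w.
Proof. by rewrite -lecR rmorphD /= -!nmE ler_normD. Qed.

Lemma nm0 : nm (0 : V) = 0.
Proof. by rewrite /nm normr0. Qed.

Lemma nmN v : nm (- v) = nm v.
Proof. by rewrite /nm normrN. Qed.

Lemma nmB v w : nm (v - w) <= nm v + nm w.
Proof. by rewrite -(nmN w) nmD. Qed.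

Lemma nmBC v w : nm (v - w) = nm (w - v).
Proof. by rewrite -nmN opprB. Qed.

Lemma nm_eq0 v : nm v = 0 -> v = 0.
Proof. by move=> h; apply/eqP; rewrite -normr_eq0 nmE h. Qed.

Lemma nm_gt0 v : v != 0 -> 0 < nm v.
Proof.
move=> v0; rewrite lt_neqAle nm_ge0 andbT eq_sym.
by apply: contra v0 => /eqP/nm_eq0 ->.
Qed.

Lemma nm_sum (I : Type) (r : seq I) (P : pred I) (F : I -> V) :
  nm (\sum_(i <- r | P i) F i) <= \sum_(i <- r | P i) nm (F i).
Proof.
elim/big_ind2: _ => [|x a y b xa yb|//]; first by rewrite nm0.
by apply: (le_trans (nmD _ _)); exact: lerD.
Qed.

Lemma nm_tri v w u : nm (v - u) <= nm (v - w) + nm (w - u).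
Proof. by rewrite -[v - u](subrKA w) nmD. Qed.

Lemma nm_sub_ge v w : nm v - nm w <= nm (v - w).
Proof. by rewrite lerBlDr -[X in nm X <= _](subrK w) nmD. Qed.
End Zmod.

Lemma nmZ (V : normedModType C) (a : C) (v : V) : nm (a *: v) = nm a * nm v.
Proof. by apply: complexI; rewrite rmorphM /= -!nmE normrZ. Qed.

Lemma nmM (a b : C) : nm (a * b) = nm a * nm b.
Proof. by apply: complexI; rewrite rmorphM /= -!nmE normrM. Qed.

Lemma nm1 : nm (1 : C) = 1.
Proof. by rewrite /nm normr1. Qed.

Lemma nmX (a : C) n : nm (a ^+ n) = nm a ^+ n.
Proof. by elim: n => [|n IH]; rewrite ?nm1 // !exprS nmM IH. Qed.

Lemma nmV (a : C) : nm (a^-1) = (nm a)^-1.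
Proof.
by apply: complexI; rewrite fmorphV /= -!nmE normfV.
Qed.

Lemma nmR (x : R) : nm (x%:C : C) = `|x|.
Proof. by rewrite /nm normc_def /= expr0n /= addr0 sqrtr_sqr. Qed.

Lemma nmconj (a : C) : nm (Num.conj a) = nm a.
Proof. by rewrite /nm norm_conjC. Qed.

Lemma nmM_conj (a : C) : a * Num.conj a = (nm a ^+ 2)%:C.
Proof. by rewrite -normCK nmE rmorphXn. Qed.

Lemma Re_le_nm (a : C) : complex.Re a <= nm a.
Proof.
by rewrite (le_trans (ler_norm _))// -lecR -nmE normc_ge_Re.
Qed.

Lemma nm_le_ReIm (a : C) : nm a <= `|complex.Re a| + `|complex.Im a|.
Proof.
have i1 : nm ('i : C) = 1.
  by rewrite /nm normc_def /= expr0n /= expr1n add0r sqrtr1.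
rewrite {1}[a]complexE (le_trans (nmD _ _)) // nmM.
by rewrite i1 mul1r !nmR.
Qed.

Lemma ge0_nm (a : C) : 0 <= a -> a = (nm a)%:C.
Proof. by move=> a0; rewrite -nmE ger0_norm. Qed.

End RealNorm.

Section Sequences.
Context {R : realType}.
Local Notation C := R[i].

(** Convergence stated with real bounds; [tends_toP] compares it with the
    convergence along the filter of the ambient topology. *)
Definition tends_to (V : normedZmodType C) (f : nat -> V) (l : V) :=
  forall e : R, 0 < e -> exists N, forall n, (N <= n)%N -> nm (f n - l) < e.

Section Zmod.
Context {V : normedZmodType C}.
Implicit Types (f g : nat -> V) (l k : V).

Lemma tends_to_cst l : tends_to (fun=> l) l.
Proof. by move=> e e0; exists 0%N => n _; rewrite subrr nm0. Qed.

Lemma eq_tends_to f g l : f =1 g -> tends_to f l -> tends_to g l.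
Proof. by move=> /funext ->. Qed.

Lemma tends_toD f g l k : tends_to f l -> tends_to g k -> tends_to (fun n => f n + g n) (l + k).
Proof.
move=> hf hg e e0; have e20 : 0 < e / 2 by lra.
have [N hN] := hf _ e20; have [M hM] := hg _ e20.
exists (maxn N M) => n; rewrite geq_max => /andP[/hN h1 /hM h2].
rewrite opprD addrACA (le_lt_trans (nmD _ _)) //; lra.
Qed.

Lemma tends_to_map (W : normedZmodType C) (T : V -> W) c f l :
  (forall u v, nm (T u - T v) <= c * nm (u - v)) ->
  tends_to f l -> tends_to (fun n => T (f n)) (T l).
Proof.
move=> hT hf e e0.
have [N hN] := hf (e / (`|c| + 1)) ltac:(by rewrite divr_gt0 // ltr_wpDl).
exists N => n /hN h; apply: (le_lt_trans (hT _ _)).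
have c1 : 0 < `|c| + 1 by rewrite ltr_wpDl.
rewrite ltr_pdivlMr // in h.
apply: le_lt_trans h; rewrite mulrC ler_wpM2l ?nm_ge0 //.
by rewrite (le_trans (ler_norm c)) // lerDl.
Qed.

Lemma tends_toN f l : tends_to f l -> tends_to (fun n => - f n) (- l).
Proof.
by apply: (@tends_to_map _ (fun x => - x) 1) => u v; rewrite mul1r -opprD nmN.
Qed.

Lemma tends_toB f g l k : tends_to f l -> tends_to g k -> tends_to (fun n => f n - g n) (l - k).
Proof. by move=> hf hg; apply: tends_toD => //; exact: tends_toN. Qed.

Lemma tends_to_sum (I : Type) (r : seq I) (F : I -> nat -> V) (L : I -> V) :
  (forall i, tends_to (F i) (L i)) ->
  tends_to (fun n => \sum_(i <- r) F i n) (\sum_(i <- r) L i).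
Proof.
move=> h; elim: r => [|i r IH].
  by rewrite big_nil; apply: eq_tends_to (tends_to_cst _) => n; rewrite big_nil.
by rewrite big_cons; apply: eq_tends_to (tends_toD (h i) IH) => n; rewrite big_cons.
Qed.

Lemma tends_to_le f l (c : R) :
  tends_to f l -> (forall e, 0 < e -> exists N, forall n, (N <= n)%N -> nm (f n) <= c + e) ->
  nm l <= c.
Proof.
move=> hf hc; apply/ler_addgt0Pr => e e0.
have e2 : 0 < e / 2 by lra.
have [N hN] := hf _ e2; have [M hM] := hc _ e2.
have h1 := hN _ (leq_maxl N M); have h2 := hM _ (leq_maxr N M).
have := nm_sub_ge l (f (maxn N M)); rewrite nmBC; lra.
Qed.

Lemma tends_to_nm_le f l (c : R) : tends_to f l -> (forall n, nm (f n) <= c) -> nm l <= c.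
Proof.
move=> hf hc; apply: tends_to_le hf _ => e e0; exists 0%N => n _.
by rewrite (le_trans (hc n)) // lerDl ltW.
Qed.

Lemma tends_to_uniq f l k : tends_to f l -> tends_to f k -> l = k.
Proof.
move=> hl hk; have h := tends_toB hl hk.
apply/eqP; rewrite -subr_eq0; apply/eqP/nm_eq0/le_anti; rewrite nm_ge0 andbT.
by apply: tends_to_nm_le h _ => n; rewrite subrr nm0.
Qed.

Lemma tends_to_sub f l (s : nat -> nat) :
  (forall N, exists M, forall n, (M <= n)%N -> (N <= s n)%N) ->
  tends_to f l -> tends_to (fun n => f (s n)) l.
Proof.
move=> hs hf e /hf[N hN]; have [M hM] := hs N.
by exists M => n /hM/hN.
Qed.

Lemma tends_to_S f l : tends_to f l -> tends_to (fun n => f n.+1) l.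
Proof. by apply: tends_to_sub => N; exists N => n; apply: leqW. Qed.

Lemma tends_to_tail f l (m : nat) :
  (forall n, (m <= n)%N -> f n = l) -> tends_to f l.
Proof. by move=> h e e0; exists m => n /h ->; rewrite subrr nm0. Qed.

Lemma tends_to_squeeze f l (g : nat -> R) :
  (forall n, nm (f n - l) <= g n) ->
  (forall e, 0 < e -> exists N, forall n, (N <= n)%N -> g n < e) -> tends_to f l.
Proof.
move=> h hg e /hg[N hN]; exists N => n /hN; exact: le_lt_trans.
Qed.

End Zmod.

Lemma tends_toZ (V : normedModType C) (a : C) (f : nat -> V) l :
  tends_to f l -> tends_to (fun n => a *: f n) (a *: l).
Proof.
by apply: (@tends_to_map _ _ (fun x => a *: x) (nm a)) => u v; rewrite -scalerBr nmZ.
Qed.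

Lemma tends_toMl (a : C) (f : nat -> C) l : tends_to f l -> tends_to (fun n => a * f n) (a * l).
Proof.
by apply: (@tends_to_map _ _ (fun x => a * x) (nm a)) => u v; rewrite -mulrBr nmM.
Qed.

Lemma tends_toP (V : normedModType C) (f : nat -> V) (l : V) :
  (f @ \oo --> l) <-> tends_to f l.
Proof.
split.
- move=> /cvgrPdist_lt h e e0.
  have e0' : 0 < e%:C :> C by rewrite ltcR.
  have [N _ hN] := h _ e0'; exists N => n Nn.
  by have /= := hN n Nn; rewrite nmE ltcR nmBC.
- move=> h; apply/cvgrPdist_lt => e e0.
  have E : e = (nm e)%:C by apply: ge0_nm; exact: ltW.
  have e0' : 0 < nm e by rewrite -ltcR -E.
  have [N hN] := h _ e0'; exists N => // n Nn.
  by rewrite /= nmE E ltcR nmBC hN.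
Qed.

Lemma tends_to_complete (V : completeNormedModType C) (f : nat -> V) :
  (forall e : R, 0 < e -> exists N, forall n, (N <= n)%N -> nm (f n - f N) < e) ->
  exists l, tends_to f l.
Proof.
move=> h; have : cauchy_ex (f @ \oo).
  move=> e e0.
  have E : e = (nm e)%:C by apply: ge0_nm; exact: ltW.
  have e0' : 0 < nm e by rewrite -ltcR -E.
  have [N hN] := h _ e0'; exists (f N); exists N => // n Nn /=.
  by rewrite -ball_normE /ball_ /= nmE E ltcR nmBC hN.
move=> /cauchy_exP/cauchy_cvgP/cvg_ex[l /tends_toP hl]; by exists l.
Qed.

Lemma mono_cauchy (s : nat -> R) c :
  (forall n, s n <= s n.+1) -> (forall n, s n <= c) ->
  forall e, 0 < e -> exists N, forall n, (N <= n)%N -> s n - s N < e.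
Proof.
move=> mono ub e e0.
have hs : has_sup (range s).
  by split; [exists (s 0%N), 0%N | exists c => _ [n _ <-]].
have [_ [N _ <-] hN] := sup_adherent e0 hs.
exists N => n _.
have : s n <= sup (range s) by apply: ub_le_sup; [exact: hs.2 | exists n].
lra.
Qed.

Lemma tail_small (a : nat -> R) c :
  (forall i, 0 <= a i) -> (forall N, \sum_(i < N) a i <= c) ->
  forall e, 0 < e -> exists N, forall n, (N <= n)%N -> \sum_(N <= i < n) a i < e.
Proof.
move=> a0 ac e e0.
have [|N hN] := @mono_cauchy (fun n => \sum_(i < n) a i) c _ ac _ e0.
  by move=> n; rewrite big_ord_recr /= lerDl.
exists N => n Nn; have := hN n Nn.
rewrite -!(big_mkord xpredT a) (big_cat_nat (leq0n N) Nn) /=; lra.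
Qed.

Lemma geo_small (q : R) (K : R) : 0 <= q -> q < 1 ->
  forall e, 0 < e -> exists N, forall n, (N <= n)%N -> K * q ^+ n < e.
Proof.
move=> q0 q1 e e0.
have K1 : 0 < `|K| + 1 by rewrite ltr_wpDl.
have := @cvg_geometric R (`|K| + 1) q ltac:(by rewrite ger0_norm).
move=> /cvgrPdist_lt/(_ e e0)[N _ hN]; exists N => n Nn.
have := hN n Nn; rewrite /= sub0r normrN /geometric /=.
rewrite ger0_norm ?mulr_ge0 ?exprn_ge0 // ?(ltW K1) //.
apply: le_lt_trans; rewrite ler_wpM2r ?exprn_ge0 //.
by rewrite (le_trans (ler_norm K)) // lerDl.
Qed.

Lemma inv_small : forall e : R, 0 < e -> exists N, forall n, (N <= n)%N -> n.+1%:R^-1 < e.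
Proof.
move=> e e0.
exists (Num.bound e^-1) => n hn.
have ei : 0 <= e^-1 by rewrite invr_ge0 ltW.
have h := archi_boundP ei.
rewrite -[e]invrK ltf_pV2 ?posrE ?ltr0n ?invr_gt0 //.
by apply: (lt_le_trans h); rewrite ler_nat ltnW.
Qed.

End Sequences.

(** * Operators with an adjoint *)

Section Hilbert.
Context {R : realType} {H : separable_hilbert R}.
Local Notation C := R[i].
Implicit Types u v w : H.

Lemma dotC u v : '[u, v] = Num.conj '[v, u].
Proof. by rewrite (hermC (hdot H)) /= expr0 mul1r. Qed.

Lemma dotDl u v w : '[u + v, w] = '[u, w] + '[v, w].
Proof. by rewrite linearDl. Qed.

Lemma dotDr u v w : '[w, u + v] = '[w, u] + '[w, v].
Proof. by rewrite raddfD. Qed.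

Lemma dotZl a u w : '[a *: u, w] = a * '[u, w].
Proof. by rewrite linearZl_LR. Qed.

Lemma dotZr a u w : '[w, a *: u] = Num.conj a * '[w, u].
Proof. by rewrite linearZr_LR. Qed.

Lemma dotNl u w : '[- u, w] = - '[u, w].
Proof. by rewrite linearNl. Qed.

Lemma dotNr u w : '[w, - u] = - '[w, u].
Proof. by rewrite raddfN. Qed.

Lemma dotBl u v w : '[u - v, w] = '[u, w] - '[v, w].
Proof. by rewrite dotDl dotNl. Qed.

Lemma dotBr u v w : '[w, u - v] = '[w, u] - '[w, v].
Proof. by rewrite dotDr dotNr. Qed.

Lemma dot0l w : '[0, w] = 0. Proof. by rewrite linear0l. Qed.

Lemma dot0r w : '[w, 0] = 0. Proof. by rewrite raddf0. Qed.

Lemma dot_suml (I : Type) (r : seq I) (P : pred I) (F : I -> H) w :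
  '[\sum_(i <- r | P i) F i, w] = \sum_(i <- r | P i) '[F i, w].
Proof. by rewrite linear_sumlz. Qed.

Lemma dot_sumr (I : Type) (r : seq I) (P : pred I) (F : I -> H) w :
  '[w, \sum_(i <- r | P i) F i] = \sum_(i <- r | P i) '[w, F i].
Proof. by rewrite raddf_sum. Qed.

Lemma dot_nm v : '[v, v] = (nm v ^+ 2)%:C.
Proof. by rewrite -hdot_norm nmE rmorphXn. Qed.

Lemma nm_dotC u v : nm '[u, v] = nm '[v, u].
Proof. by rewrite dotC nmconj. Qed.

Lemma conj_dot u v : Num.conj '[u, v] = '[v, u].
Proof. by rewrite [RHS]dotC. Qed.

Lemma nmD2 u v :
  nm (u + v) ^+ 2 = nm u ^+ 2 + nm v ^+ 2 + complex.Re '[u, v] *+ 2.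
Proof.
have E : '[u, v] + '[v, u] = (complex.Re '[u, v] *+ 2)%:C.
  by rewrite -['[v, u]]conj_dot -[Num.conj _]/(conjc _) addcJ rmorphMn /= mulr_natl.
apply: complexI; rewrite -dot_nm dotDl !dotDr [RHS]rmorphD [X in _ = X + _]rmorphD /= -E -!dot_nm.
ring.
Qed.

Lemma cauchy_schwarz u v : nm '[u, v] <= nm u * nm v.
Proof.
have [->|v0] := eqVneq v 0; first by rewrite dot0r !nm0 mulr0.
have V0 := nm_gt0 v0.
pose a := '[u, v] / (nm v ^+ 2)%:C.
have nv0 : (nm v ^+ 2)%:C != 0 :> C.
  by rewrite -(rmorph0 (real_complex R)) (inj_eq (@complexI _)) expf_neq0 // gt_eqF.
have o : '[u - a *: v, v] = 0.
  by rewrite dotBl dotZl dot_nm divfK ?subrr.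
have := nmD2 (u - a *: v) (a *: v).
rewrite subrK dotZr o mulr0 mul0rn addr0 => E.
have h : nm (a *: v) ^+ 2 <= nm u ^+ 2 by rewrite E lerDr sqr_ge0.
have {h} h : nm (a *: v) <= nm u.
  by move: h; rewrite ler_pXn2r // ?nnegrE ?nm_ge0.
move: h; rewrite nmZ /a nmM nmV nmR ger0_norm ?sqr_ge0 //.
by rewrite expr2 invfM mulrA divfK ?gt_eqF // ler_pdivrMr.
Qed.

Lemma pythagoras u v : '[u, v] = 0 -> nm (u + v) ^+ 2 = nm u ^+ 2 + nm v ^+ 2.
Proof. by move=> h; rewrite nmD2 h mul0rn addr0. Qed.

Lemma dot_ext u : (forall v, '[u, v] = 0) -> u = 0.
Proof.
move=> /(_ u); rewrite dot_nm => /eqP.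
rewrite -(rmorph0 (real_complex R)) (inj_eq (@complexI _)) sqrf_eq0.
by move=> /eqP/nm_eq0.
Qed.

Lemma dot_ext2 u v : (forall w, '[u, w] = '[v, w]) -> u = v.
Proof.
by move=> h; apply/eqP; rewrite -subr_eq0; apply/eqP/dot_ext => w; rewrite dotBl h subrr.
Qed.

Lemma tends_to_dotl (f : nat -> H) l w : tends_to f l -> tends_to (fun n => '[f n, w]) '[l, w].
Proof.
apply: (@tends_to_map _ _ _ (fun x => '[x, w]) (nm w)) => u v.
by rewrite -dotBl mulrC cauchy_schwarz.
Qed.

Lemma tends_to_dotr (f : nat -> H) l w : tends_to f l -> tends_to (fun n => '[w, f n]) '[w, l].
Proof.
apply: (@tends_to_map _ _ _ (fun x => '[w, x]) (nm w)) => u v.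
by rewrite -dotBr cauchy_schwarz.
Qed.

Definition bounded_by (T : H -> H) (c : R) := forall v, nm (T v) <= c * nm v.

Section Adjoint.
Variables (T S : H -> H).
Hypothesis TS : is_adjoint T S.

Lemma adjC : is_adjoint S T.
Proof. by move=> u v; rewrite dotC -TS conj_dot. Qed.

(** Tested against all vectors, both sides agree by linearity of the inner product. *)
Lemma adj_lin a u v : T (a *: u + v) = a *: T u + T v.
Proof.
by apply: dot_ext2 => w; rewrite TS !(dotDl, dotZl) !TS.
Qed.

Lemma adj_D u v : T (u + v) = T u + T v.
Proof. by rewrite -[u]scale1r adj_lin !scale1r. Qed.

Lemma adj_0 : T 0 = 0.
Proof. by apply: (addrI (T 0)); rewrite -adj_D !addr0. Qed.

Lemma adj_Z a u : T (a *: u) = a *: T u.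
Proof. by rewrite -[a *: u]addr0 adj_lin adj_0 addr0. Qed.

Lemma adj_N u : T (- u) = - T u.
Proof. by rewrite -scaleN1r adj_Z scaleN1r. Qed.

Lemma adj_B u v : T (u - v) = T u - T v.
Proof. by rewrite adj_D adj_N. Qed.

Lemma adj_sum (I : Type) (r : seq I) (P : pred I) (F : I -> H) :
  T (\sum_(i <- r | P i) F i) = \sum_(i <- r | P i) T (F i).
Proof. by elim/big_rec2: _ => [|i x y _ <-]; rewrite ?adj_0 ?adj_D. Qed.

(** [|S v|^2 = <T (S v), v> <= c |S v| |v|]. *)
Lemma adj_bounded c : 0 <= c -> bounded_by T c -> bounded_by S c.
Proof.
move=> c0 h v; have [->|v0] := eqVneq (S v) 0.
  by rewrite nm0 mulr_ge0 ?nm_ge0.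
have h1 : nm (S v) ^+ 2 <= c * nm (S v) * nm v.
  rewrite -[X in X <= _]ger0_norm ?sqr_ge0 // -nmR -dot_nm -TS.
  by rewrite (le_trans (cauchy_schwarz _ _)) // ler_wpM2r ?nm_ge0.
by rewrite -(ler_pM2r (nm_gt0 v0)) -expr2 mulrAC.
Qed.

Lemma tends_to_adj c (f : nat -> H) l : bounded_by T c -> tends_to f l -> tends_to (fun n => T (f n)) (T l).
Proof. by move=> h; apply: (@tends_to_map _ _ _ T c) => u v; rewrite -adj_B. Qed.

End Adjoint.

Lemma adj_comp (T S T' S' : H -> H) :
  is_adjoint T S -> is_adjoint T' S' -> is_adjoint (T \o T') (S' \o S).
Proof. by move=> h h' u v; rewrite /= h h'. Qed.

Lemma bounded_by_comp (T S : H -> H) c d : 0 <= c -> bounded_by T c -> bounded_by S d -> bounded_by (T \o S) (c * d).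
Proof.
by move=> c0 hT hS v; rewrite /= (le_trans (hT _)) // -mulrA ler_wpM2l.
Qed.

Lemma bounded_by_id : bounded_by (id : H -> H) 1.
Proof. by move=> v; rewrite mul1r. Qed.

Lemma bounded_by_le T c d : c <= d -> bounded_by T c -> bounded_by T d.
Proof. by move=> cd h v; rewrite (le_trans (h v)) // ler_wpM2r ?nm_ge0. Qed.

(** A linear map bounded by 1 on a ball is bounded, by homogeneity. *)
Lemma continuous_bounded (x : {linear H -> H}) : continuous x -> exists2 c, 0 <= c & bounded_by x c.
Proof.
move=> /(_ 0) h.
have /cvgrPdist_lt/(_ 1 ltr01) : x u @[u --> 0] --> x 0 by exact: h.
rewrite linear0 => /nbhs_ballP[e /= e0 he].
have E : e = (nm e)%:C by apply: ge0_nm; exact: ltW.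
have d0 : 0 < nm e by rewrite -ltcR -E.
have key u : nm u < nm e -> nm (x u) <= 1.
  move=> hu; have := he u; rewrite -ball_normE /ball_ /= !sub0r !normrN => hh.
  have : `|u| < e by rewrite nmE E ltcR.
  by move/hh; rewrite nmE -(rmorph1 (real_complex R)) ltcR => /ltW.
exists (2 / nm e); first by rewrite divr_ge0 // ltW.
move=> v; have [->|v0] := eqVneq v 0; first by rewrite linear0 nm0 mulr0.
have nv := nm_gt0 v0.
have := key ((nm e / 2 / nm v)%:C *: v); rewrite nmZ nmR.
have q0 : 0 < nm e / 2 / nm v by rewrite !divr_gt0.
rewrite gtr0_norm // divfK ?gt_eqF // => /(_ ltac:(by rewrite ltr_pdivrMr // mulr_natr mulr2n ltrDl)).
rewrite linearZ nmZ nmR gtr0_norm // => h1.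
have e2 : 2 / nm e * nm v = (nm e / 2 / nm v)^-1.
  by field; rewrite !gt_eqF.
by rewrite e2 -[X in _ <= X]mulr1 mulrC ler_pdivlMr // mulrC.
Qed.

Lemma bounded_continuous (x : {linear H -> H}) c : bounded_by x c -> continuous x.
Proof.
move=> h u; apply/cvgrPdist_lt => e e0.
have E : e = (nm e)%:C by apply: ge0_nm; exact: ltW.
move: (nm e) E => d E; rewrite {}E ltcR in e0 *.
have c1 : 0 < `|c| + 1 by rewrite ltr_wpDl.
apply/nbhs_ballP; exists (d / (`|c| + 1))%:C => /=.
  by rewrite ltcR divr_gt0.
move=> v; rewrite -ball_normE /ball_ /= !nmE !ltcR => hv.
rewrite ltr_pdivlMr // in hv.
rewrite -linearB; apply: (le_lt_trans (h _)); apply: le_lt_trans hv.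
by rewrite mulrC ler_wpM2l ?nm_ge0 // (le_trans (ler_norm c)) // lerDl.
Qed.

End Hilbert.

(** * Orthonormal families and nuclear operators *)

(** Stated for bounds on the two sums of squares, as Bessel inequalities
    provide them. *)
Lemma sum_cauchy_schwarz {R : realType} (N : nat) (x y : nat -> R) a b :
  0 <= a -> 0 <= b ->
  (forall k, 0 <= x k) -> (forall k, 0 <= y k) ->
  \sum_(k < N) x k ^+ 2 <= a ^+ 2 -> \sum_(k < N) y k ^+ 2 <= b ^+ 2 ->
  \sum_(k < N) x k * y k <= a * b.
Proof.
have zero (z w : nat -> R) : \sum_(k < N) z k ^+ 2 <= 0 -> \sum_(k < N) z k * w k <= 0.
  move=> h; rewrite big1 // => k _.
  have /psumr_eq0P E : \sum_(k < N) z k ^+ 2 = 0.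
    by apply/le_anti; rewrite h sumr_ge0 // => i _; rewrite sqr_ge0.
  have /eqP : z k ^+ 2 = 0 by apply: E => // i _; rewrite sqr_ge0.
  by rewrite sqrf_eq0 => /eqP ->; rewrite mul0r.
move=> a0 b0 x0 y0 hx hy.
move: a0; rewrite le_eqVlt => /predU1P[a0|a0].
  by rewrite -a0 mul0r; apply: zero; rewrite -a0 expr0n in hx.
move: b0; rewrite le_eqVlt => /predU1P[b0|b0].
  rewrite -b0 mulr0; under eq_bigr do rewrite mulrC.
  by apply: zero; rewrite -b0 expr0n in hy.
have h (k : 'I_N) : true -> x k * y k <= (x k ^+ 2 * (b / a) + y k ^+ 2 * (a / b)) / 2.
  move=> _; rewrite -subr_ge0.
  have -> : (x k ^+ 2 * (b / a) + y k ^+ 2 * (a / b)) / 2 - x k * y k =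
            (x k * b - y k * a) ^+ 2 / (2 * a * b).
    by field; rewrite !gt_eqF.
  by rewrite divr_ge0 ?sqr_ge0 // !mulr_ge0 ?ltW.
apply: (le_trans (ler_sum _ h)).
rewrite -mulr_suml big_split /= -!mulr_suml ler_pdivrMr //.
have -> : a * b * 2 = a ^+ 2 * (b / a) + b ^+ 2 * (a / b).
  by field; rewrite !gt_eqF.
by rewrite lerD // ler_wpM2r // divr_ge0 // ltW.
Qed.

(** Multiplication by such a [t] turns sums of moduli into moduli of sums. *)
Lemma exists_phase {R : realType} (z : R[i]) : exists t : R[i], nm t <= 1 /\ t * z = (nm z)%:C.
Proof.
exists (Num.conj z / (nm z)%:C).
rewrite nmM nmV nmR nmconj ger0_norm ?nm_ge0 //; split.
  have [->|h] := eqVneq (nm z) 0; first by rewrite mul0r.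
  by rewrite divff.
rewrite mulrAC [_ * z]mulrC nmM_conj.
have [h|h] := eqVneq (nm z) 0; first by rewrite h expr0n /= mul0r.
by rewrite -fmorphV -rmorphM /= expr2 mulfK.
Qed.

Lemma sum_shift (V : nmodType) (M N : nat) (F : nat -> V) :
  \sum_(M <= i < M + N) F i = \sum_(i < N) F (M + i)%N.
Proof.
rewrite -{1}[M]add0n big_addn addKn big_mkord.
by apply: eq_bigr => i _; rewrite addnC.
Qed.

Section Nuclear.
Context {R : realType} {H : separable_hilbert R}.
Local Notation C := R[i].
Implicit Types u v w : H.

(** Zero vectors are allowed, as in [orthonormal_basis]; a finite family is
    padded by zeros. *)
Definition orthonormal_family (e : nat -> H) :=
  (forall i, e i = 0 \/ '[e i, e i] = 1) /\ (forall i j, i <> j -> '[e i, e j] = 0).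

(** Unlike orthonormal families, families with the Bessel inequality are
    stable under contractions and under taking coordinates in a finite Hilbert
    sum. *)
Definition bessel_family (N : nat) (e : nat -> H) :=
  forall v, \sum_(k < N) nm '[v, e k] ^+ 2 <= nm v ^+ 2.

Lemma bessel_map (T S : H -> H) N e :
  is_adjoint T S -> bounded_by T 1 -> bessel_family N e -> bessel_family N (fun k => T (e k)).
Proof.
move=> TS h1 he v.
under eq_bigr do rewrite -(adjC TS).
apply: (le_trans (he _)); rewrite ler_pXn2r ?nnegrE ?nm_ge0 //.
by have := adj_bounded TS ler01 h1 v; rewrite mul1r.
Qed.

Section OrthonormalFamily.
Variable e : nat -> H.
Hypothesis he : orthonormal_family e.

Lemma nm_orthonormal i : nm (e i) <= 1.
Proof.
case: (he.1 i) => [->|]; first by rewrite nm0 ler01.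
rewrite dot_nm => h; have /eqP : nm (e i) ^+ 2 = 1 by exact: complexI.
by rewrite sqrf_eq1 => /orP[] /eqP -> //; rewrite (@le_trans _ _ 0) // lerN10.
Qed.

Lemma orthonormal_absorb v i : '[v, e i] * '[e i, e i] = '[v, e i].
Proof. by case: (he.1 i) => ->; rewrite ?dot0r ?mul0r ?mulr1. Qed.

Definition partial_proj (N : nat) (v : H) : H := \sum_(k < N) '[v, e k] *: e k.

Lemma nm_orthonormal_sum (r : seq nat) (v : H) : uniq r ->
  nm (\sum_(k <- r) '[v, e k] *: e k) ^+ 2 = \sum_(k <- r) nm '[v, e k] ^+ 2.
Proof.
elim: r => [|k r IH] /=; first by rewrite !big_nil nm0 expr0n.
move=> /andP[kr ur]; rewrite !big_cons pythagoras ?IH //.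
  congr (_ + _); apply: complexI; rewrite -dot_nm dotZl dotZr mulrCA mulrA.
  by rewrite -mulrA orthonormal_absorb mulrC nmM_conj.
rewrite dot_sumr big_seq big1 // => j jr.
rewrite dotZl dotZr he.2 ?mulr0 // => E; by rewrite E jr in kr.
Qed.

Lemma nm_partial_proj N v : nm (partial_proj N v) ^+ 2 = \sum_(k < N) nm '[v, e k] ^+ 2.
Proof.
have := nm_orthonormal_sum v (iota_uniq 0 (N - 0)).
by rewrite -/(index_iota 0 N) !big_mkord.
Qed.

Lemma dot_partial_proj N v i : '[partial_proj N v, e i] = if (i < N)%N then '[v, e i] else 0.
Proof.
rewrite dot_suml; case: ltnP => iN.
  rewrite (bigD1 (Ordinal iN)) //= dotZl orthonormal_absorb big1 ?addr0 // => k ki.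
  by rewrite dotZl he.2 ?mulr0 // => E; move/eqP: ki; apply; apply: val_inj.
rewrite big1 // => k _; rewrite dotZl he.2 ?mulr0 // => E.
by move: iN; rewrite -E leqNgt ltn_ord.
Qed.

(** Pythagoras for the projection onto the first [N] vectors. *)
Lemma bessel_eq N v :
  nm v ^+ 2 = nm (v - partial_proj N v) ^+ 2 + \sum_(k < N) nm '[v, e k] ^+ 2.
Proof.
rewrite -nm_partial_proj -pythagoras ?subrK //.
rewrite dot_sumr big1 // => k _; rewrite dotZr dotBl dot_partial_proj ltn_ord.
by rewrite subrr mulr0.
Qed.

Lemma orthonormal_bessel N : bessel_family N e.
Proof. by move=> v; rewrite [X in _ <= X](bessel_eq N) lerDr sqr_ge0. Qed.

Lemma partial_proj_cauchy v : forall d : R, 0 < d ->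
  exists N, forall n, (N <= n)%N -> nm (partial_proj n v - partial_proj N v) < d.
Proof.
move=> d d0.
have d20 : 0 < d ^+ 2 by rewrite exprn_gt0.
have [|N hN] := @tail_small R (fun k => nm '[v, e k] ^+ 2) _ _ (orthonormal_bessel^~ v) _ d20.
  by move=> i; rewrite sqr_ge0.
exists N => n Nn; have := hN n Nn; rewrite -nm_orthonormal_sum ?iota_uniq //.
rewrite ltr_pXn2r ?nnegrE ?nm_ge0 ?(ltW d0) // => h.
suff -> : partial_proj n v - partial_proj N v = \sum_(N <= i < n) '[v, e i] *: e i by [].
rewrite /partial_proj -!(big_mkord xpredT (fun i => '[v, e i] *: e i)).
by rewrite (big_cat_nat (leq0n N) Nn) /= addrAC subrr add0r.
Qed.

End OrthonormalFamily.

Lemma basis_family e : orthonormal_basis e -> orthonormal_family e.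
Proof. by case. Qed.

(** The partial sums converge by completeness, and their limit has the same
    coefficients as [v]. *)
Lemma parseval e v : orthonormal_basis e -> tends_to (fun N => partial_proj e N v) v.
Proof.
move=> he; have on := basis_family he; case: he => _ _ hc.
have [w hw] := tends_to_complete (partial_proj_cauchy on v).
suff E : v = w by rewrite [X in tends_to _ X]E.
apply/eqP; rewrite -subr_eq0; apply/eqP/hc => i.
rewrite dotBl; apply/eqP; rewrite subr_eq0; apply/eqP.
apply: tends_to_uniq (tends_to_dotl (e i) hw).
by apply: (@tends_to_tail _ _ _ _ i.+1) => n ni; rewrite dot_partial_proj // ni.
Qed.

Lemma parseval_dot e u w : orthonormal_basis e ->
  tends_to (fun N => \sum_(k < N) '[e k, w] * '[u, e k]) '[u, w].
Proof.
move=> he; apply: eq_tends_to (tends_to_dotl w (parseval u he)) => N.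
by rewrite dot_suml; apply: eq_bigr => k _; rewrite dotZl mulrC.
Qed.

(** A series representation [T = sum_i <., a i> b i] with bound [c] on
    [sum_i |a i| |b i|], that is, on the nuclear norm. *)
Definition nuclear (T : H -> H) (c : R) :=
  exists a b : nat -> H, (forall N, \sum_(i < N) nm (a i) * nm (b i) <= c) /\
    forall v, tends_to (fun N => \sum_(i < N) '[v, a i] *: b i) (T v).

Lemma nuclear_ge0 T c : nuclear T c -> 0 <= c.
Proof. by case=> a [b [/(_ 0%N) + _]]; rewrite big_ord0. Qed.

Lemma nuclear_compl T B B' c d : 0 <= d -> is_adjoint B B' -> bounded_by B d -> nuclear T c ->
  nuclear (B \o T) (d * c).
Proof.
move=> d0 BB hB [a [b [hc hT]]]; exists a, (fun i => B (b i)); split.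
  move=> N; apply: le_trans (_ : d * (\sum_(i < N) nm (a i) * nm (b i)) <= _).
    rewrite mulr_sumr ler_sum // => i _; rewrite mulrCA ler_wpM2l ?nm_ge0 //.
  by rewrite ler_wpM2l.
move=> v; apply: eq_tends_to (tends_to_adj BB hB (hT v)) => N.
by rewrite (adj_sum BB); apply: eq_bigr => i _; rewrite (adj_Z BB).
Qed.

Lemma nuclear_compr T B B' c d : 0 <= d -> is_adjoint B B' -> bounded_by B d -> nuclear T c ->
  nuclear (T \o B) (d * c).
Proof.
move=> d0 BB hB [a [b [hc hT]]]; exists (fun i => B' (a i)), b; split.
  move=> N; apply: le_trans (_ : d * (\sum_(i < N) nm (a i) * nm (b i)) <= _).
    rewrite mulr_sumr ler_sum // => i _; rewrite mulrA ler_wpM2r ?nm_ge0 //.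
    by have := adj_bounded BB d0 hB (a i).
  by rewrite ler_wpM2l.
move=> v; apply: eq_tends_to (hT (B v)) => N.
by apply: eq_bigr => i _; rewrite BB.
Qed.

Lemma nuclear_bounded T c : nuclear T c -> bounded_by T c.
Proof.
move=> [a [b [hc hT]]] v; apply: tends_to_nm_le (hT v) _ => N.
apply: (le_trans (nm_sum _ _ _)).
apply: le_trans (ler_wpM2r (nm_ge0 v) (hc N)).
rewrite mulr_suml ler_sum // => i _; rewrite nmZ.
rewrite mulrAC ler_wpM2r ?nm_ge0 // mulrC.
exact: cauchy_schwarz.
Qed.

Lemma eq_nuclear T T' c : T =1 T' -> nuclear T c -> nuclear T' c.
Proof. by move=> /funext ->. Qed.

(** For a rank one operator this is the Cauchy-Schwarz inequality for the
    coefficients of [a] and [b]; the general case follows by summation. *)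
Lemma nuclear_bessel T c N e f : nuclear T c -> bessel_family N e -> bessel_family N f ->
  \sum_(k < N) nm '[T (e k), f k] <= c.
Proof.
move=> [a [b [hc hT]]] he hf.
have h M : \sum_(k < N) nm '[\sum_(i < M) '[e k, a i] *: b i, f k] <= c.
  apply: le_trans (hc M).
  apply: le_trans (_ : \sum_(k < N) \sum_(i < M) nm '[a i, e k] * nm '[b i, f k] <= _).
    apply: ler_sum => k _; rewrite dot_suml (le_trans (nm_sum _ _ _)) //.
    by apply: ler_sum => i _; rewrite dotZl nmM nm_dotC.
  rewrite exchange_big /= ler_sum // => i _.
  apply: (@sum_cauchy_schwarz R N (fun k => nm '[a i, e k]) (fun k => nm '[b i, f k]));
    by rewrite ?nm_ge0 // => *; rewrite ?nm_ge0.
pose t k := projT1 (cid (exists_phase '[T (e k), f k])).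
have t1 k : nm (t k) <= 1 by rewrite /t; case: (cid _) => /= z [].
have tE k : t k * '[T (e k), f k] = (nm '[T (e k), f k])%:C.
  by rewrite /t; case: (cid _) => /= z [].
have /tends_to_nm_le : tends_to (fun M => \sum_(k < N) t k * '[\sum_(i < M) '[e k, a i] *: b i, f k])
                      (\sum_(k < N) t k * '[T (e k), f k]).
  by apply: tends_to_sum => k; apply: tends_toMl; exact: tends_to_dotl.
move=> /(_ c) H1.
have : nm (\sum_(k < N) t k * '[T (e k), f k]) <= c.
  apply: H1 => M; apply: (le_trans (nm_sum _ _ _)); apply: le_trans (h M).
  by apply: ler_sum => k _; rewrite nmM ler_piMl ?nm_ge0.
under eq_bigr do rewrite tE.
by rewrite -rmorph_sum /= nmR ger0_norm // sumr_ge0 // => k _; rewrite nm_ge0.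
Qed.

(** The tails of the representing series are small. *)
Lemma nuclear_approx T c : nuclear T c -> forall d : R, 0 < d ->
  exists M, exists a b : nat -> H,
  nuclear (fun v => T v - \sum_(i < M) '[v, a i] *: b i) d.
Proof.
move=> [a [b [hc hT]]] d d0.
have [|M hM] := @tail_small R (fun i => nm (a i) * nm (b i)) _ _ hc _ d0.
  by move=> i; rewrite mulr_ge0 ?nm_ge0.
exists M, a, b, (fun i => a (M + i)%N), (fun i => b (M + i)%N); split.
  move=> N; have := hM (M + N)%N (leq_addr _ _).
  by rewrite sum_shift => /ltW.
move=> v.
have h2 := tends_toB (tends_to_sub (s := fun n => (M + n)%N) _ (hT v)) (tends_to_cst (\sum_(i < M) '[v, a i] *: b i)).
apply: eq_tends_to (h2 _) => N.
  rewrite -(big_mkord xpredT (fun i => '[v, a i] *: b i)).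
  rewrite -(big_mkord xpredT (fun i => '[v, a i] *: b i)).
  rewrite (big_cat_nat (leq0n M) (leq_addr _ _)) /= addrAC subrr add0r.
  by rewrite sum_shift.
by exists N => n h; rewrite (leq_trans h) // leq_addl.
Qed.

(** Up to an operator of small nuclear norm, [T] has finite rank, and for rank
    one operators the sum is [<b, a>] in every basis by Parseval. *)
Lemma nuclear_trace T c e f t : nuclear T c -> orthonormal_basis e -> orthonormal_basis f ->
  tends_to (fun N => \sum_(k < N) '[T (e k), e k]) t ->
  tends_to (fun N => \sum_(k < N) '[T (f k), f k]) t.
Proof.
move=> hT he hf ht.
have key g : orthonormal_basis g -> forall d : R, 0 < d -> forall M a b,
    nuclear (fun v => T v - \sum_(i < M) '[v, a i] *: b i) d ->
    exists N, forall n, (N <= n)%N ->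
    nm (\sum_(k < n) '[T (g k), g k] - \sum_(i < M) '[b i, a i]) < d + d.
  move=> hg d d0 M a b hn.
  have h : tends_to (fun n => \sum_(i < M) \sum_(k < n) '[g k, a i] * '[b i, g k])
               (\sum_(i < M) '[b i, a i]).
    by apply: tends_to_sum => i; exact: parseval_dot.
  have [N hN] := h d d0; exists N => n /hN h1.
  have h2 := nuclear_bessel hn (orthonormal_bessel (basis_family hg) n) (orthonormal_bessel (basis_family hg) n).
  have -> : \sum_(k < n) '[T (g k), g k] - \sum_(i < M) '[b i, a i] =
    \sum_(k < n) '[T (g k) - \sum_(i < M) '[g k, a i] *: b i, g k] +
    (\sum_(i < M) \sum_(k < n) '[g k, a i] * '[b i, g k] - \sum_(i < M) '[b i, a i]).
    rewrite addrA; congr (_ - _); rewrite exchange_big -big_split /=.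
    apply: eq_bigr => k _; rewrite dotBl dot_suml.
    by under [X in _ = _ - X + _]eq_bigr do rewrite dotZl; rewrite subrK.
  apply: (le_lt_trans (nmD _ _)); rewrite ler_ltD //.
  by apply: le_trans h2; exact: nm_sum.
move=> d d0; have d5 : 0 < d / 5 by lra.
have [M [a [b hn]]] := nuclear_approx hT d5.
have [N1 h1] := key e he _ d5 M a b hn.
have [N2 h2] := key f hf _ d5 M a b hn.
have [N3 h3] := ht _ d5.
exists N2 => n /h2 {}h2.
have {}h1 := h1 _ (leq_maxl N1 N3); have {}h3 := h3 _ (leq_maxr N1 N3).
apply: (le_lt_trans (nm_tri _ (\sum_(i < M) '[b i, a i]) _)).
set s := \sum_(i < M) _ in h1 h2 *.
set p := \sum_(k < maxn N1 N3) _ in h1 h3.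
have := nm_tri s p t; rewrite (nmBC s p); lra.
Qed.

Lemma is_traceP (f : H -> H) t : is_trace f t <->
  exists2 e, orthonormal_basis e & tends_to (fun N => \sum_(k < N) '[f (e k), e k]) t.
Proof.
split=> -[e he h]; exists e => //.
  by move/tends_toP: h; apply: eq_tends_to => n; rewrite /series /= big_mkord.
by apply/tends_toP; apply: eq_tends_to h => n; rewrite /series /= big_mkord.
Qed.

End Nuclear.

(** * Inverses by the method of continuity *)

Section Invert.
Context {R : realType} {H : separable_hilbert R}.
Local Notation C := R[i].
Implicit Types u v w : H.

(** If the steps are bounded by those of a bounded real sequence, the sequence
    is Cauchy. *)
Lemma tends_to_mono (f : nat -> H) (s : nat -> R) c :
  (forall n, nm (f n.+1 - f n) <= s n.+1 - s n) -> (forall n, s n <= c) ->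
  exists l, tends_to f l.
Proof.
move=> h hc; apply: tends_to_complete => e e0.
have [|N hN] := @mono_cauchy _ s c _ hc e e0.
  by move=> n; rewrite -subr_ge0 (le_trans (nm_ge0 _) (h n)).
exists N => n Nn; apply: le_lt_trans (hN n Nn).
elim: n Nn => [|n IH]; first by rewrite leqn0 => /eqP ->; rewrite !subrr nm0.
rewrite leq_eqVlt => /predU1P[<-|Nn]; first by rewrite !subrr nm0.
by apply: (le_trans (nm_tri _ (f n) _)); have := h n; have := IH Nn; lra.
Qed.

Definition additive_map (T : H -> H) := forall u v, T (u - v) = T u - T v.

(** The iterates of [u |-> v + B u] move by at most [q ^ n |v|]. *)
Lemma contraction (B : H -> H) (q : R) : 0 <= q -> q < 1 -> additive_map B -> bounded_by B q ->
  forall v, exists u, u = v + B u.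
Proof.
move=> q0 q1 aB hB v.
pose f := fix f n := if n is n'.+1 then v + B (f n') else 0.
have B0 : B 0 = 0 by rewrite -(subrr 0) aB !subrr.
have hf n : nm (f n.+1 - f n) <= q ^+ n * nm v.
  elim: n => [|n IH]; first by rewrite /= B0 addr0 subr0 expr0 mul1r.
  have -> : f n.+2 - f n.+1 = B (f n.+1 - f n).
    by rewrite aB /= opprD addrACA subrr add0r.
  by rewrite (le_trans (hB _)) // exprS -mulrA ler_wpM2l.
have p1 : 0 < 1 - q by rewrite subr_gt0.
have [||l hl] := @tends_to_mono f (fun n => - (nm v / (1 - q) * q ^+ n)) 0.
- move=> n; apply: (le_trans (hf n)); rewrite exprS le_eqVlt; apply/orP; left.
  by apply/eqP; field; rewrite gt_eqF.
- by move=> n; rewrite oppr_le0 mulr_ge0 ?exprn_ge0 // divr_ge0 ?nm_ge0 // ltW.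
exists l.
have h1 := tends_to_S hl.
apply: (tends_to_uniq h1); apply: tends_toD; first exact: tends_to_cst.
by apply: (tends_to_map (c := q) _ hl) => u w; rewrite -aB.
Qed.

Definition onto_op (S : H -> H) := forall v, exists u, S u = v.

(** With [G] the right inverse of [S], a solution is [G y] where
    [y = v - E (G y)], and [E G] is a contraction. *)
Lemma onto_op_perturb (S E : H -> H) (d h : R) : 0 < d -> 0 <= h -> h < d ->
  additive_map S -> additive_map E -> (forall u, d * nm u <= nm (S u)) -> onto_op S -> bounded_by E h ->
  onto_op (fun u => S u + E u).
Proof.
move=> d0 h0 hd aS aE low sS hE v.
pose G w := projT1 (cid (sS w)).
have SG w : S (G w) = w by rewrite /G; case: (cid _).
have Sinj u w : S u = S w -> u = w.
  move=> E1; apply/eqP; rewrite -subr_eq0; apply/eqP/nm_eq0/le_anti.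
  rewrite nm_ge0 andbT -(ler_pM2l d0) mulr0.
  by rewrite (le_trans (low _)) // aS E1 subrr nm0.
have aG : additive_map G by move=> u w; apply: Sinj; rewrite aS !SG.
have [||||y Ey] := @contraction (fun y => - E (G y)) (h / d) _ _ _ _ v.
- by rewrite divr_ge0 // ltW.
- by rewrite ltr_pdivrMr // mul1r.
- by move=> u w; rewrite aG aE opprD.
- move=> w; rewrite nmN (le_trans (hE _)) // -mulrA ler_wpM2l //.
  by rewrite mulrC ler_pdivlMr // mulrC (le_trans (low _)) // SG.
by exists (G y); rewrite SG {1}Ey subrK.
Qed.

(** Surjectivity passes from [A + t B] to [A + t' B] when [|t - t'| c < d], and
    finitely many such steps lead from [0] to [1]. *)
Lemma continuity_method (A B : H -> H) (d c : R) : 0 < d -> 0 <= c ->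
  additive_map A -> additive_map B -> bounded_by B c ->
  (forall t : R, 0 <= t -> t <= 1 -> forall u, d * nm u <= nm (A u + t%:C *: B u)) ->
  onto_op A -> onto_op (fun u => A u + B u).
Proof.
move=> d0 c0 aA aB hB low sA.
(* steps of length [1 / (N + 1)] perturb by less than [d] *)
pose N := Num.bound (c / d).
have hN : c / N.+1%:R < d.
  rewrite ltr_pdivrMr ?ltr0n // mulrC -ltr_pdivrMr //.
  apply: lt_le_trans (_ : N%:R <= _); last by rewrite ler_nat.
  by apply: archi_boundP; rewrite divr_ge0 // ltW.
have aZ (a : C) : additive_map (fun u => a *: B u) by move=> u v; rewrite aB scalerBr.
have step j : (j <= N.+1)%N -> onto_op (fun u => A u + (j%:R / N.+1%:R)%:C *: B u).
  elim: j => [|j IH] jN.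
    by move=> v; have [u hu] := sA v; exists u; rewrite mul0r scale0r addr0.
  have hs := @onto_op_perturb (fun u => A u + (j%:R / N.+1%:R)%:C *: B u)
     (fun u => (N.+1%:R^-1)%:C *: B u) d (c / N.+1%:R) d0 _ hN _ (aZ _) _ (IH (ltnW jN)) _.
  move=> v; have [||||u hu] := hs _ _ _ _ v.
  - by rewrite divr_ge0.
  - by move=> u w; rewrite aA aZ opprD addrACA.
  - apply: low; first by rewrite divr_ge0.
    by rewrite ler_pdivrMr ?ltr0n // mul1r ler_nat ltnW.
  - move=> u; rewrite nmZ nmR ger0_norm ?invr_ge0 //.
    by rewrite [c / _]mulrC -mulrA ler_wpM2l ?invr_ge0.
  exists u; rewrite -hu -addrA -scalerDl -rmorphD /=.
  by rewrite -natr1 mulrDl mul1r.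
move=> v; have [u hu] := step N.+1 (leqnn _) v; exists u.
by rewrite -hu divff ?scale1r // pnatr_eq0.
Qed.

Lemma adj_additive_map (T S : H -> H) : is_adjoint T S -> additive_map T.
Proof. by move=> h u v; rewrite (adj_B h). Qed.

Lemma adj_scale (T S : H -> H) (a : C) : is_adjoint T S ->
  is_adjoint (fun v => a *: T v) (fun v => Num.conj a *: S v).
Proof. by move=> h u v; rewrite dotZl dotZr conjCK h. Qed.

(** [|q u + e u| >= e |u|] for positive [q], which lets the method of continuity
    reach [q + e] from [e]. *)
Lemma positive_resolvent (q : H -> H) c (e : R) : 0 < e -> 0 <= c -> is_adjoint q q ->
  positive_op q -> bounded_by q c ->
  exists J : H -> H, [/\ is_adjoint J J,
    forall v, q (J v) + e%:C *: J v = v,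
    forall v, J (q v) + e%:C *: J v = v,
    forall v, e * nm (J v) <= nm v & forall v, nm (q (J v)) <= nm v].
Proof.
move=> e0 c0 qq pq bq.
have ineq (t : R) u : 0 <= t ->
    nm (t%:C *: q u) ^+ 2 + (e * nm u) ^+ 2 <= nm (e%:C *: u + t%:C *: q u) ^+ 2.
  move=> t0; have E1 : nm (e%:C *: u) = e * nm u by rewrite nmZ nmR gtr0_norm.
  rewrite nmD2 E1 (addrC ((e * nm u) ^+ 2)) lerDl.
  rewrite mulrn_wge0 // dotZl dotZr.
  have -> : Num.conj (t%:C : C) = t%:C by rewrite -[Num.conj _]/(conjc _) conjc_real.
  rewrite -qq (ge0_nm (pq u)) -!rmorphM /=.
  by rewrite !mulr_ge0 ?nm_ge0 // ltW.
have low (t : R) u : 0 <= t -> e * nm u <= nm (e%:C *: u + t%:C *: q u).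
  move=> t0; rewrite -(@ler_pXn2r _ 2) ?nnegrE ?nm_ge0 //; last by rewrite mulr_ge0 ?nm_ge0 // ltW.
  by apply: le_trans (ineq t u t0); rewrite lerDr sqr_ge0.
have eC : e%:C != 0 :> C by rewrite -(rmorph0 (real_complex R)) (inj_eq (@complexI _)) gt_eqF.
have sj : onto_op (fun u => e%:C *: u + q u).
  apply: (@continuity_method _ q e c e0 c0 _ (adj_additive_map qq) bq) => [u v|t t0 _ u|v].
  - by rewrite scalerBr.
  - exact: low.
  - by exists (e%:C^-1 *: v); rewrite scalerA divff ?scale1r.
pose J v := projT1 (cid (sj v)).
have JE v : e%:C *: J v + q (J v) = v by rewrite /J; case: (cid _).
have uniq_sol u v : e%:C *: u + q u = e%:C *: v + q v -> u = v.
  move=> E; apply/eqP; rewrite -subr_eq0; apply/eqP/nm_eq0/le_anti.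
  rewrite nm_ge0 andbT -(ler_pM2l e0) mulr0 (le_trans (low 1 _ ler01)) //.
  by rewrite scale1r (adj_B qq) scalerBr addrACA -opprD E subrr nm0.
have JJ u : J (e%:C *: u + q u) = u by apply: uniq_sol; rewrite JE.
have sa : is_adjoint (fun u => e%:C *: u + q u) (fun u => e%:C *: u + q u).
  move=> u v; rewrite dotDl dotDr dotZl dotZr qq.
  by rewrite -[Num.conj _]/(conjc _) conjc_real.
have Ja : is_adjoint J J.
  by move=> u v; rewrite -{1}(JE v) -sa JE.
exists J; split=> // [v|v|v|v].
- by rewrite addrC.
- by rewrite -[RHS]JJ (adj_D Ja) (adj_Z Ja) addrC.
- by have := low 1 (J v) ler01; rewrite scale1r JE.
- rewrite -(@ler_pXn2r _ 2) ?nnegrE ?nm_ge0 //.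
  have := ineq 1 (J v) ler01; rewrite !scale1r JE; apply: le_trans.
  by rewrite lerDl sqr_ge0.
Qed.

End Invert.

(** * Square roots of positive operators *)

Section Sqrt.
Context {R : realType} {H : separable_hilbert R}.
Local Notation C := R[i].
Implicit Types u v w : H.

Lemma conjR (x : R) : Num.conj (x%:C : C) = x%:C.
Proof. by rewrite -[Num.conj _]/(conjc _) conjc_real. Qed.

(** Polarization: [<p w, w>] is real at [w = u + v] and at [w = u + i v]. *)
Lemma positive_selfadjoint (p : {linear H -> H}) : positive_op p -> is_adjoint p p.
Proof.
move=> hp u v.
have re w : complex.Im '[p w, w] = 0 by rewrite ger0_Im.
have h1 : complex.Im ('[p u, v] + '[p v, u]) = 0.
  have := re (u + v); rewrite (linearD p) dotDl !dotDr !raddfD /= !re.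
  by rewrite addr0 add0r.
have h2 : complex.Im ('i * ('[p v, u] - '[p u, v])) = 0.
  have := re (u + 'i *: v); rewrite (linearD p) (linearZZ p) dotDl !dotDr !dotZl !dotZr.
  have -> : Num.conj ('i : C) = - 'i by apply/eqP; rewrite eq_complex /= oppr0 !eqxx.
  rewrite mulrA mulrN -expr2 sqr_i opprK mul1r !raddfD /= !re addr0 add0r.
  rewrite -raddfD /= => <-; congr complex.Im; ring.
rewrite -[RHS]conj_dot; move: h1 h2; case: '[p u, v] => a b; case: '[p v, u] => c d /=.
move=> h1 h2; apply/eqP; rewrite eq_complex /=; apply/andP; split; apply/eqP; lra.
Qed.

(** Polarization at [v +- w] with [w] the multiple of [A v] that has the norm of
    [v], and the parallelogram law. *)
Lemma selfadjoint_bounded (A : H -> H) : is_adjoint A A ->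
  (forall v, `|complex.Re '[A v, v]| <= nm v ^+ 2) -> bounded_by A 1.
Proof.
move=> AA hA v; rewrite mul1r.
have [->|h] := eqVneq (A v) 0; first by rewrite nm0 nm_ge0.
have [->|hv] := eqVneq v 0; first by rewrite (adj_0 AA) nm0.
have a0 := nm_gt0 h; have v0 := nm_gt0 hv.
pose w := (nm v / nm (A v))%:C *: A v.
have nw : nm w = nm v by rewrite nmZ nmR ger0_norm ?divr_ge0 ?nm_ge0 // divfK ?gt_eqF.
have E : complex.Re ('[A (v + w), v + w] - '[A (v - w), v - w]) =
   4 * (nm v * nm (A v)).
  have E1 : '[A v, w] = (nm v * nm (A v))%:C.
    rewrite dotZr conjR dot_nm -rmorphM /=; congr (_%:C); field.
    by rewrite gt_eqF.
  have E2 : '[A w, v] = (nm v * nm (A v))%:C by rewrite AA -conj_dot E1 conjR.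
  rewrite (adj_D AA) (adj_B AA) dotDl dotBl !dotDr !dotNr E1 E2.
  rewrite (_ : _ - _ = 4 * (nm v * nm (A v))%:C); last by ring.
  rewrite -[4]/(4%:R) -(rmorph_nat (real_complex R)) -rmorphM /=.
  by [].
have h1 := hA (v + w); have h2 := hA (v - w).
have h3 : nm (v + w) ^+ 2 + nm (v - w) ^+ 2 = 4 * nm v ^+ 2.
  rewrite !nmD2 nmN dotNr raddfN /= nw; ring.
have : 4 * (nm v * nm (A v)) <= 4 * nm v ^+ 2.
  rewrite -E -h3 raddfB /=; move: h1 h2; rewrite !ler_norml.
  move=> /andP[_ h1] /andP[h2 _]; lra.
by rewrite ler_pM2l // expr2 ler_pM2l.
Qed.

Section Iteration.
Variable A : H -> H.
Hypotheses (AA : is_adjoint A A) (A1 : bounded_by A 1).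

Let half : C := (2^-1)%:C.

(** The iteration [Y |-> (A + Y^2) / 2], with limit [1 - sqrt (1 - A)]. *)
Fixpoint sqrt_iter (n : nat) (v : H) : H :=
  if n is m.+1 then half *: (A v + sqrt_iter m (sqrt_iter m v)) else 0.

(** The same iteration for the norm bounds, starting from [|A| <= 1]. *)
Fixpoint sqrt_bound (n : nat) : R := if n is m.+1 then (1 + sqrt_bound m ^+ 2) / 2 else 0.

Lemma sqrt_bound01 n : 0 <= sqrt_bound n <= 1.
Proof.
elim: n => [|n /andP[h0 h1]] /=; first by rewrite lexx ler01.
have : sqrt_bound n ^+ 2 <= 1 by rewrite expr_le1.
have := sqr_ge0 (sqrt_bound n); lra.
Qed.

Lemma sqrt_iter_adj n : is_adjoint (sqrt_iter n) (sqrt_iter n).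
Proof.
elim: n => [|n IH] u v /=; first by rewrite dot0l dot0r.
by rewrite dotZl dotZr dotDl dotDr AA !IH conjR.
Qed.

Lemma sqrt_iter_bounded n : bounded_by (sqrt_iter n) (sqrt_bound n).
Proof.
elim: n => [|n IH] v /=; first by rewrite nm0 mul0r.
rewrite nmZ nmR ger0_norm // [_ / 2]mulrC -mulrA ler_wpM2l //.
rewrite (le_trans (nmD _ _)) // mulrDl lerD // expr2 -mulrA.
by rewrite (le_trans (IH _)) // ler_wpM2l //; case/andP: (sqrt_bound01 n).
Qed.

(** The scalar iteration dominates the steps as well, as
    [Y'^2 - Y^2 = Y' (Y' - Y) + (Y' - Y) Y]. *)
Lemma sqrt_iter_diff n v : nm (sqrt_iter n.+1 v - sqrt_iter n v) <= (sqrt_bound n.+1 - sqrt_bound n) * nm v.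
Proof.
elim: n v => [|n IH] v.
  by have := sqrt_iter_bounded 1 v; rewrite !subr0.
have -> : sqrt_iter n.+2 v - sqrt_iter n.+1 v =
  half *: (sqrt_iter n.+1 (sqrt_iter n.+1 v - sqrt_iter n v) + (sqrt_iter n.+1 (sqrt_iter n v) - sqrt_iter n (sqrt_iter n v))).
  rewrite (adj_B (sqrt_iter_adj n.+1)) addrA subrK.
  rewrite -[sqrt_iter n.+2 v]/(half *: (A v + sqrt_iter n.+1 (sqrt_iter n.+1 v))).
  rewrite -[X in _ - X]/(half *: (A v + sqrt_iter n (sqrt_iter n v))).
  by rewrite -scalerBr; congr (_ *: _); rewrite opprD addrACA subrr add0r.
rewrite nmZ nmR ger0_norm //.
have -> : sqrt_bound n.+2 - sqrt_bound n.+1 = 2^-1 * (sqrt_bound n.+1 * (sqrt_bound n.+1 - sqrt_bound n) + (sqrt_bound n.+1 - sqrt_bound n) * sqrt_bound n).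
  rewrite -[sqrt_bound n.+2]/((1 + sqrt_bound n.+1 ^+ 2) / 2) -[X in _ - X]/((1 + sqrt_bound n ^+ 2) / 2).
  by field.
rewrite -mulrA ler_wpM2l // (le_trans (nmD _ _)) // mulrDl lerD //.
  rewrite (le_trans (sqrt_iter_bounded _ _)) // -mulrA ler_wpM2l //.
  by case/andP: (sqrt_bound01 n.+1).
rewrite (le_trans (IH _)) // -mulrA ler_wpM2l ?sqrt_iter_bounded //.
elim: n {IH} => [|n IH]; first by rewrite /= expr0n /= addr0 subr0 mul1r invr_ge0.
rewrite -[sqrt_bound n.+2]/((1 + sqrt_bound n.+1 ^+ 2) / 2) -[X in _ - X]/((1 + sqrt_bound n ^+ 2) / 2).
have -> : (1 + sqrt_bound n.+1 ^+ 2) / 2 - (1 + sqrt_bound n ^+ 2) / 2 =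
  (sqrt_bound n.+1 - sqrt_bound n) * (sqrt_bound n.+1 + sqrt_bound n) / 2 by field.
rewrite divr_ge0 // mulr_ge0 // addr_ge0 //.
  by case/andP: (sqrt_bound01 n.+1).
by case/andP: (sqrt_bound01 n).
Qed.

Lemma sqrt_iter_cvg v : exists l, tends_to (fun n => sqrt_iter n v) l.
Proof.
apply: (@tends_to_mono _ _ _ (fun n => sqrt_bound n * nm v) (nm v)) => n.
  by rewrite -mulrBl sqrt_iter_diff.
by rewrite ler_piMl ?nm_ge0 //; case/andP: (sqrt_bound01 n).
Qed.

Lemma sqrt_iter_lim : exists Y : H -> H, [/\ is_adjoint Y Y, bounded_by Y 1 &
  forall v, Y v = half *: (A v + Y (Y v))].
Proof.
pose Y v := projT1 (cid (sqrt_iter_cvg v)).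
have hY v : tends_to (fun n => sqrt_iter n v) (Y v) by rewrite /Y; case: (cid _).
have b1 n : bounded_by (sqrt_iter n) 1 by apply: bounded_by_le (sqrt_iter_bounded n); case/andP: (sqrt_bound01 n).
have YY : is_adjoint Y Y.
  move=> u v; apply: tends_to_uniq (tends_to_dotl v (hY u)) _.
  by apply: eq_tends_to (tends_to_dotr u (hY v)) => n; rewrite -sqrt_iter_adj.
exists Y; split=> //.
  by move=> v; apply: tends_to_nm_le (hY v) _ => n; exact: b1.
move=> v; apply: (tends_to_uniq (tends_to_S (hY v))) => /=.
apply: tends_toZ; apply: tends_toD; first exact: tends_to_cst.
have -> : Y (Y v) = 0 + Y (Y v) by rewrite add0r.
have h : tends_to (fun n => sqrt_iter n (sqrt_iter n v - Y v)) 0.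
  move=> e e0; have [N hN] := hY v e e0; exists N => n /hN h.
  by rewrite subr0; apply: le_lt_trans h; rewrite -[X in _ <= X]mul1r; exact: b1.
apply: eq_tends_to (tends_toD h (hY (Y v))) => n.
by rewrite (adj_B (sqrt_iter_adj n)) subrK.
Qed.
End Iteration.

(** After scaling, [A = 1 - q / k] satisfies [0 <= A <= 1], and the limit [Y] of
    the iteration has [(1 - Y)^2 = 1 - A = q / k]. *)
Lemma positive_sqrt (q : H -> H) c : 0 <= c -> is_adjoint q q -> positive_op q -> bounded_by q c ->
  exists Q d, [/\ 0 <= d, is_adjoint Q Q, positive_op Q, bounded_by Q d & forall v, Q (Q v) = q v].
Proof.
move=> c0 qq pq bq; pose k := c + 1.
have k0 : 0 < k by rewrite ltr_wpDl.
have bk : bounded_by q k by apply: bounded_by_le bq; rewrite lerDl.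
pose A v := v - (k^-1)%:C *: q v.
have AA : is_adjoint A A by move=> u v; rewrite dotBl dotBr dotZl dotZr conjR qq.
have A1 : bounded_by A 1.
  apply: selfadjoint_bounded => // v.
  have h1 : nm '[q v, v] <= k * nm v ^+ 2.
    by rewrite (le_trans (cauchy_schwarz _ _)) // expr2 mulrA ler_wpM2r ?nm_ge0.
  rewrite dotBl dotZl dot_nm (ge0_nm (pq v)) -rmorphM -rmorphB /=.
  have h2 := nm_ge0 '[q v, v].
  have h3 : k^-1 * nm '[q v, v] <= nm v ^+ 2 by rewrite mulrC ler_pdivrMr // mulrC.
  have h4 : 0 <= k^-1 * nm '[q v, v] by rewrite mulr_ge0 // invr_ge0 ltW.
  rewrite ler_norml; apply/andP; split; last by lra.
  have := sqr_ge0 (nm v); lra.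
have [Y [YY bY EY]] := sqrt_iter_lim AA A1.
pose s := Num.sqrt k; have s0 : 0 <= s by exact: sqrtr_ge0.
have ss : s * s = k by rewrite -expr2 sqr_sqrtr // ltW.
exists (fun v => s%:C *: (v - Y v)), (s * 2); split=> [||v|v|v].
- by rewrite mulr_ge0.
- by move=> u v; rewrite dotZl dotZr dotBl dotBr YY conjR.
- have hr : '[Y v, v] = (complex.Re '[Y v, v])%:C.
    have : Num.conj '[Y v, v] = '[Y v, v] by rewrite conj_dot YY.
    rewrite -[Num.conj _]/(conjc _); case: '[Y v, v] => a b [hb].
    by apply/eqP; rewrite eq_complex /= eqxx /=; apply/eqP; lra.
  rewrite dotZl mulr_ge0 ?ler0c // dotBl dot_nm hr -rmorphB /= ler0c subr_ge0.
  rewrite (le_trans (Re_le_nm _)) // (le_trans (cauchy_schwarz _ _)) //.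
  by rewrite expr2 ler_wpM2r ?nm_ge0 // -[X in _ <= X]mul1r.
- rewrite nmZ nmR ger0_norm // -mulrA ler_wpM2l // (le_trans (nmB _ _)) //.
  by have := bY v; lra.
- rewrite (adj_Z YY) (adj_B YY) -scalerBr scalerA -rmorphM /= ss.
  have gen (a b d : H) : a + a = d + b -> v - a - (a - b) = v - d.
    move=> E; have -> : d = a + a - b by rewrite E addrK.
    by rewrite -[a + a - b]addrA [in RHS]opprD [RHS]addrA.
  have E2 : Y v + Y v = A v + Y (Y v).
    rewrite {1 2}(EY v) -scalerDl -[RHS]scale1r; congr (_ *: _).
    rewrite -(rmorph1 (real_complex R)) -rmorphD /=; congr (_%:C).
    by field.
  rewrite (gen _ _ _ E2) /A subKr scalerA -rmorphM /= divff ?gt_eqF //.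
  by rewrite scale1r.
Qed.

End Sqrt.

(** * Trace class operators and nuclear operators *)

Section TraceClass.
Context {R : realType} {H : separable_hilbert R}.
Local Notation C := R[i].
Implicit Types u v w : H.

Lemma partial_sum_le (a : nat -> R) (t : C) :
  (forall k, 0 <= a k) -> tends_to (fun N => (\sum_(k < N) a k)%:C : C) t ->
  forall N, \sum_(k < N) a k <= nm t.
Proof.
move=> a0 ht N; apply/ler_addgt0Pr => e e0.
have [M hM] := ht e e0.
have := hM (N + M)%N (leq_addl _ _).
have := nm_sub_ge ((\sum_(k < N + M) a k)%:C : C) t.
rewrite nmR ger0_norm ?sumr_ge0 // big_split_ord /=.
have : 0 <= \sum_(i < M) a (N + i)%N by apply: sumr_ge0.
lra.
Qed.

Lemma mono_tends_to (s : nat -> R) c :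
  (forall n, s n <= s n.+1) -> (forall n, s n <= c) ->
  exists t : R, tends_to (fun n => (s n)%:C : C) t%:C.
Proof.
move=> mono bdd.
have hs : has_sup (range s).
  by split; [exists (s 0%N), 0%N | exists c => _ [n _ <-]].
exists (sup (range s)) => e e0.
have [_ [N _ <-] hN] := sup_adherent e0 hs.
exists N => n Nn; rewrite -rmorphB nmR distrC ger0_norm.
  have : s N <= s n.
    elim: n Nn => [|n IH]; first by rewrite leqn0 => /eqP ->.
    rewrite leq_eqVlt => /predU1P[<- //|/IH]; move/le_trans; apply; exact: mono.
  lra.
by rewrite subr_ge0; apply: ub_le_sup; [exact: hs.2 | exists n].
Qed.

(** Let [p = |x|] and [Q = sqrt p].  The operators [x (Q + e)^-1] converge in norm
    as [e -> 0] to some [y] with [|y v| <= |Q v|] and [y Q = x]; hence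
    [x = sum_i <., Q e_i> y e_i], and [sum_i |Q e_i|^2 = Tr p]. *)
Lemma trace_class_nuclear (x : {linear H -> H}) : trace_class_op x -> exists c, nuclear x c.
Proof.
case=> xcont [xs [p [xxs [pcont pp] ppE [t /is_traceP[e he ht]]]]].
have pa := positive_selfadjoint pp.
have [c c0 bp] := continuous_bounded pcont.
have [Q [d [d0 QQ pQ bQ QQp]]] := positive_sqrt c0 pa pp bp.
have nx v : nm (x v) = nm (p v).
  apply/eqP; rewrite -(@eqrXn2 _ 2) ?nm_ge0 //; apply/eqP.
  by apply: complexI; rewrite -!dot_nm xxs -ppE pa.
pose eps n : R := n.+1%:R^-1.
have eps0 n : 0 < eps n by rewrite invr_gt0 ltr0n.
pose J n := projT1 (cid (positive_resolvent (eps0 n) d0 QQ pQ bQ)).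
have J1 n v : Q (J n v) + (eps n)%:C *: J n v = v.
  by rewrite /J; case: (cid _) => /= j [].
have J2 n v : J n (Q v) + (eps n)%:C *: J n v = v.
  by rewrite /J; case: (cid _) => /= j [].
have J4 n v : nm (Q (J n v)) <= nm v by rewrite /J; case: (cid _) => /= j [].
have J5 n v : Q (J n v) = J n (Q v).
  by apply: (addIr ((eps n)%:C *: J n v)); rewrite J1 J2.
have QJ n v : Q (J n v) = v - (eps n)%:C *: J n v by rewrite -[X in _ = X - _](J1 n v) addrK.
have hy v : exists l, tends_to (fun n => x (J n v)) l.
  apply: tends_to_complete => r r0.
  have r1 : 0 < r / (2 * (nm v + 1)) by rewrite divr_gt0 // mulr_gt0 // ltr_wpDl ?nm_ge0.
  have [N hN] := inv_small r1; exists N => n Nn.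
  rewrite -(linearB x) nx -QQp (adj_B QQ) !QJ opprB addrC addrA subrK.
  rewrite (adj_B QQ) !(adj_Z QQ) (le_lt_trans (nmB _ _)) // !nmZ !nmR !gtr0_norm //.
  have h1 := hN n Nn; have h2 := hN N (leqnn N).
  have n1 : 0 < nm v + 1 by rewrite ltr_wpDl ?nm_ge0.
  rewrite ltr_pdivlMr ?mulr_gt0 // in h1; rewrite ltr_pdivlMr ?mulr_gt0 // in h2.
  have k1 : eps N * nm (Q (J N v)) <= eps N * (nm v + 1).
    by rewrite (ler_wpM2l (ltW (eps0 _))) // (le_trans (J4 _ _)) // lerDl.
  have k2 : eps n * nm (Q (J n v)) <= eps n * (nm v + 1).
    by rewrite (ler_wpM2l (ltW (eps0 _))) // (le_trans (J4 _ _)) // lerDl.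
  rewrite -/(eps n) in h1; rewrite -/(eps N) in h2; lra.
pose y v := projT1 (cid (hy v)).
have yE v : tends_to (fun n => x (J n v)) (y v) by rewrite /y; case: (cid _).
have Jlin n : is_adjoint (J n) (J n) by rewrite /J; case: (cid _) => /= j [].
have ylin a u v : y (a *: u + v) = a *: y u + y v.
  apply: tends_to_uniq (yE _) _; apply: eq_tends_to (tends_toD (tends_toZ a (yE u)) (yE v)) => n.
  by rewrite (adj_lin (Jlin n)) linearP.
have yD u v : y (u + v) = y u + y v by rewrite -[u]scale1r ylin !scale1r.
have y0 : y 0 = 0 by apply: (addrI (y 0)); rewrite -yD !addr0.
have yZ a u : y (a *: u) = a *: y u by rewrite -[a *: u]addr0 ylin y0 addr0.
have yB u v : y (u - v) = y u - y v.
  by rewrite yD -scaleN1r yZ scaleN1r.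
have ysum (I : Type) (r : seq I) F : y (\sum_(i <- r) F i) = \sum_(i <- r) y (F i).
  by elim: r => [|i r IH]; rewrite ?big_nil ?y0 // !big_cons yD IH.
have ny v : nm (y v) <= nm (Q v).
  apply: tends_to_nm_le (yE v) _ => n; rewrite nx -QQp J5; exact: J4.
have yQ v : y (Q v) = x v.
  apply: tends_to_uniq (yE _) _.
  apply: (tends_to_squeeze (g := fun n => eps n * (d * nm v))) => [n|r r0].
    rewrite -J5 QJ linearB addrAC subrr add0r nmN (linearZZ x) nmZ nmR gtr0_norm //.
    rewrite (ler_wpM2l (ltW (eps0 _))) // nx -QQp (le_trans (bQ _)) // ler_wpM2l //.
  have n1 : 0 < d * nm v + 1 by rewrite ltr_wpDl // mulr_ge0 ?nm_ge0.
  have r1 : 0 < r / (d * nm v + 1) by rewrite divr_gt0.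
  have [N hN] := inv_small r1; exists N => n /hN; rewrite -/(eps n) ltr_pdivlMr //.
  by apply: le_lt_trans; rewrite (ler_wpM2l (ltW (eps0 _))) // lerDl.
exists (nm t), (fun i => Q (e i)), (fun i => y (e i)); split.
  move=> N; apply: le_trans (_ : \sum_(i < N) nm (Q (e i)) ^+ 2 <= _).
    by apply: ler_sum => i _; rewrite expr2 ler_wpM2l ?nm_ge0.
  apply: (@partial_sum_le (fun i => nm (Q (e i)) ^+ 2)) => [k|]; first exact: sqr_ge0.
  apply: eq_tends_to ht => n; rewrite rmorph_sum /=; apply: eq_bigr => k _.
  by rewrite -dot_nm QQ -QQp QQ.
move=> v.
have h := parseval (Q v) he.
have := tends_to_map (T := y) (c := d) _ h; rewrite yQ; move=> /(_ _)h2.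
apply: eq_tends_to (h2 _) => [n|u w].
  by rewrite ysum; apply: eq_bigr => k _; rewrite yZ QQ.
by rewrite -yB (le_trans (ny _)).
Qed.

(** The adjoint is represented by the same series with [a] and [b] exchanged. *)
Lemma nuclear_adj (T S : H -> H) c : is_adjoint T S -> nuclear T c -> nuclear S c.
Proof.
move=> TS [a [b [hc hT]]]; exists b, a; split.
  by move=> N; under eq_bigr do rewrite mulrC; exact: hc.
move=> v; have [||w hw] := @tends_to_mono _ _ (fun N => \sum_(i < N) '[v, b i] *: a i)
    (fun N => nm v * \sum_(i < N) nm (a i) * nm (b i)) (nm v * c).
- move=> N; rewrite !big_ord_recr /= addrAC subrr add0r mulrDr addrAC subrr add0r.
  rewrite nmZ mulrCA mulrC ler_wpM2l ?nm_ge0 //.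
  exact: cauchy_schwarz.
- by move=> N; rewrite ler_wpM2l ?nm_ge0.
suff -> : S v = w by [].
apply: dot_ext2 => u; rewrite (adjC TS) -[RHS]conj_dot.
have h : tends_to (fun N => \sum_(i < N) '[u, a i] * '[b i, v]) '[T u, v].
  apply: eq_tends_to (tends_to_dotl v (hT u)) => N; rewrite dot_suml.
  by apply: eq_bigr => i _; rewrite dotZl.
have h2 := tends_to_uniq h _.
rewrite -conj_dot; congr (Num.conj _); apply: h2.
apply: eq_tends_to (tends_to_dotr u hw) => N; rewrite dot_sumr.
by apply: eq_bigr => i _; rewrite dotZr conj_dot mulrC.
Qed.

(** The nuclear norm bounds these sums; the condition passes to sums and to
    matrices of operators without any manipulation of series. *)
Definition trace_bounded (X : H -> H) (c : R) := forall N e f, bessel_family N e -> bessel_family N f ->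
  \sum_(k < N) nm '[X (e k), f k] <= c.

Lemma nuclear_trace_bounded T c : nuclear T c -> trace_bounded T c.
Proof. by move=> h N e f; exact: nuclear_bessel. Qed.

Lemma trace_bounded0 : trace_bounded (fun=> 0) 0.
Proof. by move=> N e f _ _; rewrite big1 // => k _; rewrite dot0l nm0. Qed.

Lemma trace_boundedD X Y c d : trace_bounded X c -> trace_bounded Y d -> trace_bounded (fun v => X v + Y v) (c + d).
Proof.
move=> hX hY N e f he hf.
apply: le_trans (lerD (hX N e f he hf) (hY N e f he hf)).
by rewrite -big_split ler_sum // => k _; rewrite dotDl nmD.
Qed.

Lemma trace_boundedZ X a c : trace_bounded X c -> trace_bounded (fun v => a *: X v) (nm a * c).
Proof.
move=> hX N e f he hf.
apply: le_trans (ler_wpM2l (nm_ge0 a) (hX N e f he hf)).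
by rewrite mulr_sumr ler_sum // => k _; rewrite dotZl nmM.
Qed.

Definition linear_of (T : H -> H) (h : forall a u v, T (a *: u + v) = a *: T u + T v) :
  {linear H -> H} := HB.pack T (GRing.isLinear.Build _ _ _ _ T h).

(** Let [p = |X|] and [J = (p + e)^-1].  Then [X J] is a contraction and
    [<p v, v> = <X v, X J v> + e <p J v, v>], so the hypothesis applied to the
    Bessel families [e_k] and [X J e_k] bounds the partial sums of [Tr p] as
    [e -> 0]. *)
Lemma trace_bounded_trace_class (X Xs : {linear H -> H}) b c (e : nat -> H) : 0 <= b -> bounded_by X b ->
  is_adjoint X Xs -> trace_bounded X c -> orthonormal_basis e -> trace_class_op X.
Proof.
move=> b0 bX XX hX he.
have bXs := adj_bounded XX b0 bX.
have qq : is_adjoint (Xs \o X) (Xs \o X) by apply: adj_comp => //; exact: adjC.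
have pq : positive_op (Xs \o X).
  by move=> v; rewrite /= (adjC XX) dot_nm ler0c sqr_ge0.
have [p [d [d0 pa pp bp pE]]] := positive_sqrt (mulr_ge0 b0 b0) qq pq (bounded_by_comp b0 bXs bX).
split; first exact: bounded_continuous bX.
exists Xs, (linear_of (adj_lin pa)); split=> //.
  by split=> //; apply: (@bounded_continuous _ _ (linear_of (adj_lin pa))) bp.
have hb N : \sum_(k < N) nm '[p (e k), e k] <= c.
  apply/ler_addgt0Pr => r r0.
  pose eps := r / N.+1%:R.
  have eps0 : 0 < eps by rewrite divr_gt0 ?ltr0n.
  have [J [JJ J1 J2 J3 J4]] := positive_resolvent eps0 d0 pa pp bp.
  have nXJ v : nm (X (J v)) = nm (p (J v)).
    apply/eqP; rewrite -(@eqrXn2 _ 2) ?nm_ge0 //; apply/eqP.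
    by apply: complexI; rewrite -!dot_nm pa pE XX.
  have XJ : is_adjoint (X \o J) (J \o Xs) by exact: adj_comp.
  have bXJ : bounded_by (X \o J) 1 by move=> v; rewrite /= nXJ mul1r.
  have hb := orthonormal_bessel (basis_family he) N.
  have hb2 := bessel_map XJ bXJ hb.
  have h := hX N e _ hb hb2.
  apply: le_trans (_ : \sum_(k < N) (nm '[X (e k), X (J (e k))] + eps) <= _).
    apply: ler_sum => k _.
    have -> : '[p (e k), e k] = '[X (e k), X (J (e k))] + '[eps%:C *: p (J (e k)), e k].
      have Jp : p (J (e k)) = J (p (e k)).
        by apply: (addIr (eps%:C *: J (e k))); rewrite J1 J2.
      have pE' : p (p (e k)) = Xs (X (e k)) by exact: pE.
      by rewrite -(adjC XX) -pE' -JJ -dotDl Jp J2.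
    rewrite (le_trans (nmD _ _)) // lerD2l (le_trans (cauchy_schwarz _ _)) //.
    rewrite nmZ nmR gtr0_norm // -mulrA ler_piMr ?(ltW eps0) //.
    have n1 := nm_orthonormal (basis_family he) k.
    by rewrite mulr_ile1 ?nm_ge0 // (le_trans (J4 _)).
  rewrite big_split /= sumr_const card_ord lerD // -mulr_natr.
  by rewrite /eps mulrAC ler_pdivrMr ?ltr0n // ler_pM2l // ler_nat.
have pnn k : '[p (e k), e k] = (nm '[p (e k), e k])%:C by apply: ge0_nm; exact: pp.
have [|t ht] := @mono_tends_to (fun N => \sum_(k < N) nm '[p (e k), e k]) c _ hb.
  by move=> n; rewrite big_ord_recr /= lerDl nm_ge0.
exists t%:C; apply/is_traceP; exists e => //; apply: eq_tends_to ht => n.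
by rewrite rmorph_sum; apply: eq_bigr => k _; exact: esym (pnn k).
Qed.

End TraceClass.

(** * Compactness and lower bounds for resolvents *)

Section UltraLimit.
Context {R : realType} (U : set_system nat) {UU : UltraFilter U}.
Local Notation C := R[i].

(** The limit is the supremum of the [x] below [f n] for almost all [n]. *)
Lemma ultralimit_real (f : nat -> R) M : (forall n, `|f n| <= M) ->
  exists l, forall e, 0 < e -> U [set n | `|f n - l| < e].
Proof.
move=> hM; pose A := [set x | U [set n | x <= f n]].
have hs : has_sup A.
  split; first exists (- M).
    by apply: filterS filterT => n _; have := hM n; rewrite ler_norml => /andP[].
  exists M => x /filter_ex[n] /= h; have := hM n; rewrite ler_norml => /andP[_].
  exact: le_trans.
exists (sup A) => e e0.
have h1 : U [set n | f n < sup A + e].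
  have [//|h] := in_ultra_setVsetC [set n | f n < sup A + e] UU.
  have : A (sup A + e).
    by apply: filterS h => n /= /negP; rewrite -leNgt.
  by move=> /(ub_le_sup hs.2); rewrite gerDl leNgt e0.
have [x xA hx] := sup_adherent e0 hs.
apply: filterS (filterI h1 xA) => n /= [h2 h3].
rewrite ltr_norml; apply/andP; split; lra.
Qed.

(** Convergence along an ultrafilter replaces the extraction of subsequences:
    every bounded sequence of numbers converges. *)
Definition ultra_cvg (V : normedZmodType C) (f : nat -> V) (l : V) :=
  forall e : R, 0 < e -> U [set n | nm (f n - l) < e].

Lemma ultralimit_complex (f : nat -> C) M : (forall n, nm (f n) <= M) -> exists l, ultra_cvg f l.
Proof.
move=> hM.
have hRe n : `|complex.Re (f n)| <= M.
  by apply: le_trans (hM n); rewrite -lecR -nmE normc_ge_Re.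
have hIm n : `|complex.Im (f n)| <= M.
  apply: le_trans (hM n); rewrite /nm normc_def /= -sqrtr_sqr ler_wsqrtr //.
  by rewrite lerDr sqr_ge0.
have [a ha] := ultralimit_real hRe; have [b hb] := ultralimit_real hIm.
exists (a +i* b) => e e0; have e2 : 0 < e / 2 by lra.
apply: filterS (filterI (ha _ e2) (hb _ e2)) => n /= [h1 h2].
apply: (le_lt_trans (nm_le_ReIm _)); move: h1 h2; case: (f n) => x y /=.
lra.
Qed.

Section Zmod.
Context {V : normedZmodType C}.

Lemma ultra_cvgD (f g : nat -> V) l k : ultra_cvg f l -> ultra_cvg g k -> ultra_cvg (fun n => f n + g n) (l + k).
Proof.
move=> hf hg e e0; have e2 : 0 < e / 2 by lra.
apply: filterS (filterI (hf _ e2) (hg _ e2)) => n /= [h1 h2].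
rewrite opprD addrACA (le_lt_trans (nmD _ _)) //; lra.
Qed.

Lemma ultra_cvg_cst (l : V) : ultra_cvg (fun=> l) l.
Proof. by move=> e e0; apply: filterS filterT => n _ /=; rewrite subrr nm0. Qed.

Lemma ultra_cvg_sum (I : Type) (r : seq I) (F : I -> nat -> V) (L : I -> V) :
  (forall i, ultra_cvg (F i) (L i)) ->
  ultra_cvg (fun n => \sum_(i <- r) F i n) (\sum_(i <- r) L i).
Proof.
move=> h; elim: r => [|i r IH].
  have -> : (fun n => \sum_(i <- [::]) F i n) = fun=> 0 by apply/funext => n; rewrite big_nil.
  rewrite big_nil; exact: ultra_cvg_cst.
have -> : (fun n => \sum_(j <- i :: r) F j n) = (fun n => F i n + \sum_(j <- r) F j n).
  by apply/funext => n; rewrite big_cons.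
by rewrite big_cons; exact: ultra_cvgD.
Qed.

Lemma ultra_cvg_uniq (f : nat -> V) l k : ultra_cvg f l -> ultra_cvg f k -> l = k.
Proof.
move=> hl hk; apply/eqP; rewrite -subr_eq0; apply/eqP/nm_eq0/le_anti.
rewrite nm_ge0 andbT; apply/ler_addgt0Pr => e e0; rewrite add0r.
have e2 : 0 < e / 2 by lra.
have [n [h1 h2]] := filter_ex (filterI (hl _ e2) (hk _ e2)).
rewrite /= in h1 h2; rewrite nmBC in h1.
by have := nm_tri l (f n) k; lra.
Qed.

Lemma ultra_cvg_nm (f : nat -> V) l : ultra_cvg f l -> (forall n, nm (f n) = 1) -> nm l = 1.
Proof.
move=> hl h1; apply/eqP; rewrite eq_le; apply/andP; split; apply/ler_addgt0Pr => e e0.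
- have [n hn] := filter_ex (hl _ e0); rewrite /= nmBC in hn.
  by have := nm_sub_ge l (f n); rewrite h1; lra.
- have [n hn] := filter_ex (hl _ e0); rewrite /= in hn.
  by have := nm_sub_ge (f n) l; rewrite h1; lra.
Qed.

End Zmod.

Lemma ultra_cvg_map (V W : normedZmodType C) (T : V -> W) c (f : nat -> V) l :
  (forall u v, nm (T u - T v) <= c * nm (u - v)) -> ultra_cvg f l -> ultra_cvg (fun n => T (f n)) (T l).
Proof.
move=> hT hf e e0; have c1 : 0 < `|c| + 1 by rewrite ltr_wpDl.
have h := hf (e / (`|c| + 1)) ltac:(by rewrite divr_gt0).
apply: filterS h => n /=; rewrite ltr_pdivlMr // => h.
apply: (le_lt_trans (hT _ _)); apply: le_lt_trans h; rewrite mulrC ler_wpM2l ?nm_ge0 //.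
by rewrite (le_trans (ler_norm c)) // lerDl.
Qed.

Lemma ultra_cvg_complete (V : completeNormedModType C) (f : nat -> V) :
  (forall e : R, 0 < e -> exists y, U [set n | nm (f n - y) < e]) -> exists l, ultra_cvg f l.
Proof.
move=> h; have : cauchy_ex (f @ U).
  move=> e e0.
  have E : e = (nm e)%:C by apply: ge0_nm; exact: ltW.
  have e0' : 0 < nm e by rewrite -ltcR -E.
  have [y hy] := h _ e0'; exists y.
  rewrite /= /nbhs /=; apply: filterS hy => n /=.
  by rewrite -ball_normE /ball_ /= nmE [in X in _ -> X]E ltcR nmBC.
move=> /cauchy_exP/cauchy_cvgP/cvg_ex[l /cvgrPdist_lt hl]; exists l => e e0.
have e0' : 0 < e%:C :> C by rewrite ltcR.
apply: filterS (hl _ e0') => n /=.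
by rewrite nmE ltcR nmBC.
Qed.

End UltraLimit.

Section LowerBound.
Context {R : realType} {H : separable_hilbert R}.
Local Notation C := R[i].
Implicit Types u v w : H.

(** Otherwise there are unit vectors [u_n] and [w_n] with [u_n - w_n T u_n -> 0].
    Along an ultrafilter [w_n] converges, and so does [T u_n] because [T] is
    compact; the limit of [u_n] is an eigenvector for the eigenvalue [w^-1], which
    has modulus at least [r]. *)
Lemma resolvent_lower (T S : H -> H) c (r : R) : 0 < r -> is_adjoint T S -> nuclear T c ->
  (forall (l : C) u, r <= nm l -> T u = l *: u -> u = 0) ->
  exists2 d : R, 0 < d & forall w : C, nm w <= r^-1 -> forall u,
    d * nm u <= nm (u - w *: T u).
Proof.
move=> r0 TS hT noev; apply: contrapT => hn.
have hseq n : exists wu : C * H, [/\ nm wu.1 <= r^-1, nm wu.2 = 1 &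
     nm (wu.2 - wu.1 *: T wu.2) < n.+1%:R^-1].
  apply: contrapT => hm; apply: hn; exists n.+1%:R^-1; first by rewrite invr_gt0.
  move=> w hw u; rewrite leNgt; apply/negP => hu; apply: hm.
  have u0 : u != 0 by apply: contraTneq hu => ->; rewrite (adj_0 TS) scaler0 subrr nm0 mulr0 ltxx.
  have nu := nm_gt0 u0.
  exists (w, (nm u)^-1%:C *: u) => /=; split=> //.
    by rewrite nmZ nmR ger0_norm ?invr_ge0 ?nm_ge0 // mulVf ?gt_eqF.
  rewrite (adj_Z TS) scalerA [w * _]mulrC -scalerA -scalerBr nmZ nmR.
  by rewrite ger0_norm ?invr_ge0 ?nm_ge0 // mulrC ltr_pdivrMr.
have [s hs] := choice hseq.
have [U [UU hU]] := @ultraFilterLemma _ \oo _.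
pose w n := (s n).1; pose u n := (s n).2.
have hw n : nm (w n) <= r^-1 by case: (hs n).
have hu n : nm (u n) = 1 by case: (hs n).
have h0 : ultra_cvg U (fun n => u n - w n *: T (u n)) 0.
  move=> e e0; have [N hN] := inv_small e0; apply: hU; exists N => // n Nn /=.
  by rewrite subr0; apply: lt_trans (hN n Nn); case: (hs n).
have [w0 hw0] := @ultralimit_complex R U UU w _ hw.
have [z hz] : exists z, ultra_cvg U (fun n => T (u n)) z.
  apply: ultra_cvg_complete => e e0; have e2 : 0 < e / 2 by lra.
  have [M [a [b hn2]]] := nuclear_approx hT e2.
  have hl i : exists l, ultra_cvg U (fun n => '[u n, a i]) l.
    apply: (@ultralimit_complex R U UU _ (nm (a i))) => n.
    by rewrite (le_trans (cauchy_schwarz _ _)) // hu mul1r.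
  have [l hl2] := choice hl.
  exists (\sum_(i < M) l i *: b i).
  have h1 : ultra_cvg U (fun n => \sum_(i < M) '[u n, a i] *: b i) (\sum_(i < M) l i *: b i).
    apply: ultra_cvg_sum => i.
    apply: (@ultra_cvg_map _ _ _ _ _ (fun x => x *: b i) (nm (b i))) => [x y|].
      by rewrite -scalerBl nmZ mulrC.
    exact: hl2.
  apply: filterS (h1 _ e2) => n /= h.
  apply: (le_lt_trans (nm_tri _ (\sum_(i < M) '[u n, a i] *: b i) _)).
  have := nuclear_bounded hn2 (u n); rewrite hu mulr1; lra.
have hu0 : ultra_cvg U u (w0 *: z).
  have -> : u = fun n => (u n - w n *: T (u n)) + ((w n - w0) *: T (u n) + w0 *: T (u n)).
    by apply/funext => n; rewrite -scalerDl !subrK.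
  have -> : w0 *: z = 0 + (0 + w0 *: z) by rewrite !add0r.
  apply: ultra_cvgD => //; apply: ultra_cvgD.
    move=> e e0; have c1 : 0 < c + 1 by rewrite ltr_wpDl // (nuclear_ge0 hT).
    have e1 : 0 < e / (c + 1) by rewrite divr_gt0.
    apply: filterS (hw0 _ e1) => n /=; rewrite ltr_pdivlMr // subr0 nmZ.
    apply: le_lt_trans; rewrite ler_wpM2l ?nm_ge0 //.
    by have := nuclear_bounded hT (u n); rewrite hu mulr1; lra.
  apply: (@ultra_cvg_map _ _ _ _ _ (fun x => w0 *: x) (nm w0)) hz => x y.
  by rewrite -scalerBr nmZ.
have hTu : T (w0 *: z) = z.
  apply: ultra_cvg_uniq hz.
  apply: (@ultra_cvg_map _ _ _ _ _ T c) hu0 => x y.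
  by rewrite -(adj_B TS); exact: nuclear_bounded.
have n1 : nm (w0 *: z) = 1 by apply: ultra_cvg_nm hu0 hu.
have w00 : w0 != 0.
  by apply/eqP => E; move: n1; rewrite E scale0r nm0 => /eqP; rewrite eq_sym oner_eq0.
have : w0 *: z = 0.
  apply: (noev w0^-1).
    rewrite nmV -[r]invrK lef_pV2 ?posrE ?invr_gt0 ?nm_gt0 //.
    apply/ler_addgt0Pr => e e0.
    have [n hn3] := filter_ex (hw0 _ e0); rewrite /= nmBC in hn3.
    have := nm_sub_ge w0 (w n); have := hw n; lra.
  by rewrite hTu scalerA mulVf ?scale1r.
by move=> E; move: n1; rewrite E nm0 => /eqP; rewrite eq_sym oner_eq0.
Qed.

End LowerBound.

(** * Growth of powers from bounds on resolvents *)

Lemma sub_sub_ACA (V : zmodType) (x y z t : V) : (x - y) - (z - t) = (x - z) - (y - t).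
Proof. by rewrite !opprD !opprK addrACA. Qed.

Section SpectralRadius.
Context {R : realType} {H : separable_hilbert R}.
Local Notation C := R[i].
Implicit Types u v : H.
Variables (T S : H -> H) (b d r0 : R).
Hypotheses (TS : is_adjoint T S) (b0 : 0 <= b) (bT : bounded_by T b).
Hypotheses (d0 : 0 < d) (r00 : 0 < r0).
Hypothesis low : forall w : C, nm w <= r0 -> forall u, d * nm u <= nm (u - w *: T u).

Let Lc : R := d^-1 * (b * d^-1).

(** [F w] inverts [1 - w^N T^N] on the disc of radius [r0], with bounds for [F w]
    and for its Lipschitz constant that do not depend on [N]. *)
Definition inverse_family N (F : C -> H -> H) :=
  forall w : C, nm w <= r0 ->
  [/\ forall v, F w v - w ^+ N *: iter N T (F w v) = v,
      forall v, F w (v - w ^+ N *: iter N T v) = v,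
      forall v, nm (F w v) <= d^-1 * nm v &
      forall w', nm w' <= r0 -> forall v, nm (F w v - F w' v) <= Lc * nm (w - w') * nm v].

(** The lower bound holds on the whole segment from [0] to [w], so the method of
    continuity applies; the Lipschitz bound is the resolvent identity. *)
Lemma inverse_family1 : exists F, inverse_family 1 F.
Proof.
have sj (w : C) : nm w <= r0 -> onto_op (fun u => u - w *: T u).
  move=> hw; have aT := adj_additive_map (adj_scale (- w) TS).
  have hb : bounded_by (fun u => - w *: T u) (nm w * b).
    by move=> u; rewrite nmZ nmN -mulrA ler_wpM2l ?nm_ge0.
  have := @continuity_method _ _ id _ d (nm w * b) d0 _ _ aT hb _ _.
  move=> h v; have [|//|t t0 t1 u|x|u hu] := h _ _ _ _ v.
  - by rewrite mulr_ge0 ?nm_ge0.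
  - rewrite scalerA mulrN scaleNr; apply: low.
    rewrite nmM nmR ger0_norm // (le_trans _ hw) //.
    by rewrite ler_piMl ?nm_ge0.
  - by exists x.
  by exists u; rewrite -hu scaleNr.
have hF (w : C) : exists F : H -> H, nm w <= r0 -> forall v, F v - w *: T (F v) = v.
  case: (leP (nm w) r0) => h; last by exists id.
  by have [F hF] := choice (sj w h); exists F.
have [F {}hF] := choice hF.
have uniq_sol (w : C) u v : nm w <= r0 -> u - w *: T u = v - w *: T v -> u = v.
  move=> hw E; apply/eqP; rewrite -subr_eq0; apply/eqP/nm_eq0/le_anti.
  rewrite nm_ge0 andbT -(ler_pM2l d0) mulr0 (le_trans (low hw _)) //.
  by rewrite (adj_B TS) scalerBr sub_sub_ACA E subrr nm0.
have bF (w : C) v : nm w <= r0 -> nm (F w v) <= d^-1 * nm v.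
  by move=> hw; rewrite ler_pdivlMl // (le_trans (low hw _)) // hF.
exists F => w hw; split=> [v|v|v|w' hw' v].
- by rewrite expr1 hF.
- by apply: (uniq_sol w) => //; rewrite hF // expr1.
- exact: bF.
- rewrite /Lc -!mulrA ler_pdivlMl // (le_trans (low hw _)) //.
  have -> : F w v - F w' v - w *: T (F w v - F w' v) = (w - w') *: T (F w' v).
    rewrite (adj_B TS) scalerBr scalerBl sub_sub_ACA (hF w hw v).
    by rewrite -{1}(hF w' hw' v) sub_sub_ACA subrr sub0r opprB.
  rewrite nmZ (_ : b * _ = nm (w - w') * (b * (d^-1 * nm v))); last by ring.
  rewrite ler_wpM2l ?nm_ge0 // (le_trans (bT _)) //.
  by rewrite ler_wpM2l // bF.
Qed.

(** Averaging over square roots: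
    [(1 - z^2)^-1 = ((1 - z)^-1 + (1 + z)^-1) / 2] with [z = w^N T^N], where
    [-z = (eta w)^N T^N] for an [eta] with [eta^N = -1].  Bounds are preserved by
    averaging. *)
Lemma inverse_family_double N F : (0 < N)%N -> inverse_family N F ->
  exists F', inverse_family (N + N) F'.
Proof.
move=> N0 hF.
pose eta : C := N.-root (-1).
have eN : eta ^+ N = -1 by exact: rootCK.
have ne : nm eta = 1.
  apply/eqP; rewrite -(@pexpr_eq1 _ _ N) ?nm_ge0 // -nmX eN nmN nm1 //.
have hew (w : C) : nm w <= r0 -> nm (eta * w) <= r0 by rewrite nmM ne mul1r.
have iA : exists S', is_adjoint (iter N T) S'.
  elim: N {N0 hF eta eN ne hew} => [|N [S' IH]]; first by exists id.
  by exists (S' \o S); apply: (adj_comp TS IH).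
have [S' hS'] := iA.
pose half : C := (2^-1)%:C.
have hh : half + half = 1.
  by rewrite -rmorphD -[RHS](rmorph1 (real_complex R)) /=; congr (_%:C); field.
have nh : nm half = 2^-1 by rewrite nmR ger0_norm.
exists (fun w v => half *: (F w v + F (eta * w) v)) => w hw.
have [A1 A2 A3 A4] := hF w hw; have [B1 B2 B3 B4] := hF _ (hew w hw).
have [Z ZE] : exists Z : H -> H, forall u, Z u = w ^+ N *: iter N T u by exists (fun u => w ^+ N *: iter N T u).
have ZD u v : Z (u + v) = Z u + Z v by rewrite !ZE (adj_D hS') scalerDr.
have ZB u v : Z (u - v) = Z u - Z v by rewrite !ZE (adj_B hS') scalerBr.
have ZZ a u : Z (a *: u) = a *: Z u by rewrite !ZE (adj_Z hS') !scalerA mulrC.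
have Z2 u : w ^+ (N + N) *: iter (N + N) T u = Z (Z u).
  by rewrite !ZE (adj_Z hS') iterD exprD scalerA.
have eZ u : (eta * w) ^+ N *: iter N T u = - Z u.
  by rewrite ZE exprMn eN mulN1r scaleNr.
have A1' v : F w v - Z (F w v) = v by rewrite ZE A1.
have A2' v : F w (v - Z v) = v by rewrite ZE A2.
have B1' v : F (eta * w) v + Z (F (eta * w) v) = v by rewrite -[RHS]B1 eZ opprK.
have B2' v : F (eta * w) (v + Z v) = v by rewrite -[RHS]B2 eZ opprK.
have hsum v : half *: (v + v) = v by rewrite scalerDr -scalerDl hh scale1r.
split=> [v|v|v|w' hw' v].
- rewrite Z2 /= 2!ZZ -scalerBr -[RHS]hsum; congr (_ *: _).
  rewrite 2!ZD opprD addrACA.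
  have -> : F w v - Z (Z (F w v)) = v + Z v.
    by rewrite -{4}(A1' v) ZB -{3}(A1' v) addrA subrK.
  have -> : F (eta * w) v - Z (Z (F (eta * w) v)) = v - Z v.
    by rewrite -{4}(B1' v) ZD -{3}(B1' v) opprD addrA addrK.
  by rewrite addrACA subrr addr0.
- rewrite Z2 -[RHS]hsum; congr (_ *: _).
  have -> : v - Z (Z v) = (v + Z v) - Z (v + Z v) by rewrite ZD opprD addrA addrK.
  rewrite A2'.
  have -> : v + Z v - Z (v + Z v) = (v - Z v) + Z (v - Z v).
    by rewrite ZD ZB opprD !addrA addrK subrK.
  by rewrite B2' addrACA subrr addr0.
- rewrite nmZ nh; have := nmD (F w v) (F (eta * w) v); have := A3 v; have := B3 v; lra.
- have := A4 w' hw' v; have := B4 _ (hew w' hw') v.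
  rewrite -mulrBr nmM ne mul1r => h1 h2.
  rewrite -scalerBr nmZ nh opprD addrACA.
  have := nmD (F w v - F w' v) (F (eta * w) v - F (eta * w') v); lra.
Qed.

Lemma inverse_family_pow j : exists F, inverse_family (2 ^ j) F.
Proof.
elim: j => [|j [F hF]]; first exact: inverse_family1.
by rewrite expnS mul2n -addnn; apply: inverse_family_double hF; rewrite expn_gt0.
Qed.

(** Exponents are powers of 2, as these are the ones that [inverse_family_pow]
    covers. *)
Definition dyadic_bound (rho : R) :=
  exists j, forall u, rho ^+ (2 ^ j) * nm (iter (2 ^ j) T u) <= nm u.

Lemma dyadic_bound_mul rho N m : 0 <= rho -> (forall u, rho ^+ N * nm (iter N T u) <= nm u) ->
  forall u, rho ^+ (m * N) * nm (iter (m * N) T u) <= nm u.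
Proof.
move=> h0 h; elim: m => [|m IH] u; first by rewrite mul0n expr0 mul1r.
rewrite mulSn iterD exprD mulrAC; apply: le_trans (IH u).
by rewrite [X in _ <= X]mulrC ler_wpM2r ?exprn_ge0.
Qed.

(** Slightly inside radius [rho] some power [s^N T^N] is small, so [F s] is close to
    the identity; by the uniform Lipschitz bound [F rho'] is still within [1/2] of
    the identity, which forces [|rho'^N T^N| <= 1].  The step [k] is the same for
    all radii. *)
Lemma dyadic_bound_step k rho rho' : 0 < k -> k <= r0 -> Lc * (2 * k) <= 1 / 4 ->
  0 <= rho -> rho <= rho' -> rho' <= r0 -> rho' <= rho + k -> dyadic_bound rho -> dyadic_bound rho'.
Proof.
move=> k0 kr kL h0 h1 h2 h3 [j hj].
(* [s = rho q] is within [k] of [rho], while [q < 1] does not depend on [rho] *)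
pose q := 1 - k / r0.
have q0 : 0 <= q by rewrite subr_ge0 ler_pdivrMr // mul1r.
have q1 : q < 1 by rewrite gtrBl divr_gt0.
have e0 : 0 < (4 * d^-1)^-1 by rewrite invr_gt0 mulr_gt0 ?invr_gt0.
have [N hN] := geo_small 1 q0 q1 e0.
pose i := (j + N)%N; exists i => u.
have iN : (N <= 2 ^ i)%N.
  by rewrite (leq_trans (leq_addl j N)) // ltnW // ltn_expl.
have [F hF] := inverse_family_pow i.
have hq := hN _ iN; rewrite mul1r in hq.
pose s := rho * q.
have s0 : 0 <= s by rewrite mulr_ge0.
have sr : s <= rho by rewrite ler_piMr // ltW.
have sk : rho - s <= k.
  rewrite /s /q mulrBr mulr1 opprB addrC subrK mulrA ler_pdivrMr //.
  by rewrite mulrC ler_pM2l // (le_trans h1).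
have hT v : s ^+ (2 ^ i) * nm (iter (2 ^ i) T v) <= q ^+ (2 ^ i) * nm v.
  rewrite exprMn mulrAC mulrC ler_wpM2l ?exprn_ge0 //.
  have := dyadic_bound_mul (2 ^ N) h0 hj v; by rewrite -expnD addnC.
have ns : nm (s%:C : C) <= r0 by rewrite nmR ger0_norm // (le_trans sr) // (le_trans h1).
have nr : nm (rho'%:C : C) <= r0 by rewrite nmR ger0_norm // (le_trans h0).
have [A1 A2 A3 A4] := hF _ nr; have [B1 B2 B3 B4] := hF _ ns.
have close v : nm (F rho'%:C v - v) <= 2^-1 * nm v.
  (* [F s] differs from the identity by [s^N T^N F s] *)
  have c1 : nm (F s%:C v - v) <= 4^-1 * nm v.
    rewrite -{2}(B1 v) opprB addrC subrK nmZ nmX nmR ger0_norm //.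
    apply: (le_trans (hT _)); apply: le_trans (ler_wpM2l (exprn_ge0 _ q0) (B3 v)) _.
    rewrite mulrA ler_wpM2r ?nm_ge0 //.
    rewrite -ler_pdivlMr ?invr_gt0 // (le_trans (ltW hq)) //.
    by rewrite invfM.
  have c2 : nm (F rho'%:C v - F s%:C v) <= 4^-1 * nm v.
    apply: (le_trans (A4 _ ns v)); rewrite ler_wpM2r ?nm_ge0 //.
    have L0 : 0 <= Lc by rewrite /Lc !mulr_ge0 ?invr_ge0 ?(ltW d0).
    rewrite -rmorphB nmR; apply: le_trans (ler_wpM2l L0 (_ : _ <= 2 * k)) _.
      rewrite ger0_norm; lra.
    by rewrite -div1r.
  have := nm_tri (F rho'%:C v) (F s%:C v) v; lra.
(* [u = F rho' g], so [u - g] is at most half of [g] *)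
pose g := u - rho'%:C ^+ (2 ^ i) *: iter (2 ^ i) T u.
have hg := close g; rewrite A2 in hg.
have E : u - g = rho'%:C ^+ (2 ^ i) *: iter (2 ^ i) T u by rewrite /g opprB addrC subrK.
have <- : nm (u - g) = rho' ^+ (2 ^ i) * nm (iter (2 ^ i) T u).
  by rewrite E nmZ nmX nmR ger0_norm // (le_trans h0).
have := nm_sub_ge g u; rewrite nmBC; lra.
Qed.

Lemma dyadic_bound_top : dyadic_bound r0.
Proof.
have L0 : 0 <= Lc by rewrite /Lc !mulr_ge0 ?invr_ge0 ?(ltW d0).
(* a step for which two radii [2 k] apart have inverses within [1 / 4] *)
pose k := Num.min r0 (8 * (Lc + 1))^-1.
have k0 : 0 < k by rewrite lt_min r00 /= invr_gt0 mulr_gt0 // ltr_wpDl.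
have kr : k <= r0 by rewrite ge_min lexx.
have kL : Lc * (2 * k) <= 1 / 4.
  have : k <= (8 * (Lc + 1))^-1 by rewrite ge_min lexx orbT.
  rewrite -div1r ler_pdivlMr ?mulr_gt0 ?ltr_wpDl // => h.
  nra.
have key m : dyadic_bound (Num.min r0 (m%:R * k)).
  elim: m => [|m IH].
    exists 0%N => u; rewrite mul0r min_r ?(ltW r00) // expr1 mul0r; exact: nm_ge0.
  apply: (dyadic_bound_step k0 kr kL _ _ _ _ IH).
  - by rewrite le_min (ltW r00) /= mulr_ge0 // ltW.
  - by rewrite le_min ge_min lexx /= ge_min -natr1 mulrDl mul1r lerDl (ltW k0) orbT.
  - by rewrite ge_min lexx.
  - rewrite -natr1 mulrDl mul1r addr_minl le_min; apply/andP; split.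
      by rewrite ge_min; apply/orP; left; rewrite lerDl ltW.
    by rewrite ge_min lexx orbT.
have := key (Num.bound (r0 / k)); rewrite min_l //.
rewrite -ler_pdivrMr // ltW // archi_boundP // divr_ge0 // ltW //.
Qed.

(** A single [N] with [|r0^N T^N| <= 1] bounds all powers, by division with remainder
    of the exponent. *)
Lemma power_bound : exists2 K : R, 0 <= K &
  forall m u, nm (iter m T u) <= K * (r0^-1) ^+ m * nm u.
Proof.
have [j hj] := dyadic_bound_top; pose N := (2 ^ j)%N.
have N0 : (0 < N)%N by rewrite expn_gt0.
pose B := 1 + r0 * b.
have B1 : 1 <= B by rewrite lerDl mulr_ge0 // ltW.
(* the remainder of the exponent modulo [N] costs at most [N] factors [B] *)
exists (B ^+ N); first by rewrite exprn_ge0 // (le_trans ler01).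
move=> m u; rewrite (divn_eq m N).
have small s : nm (iter s T u) <= b ^+ s * nm u.
  elim: s => [|s IH]; first by rewrite mul1r.
  by rewrite iterS (le_trans (bT _)) // exprS -mulrA ler_wpM2l.
have := dyadic_bound_mul (m %/ N) (ltW r00) hj (iter (m %% N) T u).
rewrite -/N -iterD => h.
have hm : nm (iter (m %/ N * N + m %% N) T u) <= r0^-1 ^+ (m %/ N * N) * (b ^+ (m %% N) * nm u).
  rewrite exprVn ler_pdivlMl ?exprn_gt0 // (le_trans h) //.
apply: (le_trans hm); rewrite [r0^-1 ^+ (_ + _)]exprD.
set x := r0^-1 ^+ (m %/ N * N).
rewrite (_ : B ^+ N * _ * _ = x * (B ^+ N * r0^-1 ^+ (m %% N) * nm u)); last by ring.
apply: ler_wpM2l; first by rewrite exprn_ge0 // invr_ge0 ltW.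
apply: ler_wpM2r; first exact: nm_ge0.
have -> : b ^+ (m %% N) = (r0 * b) ^+ (m %% N) * r0^-1 ^+ (m %% N).
  by rewrite -exprMn; congr (_ ^+ _); field; rewrite gt_eqF.
rewrite ler_wpM2r ?exprn_ge0 ?invr_ge0 ?(ltW r00) //.
apply: le_trans (_ : B ^+ (m %% N) <= _).
  by rewrite lerXn2r ?nnegrE // ?mulr_ge0 ?(ltW r00) // ?(le_trans ler01) // lerDr.
by rewrite ler_weXn2l // ltnW // ltn_pmod.
Qed.

End SpectralRadius.

(** * Power sums and triangular flags *)

Section PowerSums.
Context {R : realType}.
Local Notation C := R[i].

(** Replacing [p (x)] by [(x - b) p (x)] turns the weighted sum [E p m] into
    [E p (m + 1) - b E p m], which is still [O (r^m)].  When [p] vanishes at all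
    entries of [t] and [t'], what remains is [(n - n') p (l) l^m], and [r < |l|]. *)
Lemma power_sums_mult (l : C) (t t' : seq C) (n n' : nat) (K r : R) :
  0 < r -> r < nm l -> l \notin t -> l \notin t' ->
  (forall m, (2 <= m)%N ->
    nm ((\sum_(a <- t) a ^+ m + n%:R * l ^+ m) - (\sum_(a <- t') a ^+ m + n'%:R * l ^+ m))
      <= K * r ^+ m) -> n = n'.
Proof.
move=> r0 rl lt lt' hD.
pose E (p : C -> C) m := (\sum_(a <- t) p a * a ^+ m + n%:R * (p l * l ^+ m))
   - (\sum_(a <- t') p a * a ^+ m + n'%:R * (p l * l ^+ m)).
pose P (s : seq C) x := \prod_(b <- s) (x - b).
have bound s : exists K, forall m, (2 <= m)%N -> nm (E (P s) m) <= K * r ^+ m.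
  elim: s => [|b s [K1 IH]].
    exists K => m m2; have P1 x : P [::] x = 1 by rewrite /P big_nil.
    have sumE (u : seq C) : \sum_(a <- u) P [::] a * a ^+ m = \sum_(a <- u) a ^+ m.
      by apply: eq_bigr => a _; rewrite P1 mul1r.
    by rewrite /E !sumE !P1 !mul1r; exact: hD.
  exists (K1 * r + nm b * K1) => m m2.
  have PS x k : P (b :: s) x * x ^+ k = P s x * x ^+ k.+1 - b * (P s x * x ^+ k).
    by rewrite /P big_cons exprS; ring.
  have sumE (u : seq C) : \sum_(a <- u) P (b :: s) a * a ^+ m =
      \sum_(a <- u) P s a * a ^+ m.+1 - b * \sum_(a <- u) P s a * a ^+ m.
    by rewrite mulr_sumr -sumrB; apply: eq_bigr => a _; exact: PS.
  have -> : E (P (b :: s)) m = E (P s) m.+1 - b * E (P s) m.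
    rewrite /E !sumE PS; ring.
  apply: (le_trans (nmB _ _)); rewrite mulrDl lerD //.
    by rewrite -mulrA -exprS IH // ltnW.
  by rewrite nmM -mulrA ler_wpM2l ?nm_ge0 // IH.
have [K1 hK] := bound (t ++ t').
have P0 a : a \in t ++ t' -> P (t ++ t') a = 0.
  by move=> h; apply/eqP; rewrite prodf_seq_eq0; apply/hasP; exists a => //=; rewrite subrr eqxx.
have Pl : P (t ++ t') l != 0.
  rewrite prodf_seq_neq0; apply/allP => a; rewrite mem_cat => h /=.
  rewrite subr_eq0; apply/eqP => E1; move: h; rewrite -E1.
  by rewrite (negbTE lt) (negbTE lt').
have EE m : E (P (t ++ t')) m = (n%:R - n'%:R) * P (t ++ t') l * l ^+ m.
  rewrite /E !big1_seq ?add0r; first by ring.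
  - by move=> a /andP[_ h]; rewrite P0 ?mul0r // mem_cat h orbT.
  - by move=> a /andP[_ h]; rewrite P0 ?mul0r // mem_cat h.
have l0 : 0 < nm l by exact: lt_trans rl.
have q0 : 0 <= r / nm l by rewrite divr_ge0 ?ltW.
have q1 : r / nm l < 1 by rewrite ltr_pdivrMr // mul1r.
have Z : (n%:R - n'%:R) * P (t ++ t') l = 0 :> C.
  apply/nm_eq0/le_anti; rewrite nm_ge0 andbT; apply/ler_addgt0Pr => e e0; rewrite add0r.
  have [N hN] := geo_small K1 q0 q1 e0.
  have := hK (N + 2)%N (leq_addl _ _); rewrite EE nmM nmX.
  rewrite -ler_pdivlMr ?exprn_gt0 // => h; apply: (le_trans h).
  by rewrite -mulrA -expr_div_n ltW // hN // leq_addr.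
move/eqP: Z; rewrite mulf_eq0 (negbTE Pl) orbF subr_eq0 eqr_nat.
by move/eqP.
Qed.
End PowerSums.

Section Flags.
Context {R : realType} {H : separable_hilbert R}.
Local Notation C := R[i].
Implicit Types u v w : H.
Implicit Types s t : seq (C * H).

(** Indices beyond the length give the zero vector, so that the family fits
    [orthonormal_family]. *)
Definition flag_vec s (i : nat) : H := (nth (0, 0) s i).2.
Definition flag_proj s (w : H) : H := partial_proj (flag_vec s) (size s) w.
Definition in_span s (w : H) : Prop := flag_proj s w = w.

Lemma flag_proj_cons q s w : flag_proj (q :: s) w = '[w, q.2] *: q.2 + flag_proj s w.
Proof. by rewrite /flag_proj /partial_proj big_ord_recl. Qed.

Lemma flag_vec_default s i : (size s <= i)%N -> flag_vec s i = 0.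
Proof. by move=> h; rewrite /flag_vec nth_default. Qed.

Lemma flag_proj_adj s : is_adjoint (flag_proj s) (flag_proj s).
Proof.
elim: s => [|q s IH] u v; first by rewrite /flag_proj /partial_proj !big_ord0 dot0l dot0r.
rewrite !flag_proj_cons dotDl dotDr IH dotZl dotZr conj_dot; congr (_ + _).
by rewrite mulrC.
Qed.

Section Span.
Variable s : seq (C * H).

Lemma span_lin (a : C) u v : in_span s u -> in_span s v -> in_span s (a *: u + v).
Proof. by rewrite /in_span => hu hv; rewrite (adj_lin (flag_proj_adj s)) hu hv. Qed.

Lemma span0 : in_span s 0.
Proof. by rewrite /in_span (adj_0 (flag_proj_adj s)). Qed.

Lemma spanZ (a : C) u : in_span s u -> in_span s (a *: u).
Proof. by move=> h; rewrite -[a *: u]addr0; exact: span_lin h span0. Qed.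

Lemma spanD u v : in_span s u -> in_span s v -> in_span s (u + v).
Proof. by move=> h h'; rewrite -[u]scale1r; exact: span_lin. Qed.

Lemma spanB u v : in_span s u -> in_span s v -> in_span s (u - v).
Proof. by move=> h h'; rewrite -scaleN1r addrC; exact: span_lin. Qed.

Hypothesis on : orthonormal_family (flag_vec s).

Lemma dot_flag_proj w i : '[flag_proj s w, flag_vec s i] = '[w, flag_vec s i].
Proof. by rewrite /flag_proj dot_partial_proj //; case: ltnP => // h; rewrite flag_vec_default // dot0r. Qed.

Lemma flag_proj_idem w : flag_proj s (flag_proj s w) = flag_proj s w.
Proof. by rewrite {1 3}/flag_proj /partial_proj; apply: eq_bigr => i _; rewrite dot_flag_proj. Qed.

Lemma span_pr w : in_span s (flag_proj s w).
Proof. exact: flag_proj_idem. Qed.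

Lemma span_vec i : in_span s (flag_vec s i).
Proof.
have [h|h] := ltnP i (size s); last by rewrite flag_vec_default //; exact: span0.
rewrite /in_span /flag_proj /partial_proj (bigD1 (Ordinal h)) //= big1 ?addr0 => [|k ki].
  by case: (on.1 i) => ->; rewrite ?scaler0 // scale1r.
by rewrite on.2 ?scale0r // => E; move/eqP: ki; apply; apply: val_inj.
Qed.

End Span.

Section Operator.
Variables (T S : H -> H).
Hypothesis TS : is_adjoint T S.

(** An orthonormal sequence, most recent vector first, on which [T] is triangular;
    each vector is paired with its diagonal entry.  It is a Schur form of [T] on
    the span. *)
Fixpoint flag s : Prop := if s is q :: s' then
  [/\ flag s', nm q.2 = 1, forall i, '[q.2, flag_vec s' i] = 0 & in_span s' (T q.2 - q.1 *: q.2)]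
  else True.

Lemma flag_orthonormal s : flag s -> orthonormal_family (flag_vec s).
Proof.
elim: s => [_|q s IH fs].
  split=> i; first by left; rewrite /flag_vec nth_nil.
  by move=> j _; rewrite /flag_vec nth_nil dot0l.
case: fs => fs' h1 h2 _; case: (IH fs') => o1 o2.
split; first case=> [|i]; last case=> [|i] [|j] //=.
- by right; rewrite /flag_vec /= dot_nm h1 expr1n.
- exact: o1.
- by move=> _; exact: h2.
- by move=> _; rewrite -conj_dot h2 rmorph0.
- by move=> h; apply: o2 => E; apply: h; rewrite E.
Qed.

Lemma span_orth s v w : (forall i, '[v, flag_vec s i] = 0) -> in_span s w -> '[w, v] = 0.
Proof.
move=> h hw; rewrite -hw /flag_proj /partial_proj dot_suml big1 // => i _.
by rewrite dotZl -[X in _ * X]conj_dot h rmorph0 mulr0.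
Qed.

Lemma span_cons q s w : (forall i, '[q.2, flag_vec s i] = 0) -> in_span s w -> in_span (q :: s) w.
Proof.
by move=> h hw; rewrite /in_span flag_proj_cons (span_orth h hw) scale0r add0r.
Qed.

(** Modulo the span of the earlier vectors, [T - m] multiplies the coefficient of
    the newest vector by [q.1 - m]. *)
Lemma flag_step q s w (m : C) : flag (q :: s) -> (forall u, in_span s u -> in_span s (T u)) ->
  in_span (q :: s) w -> in_span s (T w - m *: w - ('[w, q.2] * (q.1 - m)) *: q.2).
Proof.
move=> [fs h1 h2 h3] inv hw; have on := flag_orthonormal fs.
have hp := span_pr on w.
have {1 2}-> : w = '[w, q.2] *: q.2 + flag_proj s w by rewrite -flag_proj_cons.
set a := '[w, q.2].
have -> : T (a *: q.2 + flag_proj s w) - m *: (a *: q.2 + flag_proj s w) - (a * (q.1 - m)) *: q.2 =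
   a *: (T q.2 - q.1 *: q.2) + (T (flag_proj s w) - m *: flag_proj s w).
  have gen (X P V Y W : H) : X + P - (V + Y) - (W - V) = X - W + (P - Y).
    by rewrite opprB opprD [X + P + _]addrACA addrAC subrKA addrAC.
  rewrite (adj_lin TS) scalerDr !scalerA mulrBr scalerBl scalerBr scalerA.
  by rewrite [m * a]mulrC gen.
by apply: spanD; [exact: spanZ | apply: spanB; [exact: inv | exact: spanZ]].
Qed.

Lemma flag_inv s w : flag s -> in_span s w -> in_span s (T w).
Proof.
elim: s w => [|q s IH] w; first by rewrite /in_span /flag_proj /partial_proj !big_ord0 => _ <-; rewrite (adj_0 TS).
move=> fs hw; have [fs' h1 h2 h3] := fs.
have h := flag_step 0 fs (fun u => IH u fs') hw.
rewrite scale0r !subr0 in h.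
rewrite -[T w](subrK (('[w, q.2] * q.1) *: q.2)); apply: spanD; first exact: span_cons.
by apply: spanZ; exact: (span_vec (flag_orthonormal fs) 0).
Qed.

Lemma flag_lower q s w : flag (q :: s) -> in_span (q :: s) w -> in_span s (T w - q.1 *: w).
Proof.
move=> fs hw; have [fs' _ _ _] := fs.
have := flag_step q.1 fs (fun u => @flag_inv s u fs') hw.
by rewrite subrr mulr0 scale0r subr0.
Qed.

Lemma span_cat t s w : flag (t ++ s) -> in_span s w -> in_span (t ++ s) w.
Proof.
elim: t => [|q t IH] //= [f h1 h2 h3] h; apply: span_cons => //; exact: IH.
Qed.

Lemma flag_diag s k i : flag s -> (i < size s)%N ->
  '[iter k T (flag_vec s i), flag_vec s i] = (nth (0, 0) s i).1 ^+ k.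
Proof.
elim: s i => [|q s IH] // [|i] fs hi; last by case: fs => fs _ _ _; exact: IH.
have [fs' h1 h2 h3] := fs; rewrite /flag_vec /=.
have : in_span s (iter k T q.2 - q.1 ^+ k *: q.2).
  elim: k {IH} => [|k IHk]; first by rewrite /= expr0 scale1r subrr; exact: span0.
  have := flag_inv fs' IHk; rewrite (adj_B TS) (adj_Z TS) -iterS => h.
  have := span_lin (q.1 ^+ k) h3 h.
  by rewrite scalerBr scalerA -exprSr addrC addrA subrK.
move=> /(span_orth h2); rewrite dotBl dotZl dot_nm h1 expr1n mulr1 => /eqP.
by rewrite subr_eq0 => /eqP.
Qed.

(** Gram-Schmidt: only the component of [w] orthogonal to the span matters. *)
Lemma flag_extend s w (m : C) : flag s -> ~ in_span s w -> in_span s (T w - m *: w) ->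
  exists v, flag ((m, v) :: s).
Proof.
move=> fs nw hw; have on := flag_orthonormal fs.
pose u := w - flag_proj s w.
have u0 : u != 0 by rewrite subr_eq0; apply/eqP => E; apply: nw; rewrite /in_span -E.
have nu := nm_gt0 u0.
exists ((nm u)^-1%:C *: u); split=> //=.
- by rewrite nmZ nmR ger0_norm ?invr_ge0 ?nm_ge0 // mulVf ?gt_eqF.
- by move=> i; rewrite dotZl dotBl dot_flag_proj // subrr mulr0.
- rewrite (adj_Z TS) scalerA [m * _]mulrC -scalerA -scalerBr; apply: spanZ.
  rewrite (adj_B TS) scalerBr sub_sub_ACA; apply: spanB => //.
  apply: spanB; last by apply: spanZ; exact: span_pr.
  by apply: flag_inv => //; exact: span_pr.
Qed.

(** The diagonal entries are [<T v_i, v_i>], whose moduli sum to at most the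
    nuclear bound. *)
Lemma flag_size s c (r : R) : nuclear T c -> flag s -> (forall i, (i < size s)%N -> r <= nm (nth (0, 0) s i).1) ->
  (size s)%:R * r <= c.
Proof.
move=> hT fs hr; have ob := orthonormal_bessel (flag_orthonormal fs) (size s).
apply: le_trans (nuclear_bessel hT ob ob).
apply: le_trans (_ : \sum_(k < size s) r <= _); first by rewrite sumr_const card_ord mulr_natl.
apply: ler_sum => i _; rewrite -[T _]/(iter 1 T _) flag_diag // expr1.
exact: hr.
Qed.

Lemma maximal_extension (P : seq (C * H) -> Prop) N s0 :
  (forall s, P s -> (size s <= N)%N) -> P s0 ->
  exists t, P (t ++ s0) /\ forall q, ~ P (q :: (t ++ s0)).
Proof.
move=> hN; move: {2}(N - size s0)%N (leqnn (N - size s0)) => k.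
elim: k s0 => [|k IH] s0 hk hs.
  exists [::]; split=> // q /hN /= h; move: hk h; lia.
case: (pselect (exists q, P (q :: s0))) => [[q hq]|hn].
  have [|t [h1 h2]] := IH (q :: s0) _ hq; first by move=> /=; have := hN _ hq => /=; lia.
  by exists (rcons t q); rewrite cat_rcons.
by exists [::]; split=> // q hq; apply: hn; exists q.
Qed.

Definition eigenflag (l : C) s := flag s /\ all (fun q => q.1 == l) s.

Definition max_eigenflag l s := eigenflag l s /\ forall q, ~ eigenflag l (q :: s).

(** A generalized eigenvector outside the span would, after applying powers of
    [T - l], give a vector by which the flag can be lengthened. *)
Lemma max_eigenflag_ge s l w m : max_eigenflag l s ->
  iter m (fun u => T u - l *: u) w = 0 -> in_span s w.
Proof.
move=> [[fs ls] hm]; elim: m w => [|m IH] w; first by move=> /= ->; exact: span0.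
rewrite iterSr => /IH h; apply: contrapT => nw.
have [v hv] := flag_extend fs nw h.
by apply: (hm (l, v)); split=> //=; rewrite eqxx.
Qed.

(** Each application of [T - l] removes the newest vector. *)
Lemma eigenflag_le s l w : eigenflag l s -> in_span s w ->
  iter (size s) (fun u => T u - l *: u) w = 0.
Proof.
elim: s w => [|q s IH] w; first by rewrite /in_span /flag_proj /partial_proj big_ord0 => _ <-.
move=> [fs /andP[/eqP ql ls]] hw.
rewrite -[size (q :: s)]/(size s).+1 iterSr; apply: IH.
  by split=> //; case: fs.
by rewrite -ql; exact: flag_lower.
Qed.

(** Suppose the newest vector [v] had diagonal entry [l].  Let [K] be the product
    of the [T - mu] over the diagonal entries [mu <> l] met in between.  [K] maps
    the span of the earlier vectors into the span of [s]; as [K] commutes with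
    [T - l], this puts [K v] into the generalized eigenspace, the span of [s].
    But [K v] is a nonzero multiple of [v] modulo the earlier vectors. *)
Lemma max_eigenflag_ext t s l : max_eigenflag l s -> flag (t ++ s) -> all (fun q => q.1 != l) t.
Proof.
move=> hm; elim: t => [|q t IH] //= fs; have [fs' h1 h2 h3] := fs.
have ht := IH fs'; rewrite ht andbT; apply/eqP => ql.
pose K := fix K (t : seq (C * H)) (u : H) : H := if t is q' :: t' then K t' (T u - q'.1 *: u) else u.
have Klow t' u : flag (t' ++ s) -> in_span (t' ++ s) u -> in_span s (K t' u).
  elim: t' u => [|q' t' IHt] u //= f hu; have [f' _ _ _] := f.
  by apply: IHt => //; exact: flag_lower f hu.
have Kcomm t' u : K t' (T u - l *: u) = T (K t' u) - l *: K t' u.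
  elim: t' u => [|q' t' IHt] u //=; rewrite -IHt; congr (K _ _).
  rewrite !(adj_B TS) !(adj_Z TS) !scalerBr !scalerA [l * q'.1]mulrC.
  by rewrite sub_sub_ACA.
have Kval t' u a : in_span (t ++ s) (u - a *: q.2) -> all (fun q => q.1 != l) t' -> a != 0 ->
    exists2 a', a' != 0 & in_span (t ++ s) (K t' u - a' *: q.2).
  elim: t' u a => [|q' t' IHt] u a hu /=; first by exists a.
  move=> /andP[q'l ht'] a0; apply: (IHt _ (a * (l - q'.1))) => //; last first.
    by rewrite mulf_neq0 // subr_eq0 eq_sym.
  have e1 := flag_inv fs' hu; rewrite (adj_B TS) (adj_Z TS) in e1.
  have e2 := spanD (spanB e1 (spanZ q'.1 hu)) (spanZ a h3).
  have gen (X Y U V W : H) : X - Y - (U - V) + (Y - W) = X - U - (W - V).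
    by rewrite sub_sub_ACA -addrA !opprB subrKA.
  rewrite ql !scalerBr !scalerA [q'.1 * a]mulrC gen in e2.
  by rewrite mulrBr scalerBl.
have [|a a0 ha] := Kval t q.2 1 _ ht (oner_neq0 _).
  by rewrite scale1r subrr; exact: span0.
have hK : in_span s (K t q.2).
  apply: (@max_eigenflag_ge s l _ (size s).+1 hm).
  rewrite iterSr -Kcomm; apply: eigenflag_le; first exact: hm.1.
  by apply: Klow => //; rewrite -ql.
have := spanB (span_cat fs' hK) ha; rewrite opprB addrC subrK => /(spanZ a^-1).
rewrite scalerA mulVf // scale1r => hq.
have := span_orth h2 hq; rewrite dot_nm h1 expr1n => /eqP.
by rewrite oner_eq0.
Qed.

End Operator.
End Flags.

(** * Eigenvalues from moments *)

Section Eigenvalues.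
Context {R : realType} {H : separable_hilbert R}.
Local Notation C := R[i].
Implicit Types u v : H.
Variables (T S : H -> H) (b c : R).
Hypotheses (TS : is_adjoint T S) (b0 : 0 <= b) (bT : bounded_by T b) (nT : nuclear T c).

Lemma iter_adj (A B : H -> H) m : is_adjoint A B -> is_adjoint (iter m A) (iter m B).
Proof.
move=> AB; elim: m => [|m IH] u v //=.
by rewrite AB IH -iterSr.
Qed.

Lemma max_eigenflag_exists (l : C) : l != 0 -> exists s, max_eigenflag T l s.
Proof.
move=> l0; have nl := nm_gt0 l0.
have hN s : eigenflag T l s -> (size s <= Num.bound (c / nm l))%N.
  move=> [fs /allP ls]; rewrite -(ler_nat R) ltW //.
  apply: le_lt_trans (archi_boundP _); last by rewrite divr_ge0 ?(nuclear_ge0 nT) // ltW.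
  rewrite ler_pdivlMr //; apply: (flag_size TS nT fs) => i hi.
  by have := ls _ (mem_nth (0, 0) hi) => /eqP ->.
have [|t [h1 h2]] := @maximal_extension _ _ (eigenflag T l) _ [::] hN; first by split.
by exists (t ++ [::]); split.
Qed.

(** Extend [s0] to a longest flag with diagonal entries of modulus at least [r] and
    let [Q] project onto the orthogonal complement of its span.  An eigenvector
    of [Q T] with eigenvalue of modulus at least [r] would lengthen the flag, so
    the powers of [Q T] are [O (r^m)].  Since the span is invariant,
    [(Q T)^m = Q T^m], and the trace of the remaining part of [T^m] is the sum of
    the powers of the diagonal entries. *)
Lemma max_eigenflag_estimate (l : C) s0 (r : R) : 0 < r -> r <= nm l -> max_eigenflag T l s0 ->
  exists t : seq C, l \notin t /\ exists K : R, forall m e tr, (1 <= m)%N -> orthonormal_basis e ->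
   tends_to (fun N => \sum_(k < N) '[iter m T (e k), e k]) tr ->
   nm (tr - (\sum_(a <- t) a ^+ m + (size s0)%:R * l ^+ m)) <= K * r ^+ m.
Proof.
move=> r0 rl hs0.
pose big s := flag T s /\ all (fun q => r <= nm q.1) s.
have hN s : big s -> (size s <= Num.bound (c / r))%N.
  move=> [fs /allP ls]; rewrite -(ler_nat R) ltW //.
  apply: le_lt_trans (archi_boundP _); last by rewrite divr_ge0 ?(nuclear_ge0 nT) // ltW.
  rewrite ler_pdivlMr //; apply: (flag_size TS nT fs) => i hi.
  by have := ls _ (mem_nth (0, 0) hi).
have [[fs0 ls0] _] := hs0.
have [|t [[fs bs] hmax]] := @maximal_extension _ _ big _ s0 hN.
  split=> //; apply: sub_all ls0 => q /eqP ->; exact: rl.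
have tl := max_eigenflag_ext TS hs0 fs.
exists (map fst t); split.
  apply/negP => /mapP[q qt E]; move/allP: tl => /(_ q qt); by rewrite E eqxx.
pose s := t ++ s0.
have on := flag_orthonormal fs.
pose Q u := u - flag_proj s u.
have QQ : is_adjoint Q Q.
  by move=> u v; rewrite dotBl dotBr flag_proj_adj.
have bQ : bounded_by Q 1.
  move=> u; rewrite mul1r -(@ler_pXn2r _ 2) ?nnegrE ?nm_ge0 //.
  by rewrite [X in _ <= X](bessel_eq on (size s)) lerDl sumr_ge0 // => k _; rewrite sqr_ge0.
have Qspan u : in_span s u -> Q u = 0 by move=> h; rewrite /Q h subrr.
have QT m u : iter m.+1 (Q \o T) u = Q (iter m.+1 T u).
  (* the span is invariant, hence [Q T (1 - Q) = 0] *)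
  have QTQ w : Q (T (Q w)) = Q (T w).
    rewrite -[Q w]/(w - flag_proj s w) (adj_B TS) (adj_B QQ).
    by rewrite [Q (T (flag_proj s _))]Qspan ?subr0 //; apply: (flag_inv TS fs); exact: span_pr.
  by elim: m => [|m IH] //; rewrite iterS IH [LHS]QTQ.
have TQ : is_adjoint (Q \o T) (S \o Q) by exact: adj_comp.
have nQT : nuclear (Q \o T) (1 * c) by apply: nuclear_compl nT.
have bQT : bounded_by (Q \o T) b by rewrite -[b]mul1r; apply: bounded_by_comp.
have noev (a : C) u : r <= nm a -> (Q \o T) u = a *: u -> u = 0.
  move=> ra E; have a0 : a != 0.
    by apply/eqP => E0; move: ra; rewrite E0 nm0 leNgt r0.
  have Eu : u = a^-1 *: Q (T u) by rewrite -[Q _]/((Q \o T) u) E scalerA mulVf ?scale1r.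
  have pu : flag_proj s u = 0.
    rewrite Eu (adj_Z (flag_proj_adj s)) /Q (adj_B (flag_proj_adj s)).
    by rewrite flag_proj_idem // subrr scaler0.
  apply: contrapT => nu.
  have [||v [hv1 hv2 hv3 hv4]] := @flag_extend _ _ T S TS s u a fs.
  - by rewrite /in_span pu => E0; apply: nu.
  - by rewrite -E /Q /= opprB addrC subrK; exact: span_pr.
  by apply: (hmax (a, v)); split=> //=; rewrite ra.
have [d d0 hd] := resolvent_lower r0 TQ nQT noev.
have ri : 0 < r^-1 by rewrite invr_gt0.
have [K K0 hK] := power_bound TQ b0 bQT d0 ri hd.
rewrite invrK in hK.
exists (K * r^-1 * c) => -[//|m] e tr _ he htr.
have hpr : tends_to (fun N => \sum_(k < N) '[flag_proj s (iter m.+1 T (e k)), e k])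
   (\sum_(i < size s) '[iter m.+1 T (flag_vec s i), flag_vec s i]).
  have h : tends_to (fun N => \sum_(i < size s) \sum_(k < N)
      '[e k, iter m.+1 S (flag_vec s i)] * '[flag_vec s i, e k])
      (\sum_(i < size s) '[flag_vec s i, iter m.+1 S (flag_vec s i)]).
    by apply: tends_to_sum => i; exact: parseval_dot.
  have -> : \sum_(i < size s) '[iter m.+1 T (flag_vec s i), flag_vec s i] =
     \sum_(i < size s) '[flag_vec s i, iter m.+1 S (flag_vec s i)].
    by apply: eq_bigr => i _; rewrite (iter_adj m.+1 TS).
  apply: eq_tends_to h => N; rewrite exchange_big /=; apply: eq_bigr => k _.
  rewrite /flag_proj /partial_proj dot_suml; apply: eq_bigr => i _.
  by rewrite dotZl -(iter_adj m.+1 TS).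
have Es : \sum_(i < size s) '[iter m.+1 T (flag_vec s i), flag_vec s i] =
    \sum_(a <- map fst t) a ^+ m.+1 + (size s0)%:R * l ^+ m.+1.
  transitivity (\sum_(q <- s) q.1 ^+ m.+1).
    rewrite (big_nth (0, 0)) big_mkord; apply: eq_bigr => i _.
    exact: (flag_diag TS m.+1 fs).
  rewrite big_cat big_map /=; congr (_ + _).
  rewrite big_seq (eq_bigr (fun=> l ^+ m.+1)); last first.
    by move=> q qs; move/allP: ls0 => /(_ q qs) /eqP ->.
  by rewrite -big_seq big_const_seq count_predT iter_addr_0 mulr_natl.
rewrite -Es; apply: tends_to_nm_le (tends_toB htr hpr) _ => N.
rewrite -sumrB.
have nm1 : nuclear (iter m.+1 (Q \o T)) (K * r ^+ m * (1 * c)).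
  have hb : bounded_by (iter m (Q \o T)) (K * r ^+ m) by exact: hK.
  have := nuclear_compl _ (iter_adj m TQ) hb nQT; rewrite mulr_ge0 ?exprn_ge0 ?(ltW r0) //.
  move=> /(_ isT); apply: eq_nuclear => u; by rewrite iterSr.
have ob := orthonormal_bessel (basis_family he) N.
have hn := nuclear_bessel nm1 ob ob.
have -> : K / r * c * r ^+ m.+1 = K * r ^+ m * (1 * c).
  rewrite exprS; field; by rewrite gt_eqF.
apply: le_trans hn; apply: (le_trans (nm_sum _ _ _)); apply: ler_sum => k _.
by rewrite -dotBl QT.
Qed.

Lemma max_eigenflag_mult (x : {linear H -> H}) l s : x =1 T -> max_eigenflag T l s ->
  alg_mult x l (size s).
Proof.
move=> xT hs; have [[fs ls] _] := hs; have on := flag_orthonormal fs.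
have iterE m v : iter m (fun u => x u - l *: u) v = iter m (fun u => T u - l *: u) v.
  by apply: eq_iter => u; rewrite xT.
have vv (i : 'I_(size s)) : '[flag_vec s i, flag_vec s i] = 1.
  have := flag_diag TS 0 fs (ltn_ord i) => /=; by rewrite expr0.
exists (fun i => flag_vec s i); split.
- move=> i; exists (size s); rewrite iterE; apply: (eigenflag_le TS); first by split.
  exact: span_vec.
- move=> a E i; have := congr1 (fun u => '[u, flag_vec s i]) E.
  rewrite dot0l dot_suml (bigD1 i) //= dotZl vv mulr1 big1 ?addr0 // => j ji.
  by rewrite dotZl on.2 ?mulr0 // => E'; move/eqP: ji; apply; apply: val_inj.
- move=> v [m]; rewrite iterE => /(max_eigenflag_ge TS hs) hv.
  by exists (fun i => '[v, flag_vec s i]); rewrite -{1}hv.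
Qed.

End Eigenvalues.

Lemma trace_class_data (R : realType) (H : separable_hilbert R) (x : {linear H -> H}) :
  trace_class_op x -> exists xs b c, [/\ is_adjoint x xs, 0 <= b, bounded_by x b & nuclear x c].
Proof.
move=> hx; have [c hc] := trace_class_nuclear hx; have [/continuous_bounded[b b0 hb] [xs [p [h _ _ _]]]] := hx.
by exists xs, b, c.
Qed.

(** Both multiplicities are lengths of maximal flags for [l], and the power sum
    estimates at radius [|l| / 2] determine these from the common moments. *)
Lemma trace_moments_mult (R : realType) (H H' : separable_hilbert R)
   (x : {linear H -> H}) (y : {linear H' -> H'}) (t : nat -> R[i]) l s :
  trace_class_op x -> trace_class_op y ->
  (forall m, (2 <= m)%N -> is_trace (iter m x) (t m)) ->
  (forall m, (2 <= m)%N -> is_trace (iter m y) (t m)) ->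
  l != 0 -> max_eigenflag x l s -> alg_mult y l (size s).
Proof.
move=> hx hy tx ty l0 hs.
have [xs [b [c [xxs b0 bx nx]]]] := trace_class_data hx.
have [ys [b' [c' [yys b0' by' ny]]]] := trace_class_data hy.
have [s' hs'] := max_eigenflag_exists yys ny l0.
have nl := nm_gt0 l0.
pose r := nm l / 2.
have r0 : 0 < r by rewrite divr_gt0.
have rl : r < nm l by rewrite /r; lra.
have [u [lu [K hK]]] := max_eigenflag_estimate xxs b0 bx nx r0 (ltW rl) hs.
have [u' [lu' [K' hK']]] := max_eigenflag_estimate yys b0' by' ny r0 (ltW rl) hs'.
suff -> : size s = size s' by exact: (max_eigenflag_mult yys) hs'.
apply: (power_sums_mult (K := K + K') r0 rl lu lu') => m m2.
have /is_traceP[e he ht] := tx m m2.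
have /is_traceP[e' he' ht'] := ty m m2.
have h := hK m e _ (ltnW m2) he ht; have h' := hK' m e' _ (ltnW m2) he' ht'.
rewrite mulrDl; apply: (le_trans (nm_tri _ (t m) _)).
by rewrite nmBC lerD.
Qed.

(** * Finite Hilbert sums and matrices of operators *)

Section HilbertSum.
Context {R : realType} (H : separable_hilbert R) (n : nat).
Local Notation C := R[i].

(** An alias of the type of finite functions, to carry the Hilbert norm. *)
Definition hsum : Type := {ffun 'I_n -> H}.

HB.instance Definition _ := GRing.Lmodule.copy hsum {ffun 'I_n -> H}.

Implicit Types u v : hsum.

Definition hsum_nm v : R := Num.sqrt (\sum_i nm (v i) ^+ 2).

Lemma hsum_nm_sq v : hsum_nm v ^+ 2 = \sum_i nm (v i) ^+ 2.
Proof. by rewrite sqr_sqrtr // sumr_ge0 // => i _; rewrite sqr_ge0. Qed.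

Lemma hsum_nm_ge0 v : 0 <= hsum_nm v.
Proof. exact: sqrtr_ge0. Qed.

Lemma hsumDE u v i : (u + v) i = u i + v i.
Proof. by rewrite ffunE. Qed.

Lemma hsumZE (a : C) v i : (a *: v) i = a *: v i.
Proof. by rewrite ffunE. Qed.

Lemma ord_cauchy_schwarz (f g : 'I_n -> R) (a b : R) : 0 <= a -> 0 <= b ->
  (forall i, 0 <= f i) -> (forall i, 0 <= g i) ->
  \sum_i f i ^+ 2 <= a ^+ 2 -> \sum_i g i ^+ 2 <= b ^+ 2 -> \sum_i f i * g i <= a * b.
Proof.
move=> a0 b0 f0 g0 hf hg.
pose ext (h : 'I_n -> R) k := if insub k is Some i then h i else 0.
have E h i : ext h (val i) = h i by rewrite /ext valK.
rewrite (eq_bigr (fun i : 'I_n => ext f i * ext g i)) => [|i _]; last by rewrite !E.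
apply: sum_cauchy_schwarz => // [k|k||]; try by rewrite /ext; case: insub.
  by rewrite (eq_bigr (fun i => f i ^+ 2)) // => i _; rewrite E.
by rewrite (eq_bigr (fun i => g i ^+ 2)) // => i _; rewrite E.
Qed.

Lemma hsum_nmD u v : hsum_nm (u + v) <= hsum_nm u + hsum_nm v.
Proof.
rewrite -(@ler_pXn2r _ 2) ?nnegrE ?addr_ge0 ?hsum_nm_ge0 // hsum_nm_sq.
apply: le_trans (_ : \sum_i (nm (u i) ^+ 2 + nm (v i) ^+ 2 + (nm (u i) * nm (v i)) *+ 2) <= _).
  apply: ler_sum => i _; rewrite hsumDE.
  rewrite addrAC -sqrrD ler_pXn2r ?nnegrE ?addr_ge0 ?nm_ge0 //; exact: nmD.
rewrite big_split big_split /= -!hsum_nm_sq sumrMnl sqrrD [X in _ <= X]addrAC lerD2l lerMn2r /=.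
by apply: ord_cauchy_schwarz; rewrite ?hsum_nm_ge0 ?hsum_nm_sq // => i; exact: nm_ge0.
Qed.

Lemma hsum_nmZ (a : C) v : hsum_nm (a *: v) = nm a * hsum_nm v.
Proof.
apply/eqP; rewrite -(@eqrXn2 _ 2) ?mulr_ge0 ?hsum_nm_ge0 ?nm_ge0 // exprMn !hsum_nm_sq.
by rewrite mulr_sumr; apply/eqP/eq_bigr => i _; rewrite hsumZE nmZ exprMn.
Qed.

Lemma hsum_nm_coord v i : nm (v i) <= hsum_nm v.
Proof.
rewrite -(@ler_pXn2r _ 2) ?nnegrE ?hsum_nm_ge0 ?nm_ge0 // hsum_nm_sq.
by rewrite (bigD1 i) //= lerDl sumr_ge0 // => j _; rewrite sqr_ge0.
Qed.

Lemma hsum_nm0 v : hsum_nm v = 0 -> v = 0.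
Proof.
move=> h; apply/ffunP => i; rewrite ffunE; apply/nm_eq0/le_anti.
by rewrite nm_ge0 -h hsum_nm_coord.
Qed.

Definition hsum_norm v : C := (hsum_nm v)%:C.

Lemma hsum_normD u v : hsum_norm (u + v) <= hsum_norm u + hsum_norm v.
Proof. by rewrite /hsum_norm -rmorphD lecR hsum_nmD. Qed.

Lemma hsum_normZ (a : C) v : hsum_norm (a *: v) = `|a| * hsum_norm v.
Proof. by rewrite /hsum_norm hsum_nmZ rmorphM nmE. Qed.

Lemma hsum_norm0 v : hsum_norm v = 0 -> v = 0.
Proof. by move=> h; apply/hsum_nm0; exact: complexI. Qed.

HB.instance Definition _ := Lmodule_isNormed.Build C hsum hsum_normD hsum_normZ hsum_norm0.

Lemma hsum_nmE v : nm v = hsum_nm v.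
Proof. by []. Qed.

Lemma hsum_nm_le v : nm v <= \sum_i nm (v i).
Proof.
rewrite hsum_nmE -(@ler_pXn2r _ 2) ?nnegrE ?hsum_nm_ge0 //; last first.
  by rewrite sumr_ge0 // => i _; exact: nm_ge0.
rewrite hsum_nm_sq expr2 mulr_suml ler_sum // => i _.
rewrite expr2 ler_wpM2l ?nm_ge0 // (bigD1 i) //= lerDl sumr_ge0 // => j _.
exact: nm_ge0.
Qed.

Lemma hsum_complete (F : set_system hsum) : ProperFilter F -> cauchy F -> cvg F.
Proof.
move=> FF Fc.
have hi i : exists l : H, (fun v : hsum => v i) @ F --> l.
  have : cauchy ((fun v : hsum => v i) @ F).
    apply: cauchy_exP => e e0.
    have /cauchyP/(_ e e0)[v hv] : cauchy F by [].
    exists (v i); have : F [set u : hsum | ball (v i) e (u i)]; last by [].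
    apply: filterS hv => u /=; rewrite -!ball_normE /ball_ /=.
    apply: le_lt_trans; rewrite nmE -[X in _ <= X]/((hsum_nm (v - u))%:C) lecR.
    have := hsum_nm_coord (v - u) i; by rewrite !ffunE.
  by move=> /cauchy_cvgP/cvg_ex.
have [l hl] := choice hi.
apply/cvg_ex; exists ([ffun i => l i] : hsum).
apply/cvgrPdist_lt => e e0.
have E : e = (nm e)%:C by apply: ge0_nm; exact: ltW.
move: (nm e) E => d E; rewrite {}E ltcR in e0 *.
have d0 : 0 < d / n.+1%:R by rewrite divr_gt0.
have H1 : F [set v : hsum | forall i, nm (l i - v i) < d / n.+1%:R].
  apply: filter_forall => i; have d0' : 0 < (d / n.+1%:R)%:C :> C by rewrite ltcR.
  have /cvgrPdist_lt/(_ _ d0') := hl i.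
  by apply: filterS => v /=; rewrite nmE ltcR.
apply: filterS H1 => v hv /=; rewrite nmE ltcR.
apply: (le_lt_trans (hsum_nm_le _)).
apply: le_lt_trans (_ : \sum_(i < n) d / n.+1%:R < _).
  by apply: ler_sum => i _; rewrite !ffunE ltW //; exact: hv i.
rewrite sumr_const card_ord -[X in X < _]mulr_natr mulrAC ltr_pdivrMr // ltr_pM2l //.
by rewrite ltr_nat.
Qed.

HB.instance Definition _ := Uniform_isComplete.Build hsum hsum_complete.

Definition hsum_dot u v : C := \sum_i '[u i, v i].

Lemma hsum_dot_bilinear :
  bilinear_for (GRing.Scale.Law.clone _ _ *%R _)
    (GRing.Scale.Law.clone _ _ (Num.conj \; *%R) _) hsum_dot.
Proof.
split=> [w a u v|w a u v] /=; rewrite /hsum_dot mulr_sumr -big_split /=;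
  apply: eq_bigr => i _; rewrite !ffunE.
  by rewrite dotDl dotZl.
by rewrite dotDr dotZr.
Qed.

HB.instance Definition _ := bilinear_isBilinear.Build C hsum hsum C
  (GRing.Scale.Law.clone _ _ *%R _) (GRing.Scale.Law.clone _ _ (Num.conj \; *%R) _)
  hsum_dot hsum_dot_bilinear.

Lemma hsum_dot_herm u v : hsum_dot u v = (-1) ^+ false * Num.conj (hsum_dot v u).
Proof.
rewrite expr0 mul1r /hsum_dot rmorph_sum; apply: eq_bigr => i _.
exact: dotC.
Qed.

HB.instance Definition _ := @isHermitianSesquilinear.Build C hsum false Num.conj
  hsum_dot hsum_dot_herm.

Lemma hsum_dot_norm v : `|v| ^+ 2 = hsum_dot v v.
Proof.
rewrite nmE -rmorphXn /= hsum_nmE hsum_nm_sq rmorph_sum; apply: eq_bigr => i _.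
by rewrite dot_nm.
Qed.

Lemma hsum_dot_gt0 v : v != 0 -> 0 < hsum_dot v v.
Proof. by move=> v0; rewrite -hsum_dot_norm exprn_gt0 // normr_gt0. Qed.

HB.instance Definition _ := isDotProduct.Build C hsum hsum_dot hsum_dot_gt0.

Lemma hsum_separable : exists2 S : set hsum, countable S & dense S.
Proof.
have [S0 /countable_injP[f hf] dS] := hilbert_separable H.
exists [set v : hsum | forall i, S0 (v i)].
  apply/countable_injP.
  exists (fun v : hsum => pickle ([ffun i => f (v i)] : {ffun 'I_n -> nat})).
  move=> u v /set_mem hu /set_mem hv /(pcan_inj pickleK) E.
  apply/ffunP => i; apply: hf; rewrite ?inE //.
  by have /ffunP/(_ i) := E; rewrite !ffunE.
move=> O [v Ov] openO.
have /nbhs_ballP[e /= e0 he] : nbhs v O by exact: open_nbhs_nbhs.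
have E : e = (nm e)%:C by apply: ge0_nm; exact: ltW.
move: (nm e) E => d E; rewrite {}E ltcR in e0 he.
have d0 : 0 < (d / n.+1%:R)%:C :> C by rewrite ltcR divr_gt0.
have hx i : exists w : H, S0 w /\ nm (v i - w) < d / n.+1%:R.
  have [||w [hw Sw]] := dS (interior (ball (v i) (d / n.+1%:R)%:C)).
  - by exists (v i); exact: nbhsx_ballx.
  - exact: open_interior.
  exists w; split=> //; have := interior_subset hw.
  by rewrite -ball_normE /ball_ /= nmE ltcR.
have [w hw] := choice hx.
exists ([ffun i => w i] : hsum); split; last by move=> i /=; rewrite ffunE; case: (hw i).
apply: he; rewrite -ball_normE /ball_ /= nmE ltcR.
apply: (le_lt_trans (hsum_nm_le _)).
apply: le_lt_trans (_ : \sum_(i < n) d / n.+1%:R < _).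
  by apply: ler_sum => i _; rewrite !ffunE ltW //; case: (hw i).
rewrite sumr_const card_ord -[X in X < _]mulr_natr mulrAC ltr_pdivrMr // ltr_pM2l //.
by rewrite ltr_nat.
Qed.

End HilbertSum.

Definition hilbert_sum (R : realType) (H : separable_hilbert R) (n : nat) : separable_hilbert R :=
  @SeparableHilbert R (hsum H n : completeNormedModType R[i])
    (@hsum_dot R H n : {dot _ for Num.conj}) (@hsum_dot_norm R H n) (@hsum_separable R H n).

Section OperatorMatrix.
Context {R : realType} (H : separable_hilbert R) (n : nat).
Local Notation C := R[i].
Local Notation HH := (hilbert_sum H n).

Lemma hdot_sumE (u v : HH) : '[u, v] = \sum_i '[u i, v i].
Proof. by []. Qed.

Definition coord_inj (i : 'I_n) (h : H) : HH := [ffun j => if j == i then h else 0].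

Lemma dot_coord_inj i h (v : HH) : '[coord_inj i h, v] = '[h, v i].
Proof.
rewrite hdot_sumE (bigD1 i) //= ffunE eqxx big1 ?addr0 // => j ji.
by rewrite ffunE (negbTE ji) dot0l.
Qed.

Lemma dot_coord_injr i h (v : HH) : '[v, coord_inj i h] = '[v i, h].
Proof. by rewrite dotC dot_coord_inj conj_dot. Qed.

Lemma nm_coord_inj i h : nm (coord_inj i h) = nm h.
Proof.
apply/eqP; rewrite -(@eqrXn2 _ 2) ?nm_ge0 //; apply/eqP.
apply: complexI; rewrite -!dot_nm dot_coord_inj ffunE eqxx //.
Qed.

Definition opmx (X : 'I_n -> 'I_n -> H -> H) (v : HH) : HH :=
  [ffun i => \sum_j X i j (v j)].

Lemma opmx_adj (X Xs : 'I_n -> 'I_n -> H -> H) :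
  (forall i j, is_adjoint (X i j) (Xs j i)) -> is_adjoint (opmx X) (opmx Xs).
Proof.
move=> h u v; rewrite !hdot_sumE.
transitivity (\sum_i \sum_j '[X i j (u j), v i]).
  by apply: eq_bigr => i _; rewrite ffunE dot_suml.
rewrite exchange_big /=; apply: eq_bigr => j _; rewrite ffunE dot_sumr.
by apply: eq_bigr => i _; rewrite h.
Qed.

Lemma opmx_bounded (X : 'I_n -> 'I_n -> H -> H) (b : 'I_n -> 'I_n -> R) :
  (forall i j, 0 <= b i j) -> (forall i j, bounded_by (X i j) (b i j)) ->
  bounded_by (opmx X) (\sum_i \sum_j b i j).
Proof.
move=> b0 h v; apply: (le_trans (hsum_nm_le _)); rewrite mulr_suml ler_sum // => i _.
rewrite ffunE (le_trans (nm_sum _ _ _)) // mulr_suml ler_sum // => j _.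
apply: (le_trans (h i j _)); apply: ler_wpM2l => //.
exact: hsum_nm_coord.
Qed.

Lemma bessel_coord N (e : nat -> HH) i : bessel_family N e -> bessel_family N (fun k => e k i).
Proof.
move=> he v; rewrite -(nm_coord_inj i); apply: le_trans (he (coord_inj i v)).
by apply: ler_sum => k _; rewrite dot_coord_inj.
Qed.

Lemma opmx_trace_bounded (X : 'I_n -> 'I_n -> H -> H) (c : 'I_n -> 'I_n -> R) :
  (forall i j, trace_bounded (X i j) (c i j)) -> trace_bounded (opmx X) (\sum_i \sum_j c i j).
Proof.
move=> h N e f he hf.
apply: le_trans (_ : \sum_(k < N) \sum_i \sum_j nm '[X i j (e k j), f k i] <= _).
  apply: ler_sum => k _; rewrite hdot_sumE (le_trans (nm_sum _ _ _)) // ler_sum // => i _.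
  by rewrite ffunE dot_suml (le_trans (nm_sum _ _ _)).
rewrite exchange_big ler_sum // => i _; rewrite exchange_big ler_sum // => j _.
by apply: (h i j N (fun k => e k j) (fun k => f k i)); exact: bessel_coord.
Qed.

Hypothesis n0 : (0 < n)%N.

(** The basis [e_k] placed in coordinate [j] has index [k n + j]. *)
Definition onb_sum (e : nat -> H) (m : nat) : HH :=
  coord_inj (Ordinal (ltn_pmod m n0)) (e (m %/ n)%N).

Lemma onb_sumP e : orthonormal_basis e -> orthonormal_basis (onb_sum e).
Proof.
move=> [h1 h2 h3]; split.
- move=> m; rewrite /onb_sum dot_coord_inj ffunE eqxx.
  case: (h1 (m %/ n)%N) => [->|->]; [left|by right].
  by apply/ffunP => j; rewrite !ffunE; case: ifP.
- move=> i j ij; rewrite /onb_sum dot_coord_inj ffunE; case: eqP; last by rewrite dot0r.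
  move=> [E]; apply: h2 => E2; apply: ij.
  by rewrite (divn_eq i n) (divn_eq j n) E E2.
- move=> v hv; apply/ffunP => j; rewrite ffunE; apply: h3 => k.
  have := hv (k * n + j)%N; rewrite -conj_dot /onb_sum dot_coord_inj.
  have -> : Ordinal (ltn_pmod (k * n + j) n0) = j.
    by apply: val_inj; rewrite /= modnMDl modn_small.
  rewrite divnMDl // divn_small // addn0 => /eqP.
  by rewrite conj_dot => /eqP.
Qed.

Lemma count_step (j M : nat) : (j < n)%N ->
  ((M.+1 + n.-1 - j) %/ n = (M + n.-1 - j) %/ n + (M %% n == j))%N.
Proof.
move=> jn; have := ltn_pmod M n0; move: (divn_eq M n).
move: (M %/ n)%N (M %% n)%N => q s EM sn.
have one x : (n <= x)%N -> (x < n + n)%N -> (x %/ n = 1)%N.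
  move=> h1 h2; rewrite -(subnKC h1) -{1}[n]mul1n divnMDl // divn_small //.
  by rewrite ltn_subLR.
have -> : (M.+1 + n.-1 - j = q * n + (s + n - j))%N by lia.
have -> : (M + n.-1 - j = q * n + (s + n.-1 - j))%N by lia.
rewrite !divnMDl // -addnA; congr (_ + _)%N.
case: (ltngtP s j) => h.
- rewrite !divn_small //; lia.
- rewrite !one //; lia.
- by rewrite one ?divn_small //; lia.
Qed.

(** Of the indices below [M], those congruent to [j] correspond to the
    [k < ceil ((M - j) / n)]. *)
Lemma sum_mod_count (g : nat -> C) (j M : nat) : (j < n)%N ->
  \sum_(m < M) (if (m %% n == j)%N then g (m %/ n)%N else 0) =
  \sum_(k < (M + n.-1 - j) %/ n) g k.
Proof.
move=> jn; elim: M => [|M IH].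
  by rewrite big_ord0 divn_small ?big_ord0 //; lia.
rewrite big_ord_recr /= IH count_step //.
have [E|E] := eqVneq (M %% n)%N j; last by rewrite addn0 addr0.
rewrite addn1 big_ord_recr /=; congr (_ + g _).
rewrite [in RHS](divn_eq M n) E.
have -> : (M %/ n * n + j + n.-1 - j = M %/ n * n + n.-1)%N by rewrite addnAC addnK.
by rewrite divnMDl // [(n.-1 %/ n)%N]divn_small ?addn0 // ltn_predL.
Qed.

(** The partial sums of the trace on the Hilbert sum are sums of partial sums, of
    different lengths, of the diagonal traces. *)
Lemma opmx_trace (X : 'I_n -> 'I_n -> H -> H) (t : 'I_n -> C) e :
  (forall i j, X i j 0 = 0) ->
  orthonormal_basis e ->
  (forall i, tends_to (fun N => \sum_(k < N) '[X i i (e k), e k]) (t i)) ->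
  is_trace (opmx X) (\sum_i t i).
Proof.
move=> X0 he ht; apply/is_traceP; exists (onb_sum e); first exact: onb_sumP.
have h : tends_to (fun M => \sum_i \sum_(k < (M + n.-1 - (i : 'I_n)) %/ n) '[X i i (e k), e k])
    (\sum_i t i).
  apply: tends_to_sum => i; apply: (tends_to_sub (s := fun M => ((M + n.-1 - i) %/ n)%N) _ (ht i)).
  move=> N; exists (N * n)%N => M hM; rewrite leq_divRL //.
  by have := ltn_ord i; lia.
apply: eq_tends_to h => M.
under eq_bigr do rewrite -(sum_mod_count (fun k => '[X _ _ (e k), e k])) //.
rewrite exchange_big /=; apply: eq_bigr => m _.
pose i0 := Ordinal (ltn_pmod m n0).
transitivity '[opmx X (onb_sum e m) i0, e (m %/ n)%N]; last exact/esym/dot_coord_injr.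
rewrite ffunE /onb_sum -/i0; rewrite (bigD1 i0) //= eqxx big1 ?addr0; last first.
  by move=> i ii; case: eqP => // E; case/eqP: ii; apply: val_inj.
congr '[_, _]; rewrite (bigD1 i0) //= ffunE eqxx big1 ?addr0 // => j ji.
by rewrite ffunE (negbTE ji) X0.
Qed.

End OperatorMatrix.

(** * Matrices of linear combinations of words *)

Section Words.
Context {R : realType} {Alg : algType R[i]} (star : Alg -> Alg) (D : set Alg)
  (omega : Alg -> R[i]).
Local Notation C := R[i].
Hypothesis hstar : is_star star.
Hypothesis homega : tracial_weight star D omega.

Lemma star1 : star 1 = 1.
Proof.
have [_ hm hi] := hstar.
have h y : y = y * star 1 by rewrite -{1}[y]hi -[X in star X]mul1r hm hi.
by rewrite -[LHS]mul1r -h.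
Qed.

Lemma star0 : star 0 = 0.
Proof.
have [hl _ _] := hstar; have := hl 1 0 0.
rewrite scale1r addr0 rmorph1 scale1r => h.
by apply: (addrI (star 0)); rewrite -h addr0.
Qed.

Lemma starZ (c : C) z : star (c *: z) = Num.conj c *: star z.
Proof. by have [hl _ _] := hstar; have := hl c z 0; rewrite !addr0 star0 addr0. Qed.

Lemma starD y z : star (y + z) = star y + star z.
Proof. by have [hl _ _] := hstar; have := hl 1 y z; rewrite rmorph1 !scale1r. Qed.

Lemma star_sum (J : Type) (r : seq J) (F : J -> Alg) :
  star (\sum_(i <- r) F i) = \sum_(i <- r) star (F i).
Proof. by elim: r => [|i r IH]; rewrite ?big_nil ?star0 // !big_cons starD IH. Qed.

Lemma dom0 : D 0. Proof. by case: homega => -[]. Qed.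
Lemma domZD (c : C) y z : D y -> D z -> D (c *: y + z).
Proof. by case: homega => -[_ h _ _] _; exact: h. Qed.
Lemma domD y z : D y -> D z -> D (y + z).
Proof. by move=> h h'; rewrite -[y]scale1r; exact: domZD. Qed.
Lemma domZ (c : C) z : D z -> D (c *: z).
Proof. by move=> h; rewrite -[_ *: _]addr0; apply: domZD => //; exact: dom0. Qed.
Lemma domM y z : D y -> D z -> D (y * z).
Proof. by case: homega => -[_ _ h _] _; exact: h. Qed.
Lemma dom_star z : D z -> D (star z).
Proof. by case: homega => -[_ _ _ h] _; exact: h. Qed.
Lemma dom_sum (J : Type) (r : seq J) (F : J -> Alg) :
  (forall i, D (F i)) -> D (\sum_(i <- r) F i).
Proof.
by move=> h; elim: r => [|i r IH]; rewrite ?big_nil ?big_cons; [exact: dom0|apply: domD].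
Qed.

Lemma omegaZD (c : C) y z : D y -> D z -> omega (c *: y + z) = c * omega y + omega z.
Proof. by case: homega => _ [h _ _ _]; exact: h. Qed.
Lemma omega0 : omega 0 = 0.
Proof.
have := omegaZD 1 dom0 dom0; rewrite scale1r addr0 mul1r => h.
by apply: (addrI (omega 0)); rewrite -h addr0.
Qed.
Lemma omegaD y z : D y -> D z -> omega (y + z) = omega y + omega z.
Proof. by move=> h h'; rewrite -[y]scale1r omegaZD // mul1r scale1r. Qed.
Lemma omegaZ (c : C) z : D z -> omega (c *: z) = c * omega z.
Proof. by move=> h; rewrite -[_ *: _]addr0 omegaZD ?omega0 ?addr0 //; exact: dom0. Qed.
Lemma omega_sum (J : Type) (r : seq J) (F : J -> Alg) :
  (forall i, D (F i)) -> omega (\sum_(i <- r) F i) = \sum_(i <- r) omega (F i).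
Proof.
move=> h; elim: r => [|i r IH]; rewrite ?big_nil ?omega0 // !big_cons omegaD ?IH //.
exact: dom_sum.
Qed.

Section Rep.
Variables (I : eqType) (a : I -> Alg) (H : separable_hilbert R).
Variables (x xs : I -> {linear H -> H}).
Hypothesis aD : forall i, D (a i).
Hypothesis xtc : forall i, trace_class_op (x i).
Hypothesis xadj : forall i, is_adjoint (x i) (xs i).
Hypothesis xtr : forall s : seq (I * bool), (0 < size s)%N ->
  is_trace (op_word x xs s) (omega (star_word star a s)).


Definition adjoint_word (s : seq (I * bool)) := rev [seq (p.1, ~~ p.2) | p <- s].

Lemma star_word_flip s : star (star_word star a s) = star_word star a (adjoint_word s).
Proof.
have [_ hm hi] := hstar.
rewrite /adjoint_word /star_word; elim: s => [|p s IH]; first by rewrite !big_nil star1.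
rewrite big_cons hm IH /= rev_cons -cats1 big_cat big_seq1 /=; congr (_ * _).
by case: p.2 => /=; rewrite ?hi.
Qed.

Lemma op_word_flip s : is_adjoint (op_word x xs s) (op_word x xs (adjoint_word s)).
Proof.
elim: s => [|p s IH] u v //=.
rewrite /adjoint_word /= rev_cons /op_word foldr_rcons -/(op_word x xs _).
have <- : '[op_word x xs s u, (if ~~ p.2 then xs p.1 else x p.1) v] =
   '[(if p.2 then xs p.1 else x p.1) (op_word x xs s u), v].
  by case: p.2 => /=; [rewrite (adjC (xadj _)) | rewrite xadj].
rewrite IH /adjoint_word; congr '[_, _].
elim: (rev _) => [|q r IHr] //=; by rewrite IHr.
Qed.

Lemma op_word_cat s s' v : op_word x xs (s ++ s') v = op_word x xs s (op_word x xs s' v).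
Proof. by elim: s => [|p s IH] //=; rewrite IH. Qed.

(** The first letter is nuclear and the remaining ones are bounded. *)
Lemma op_word_nuclear s : (0 < size s)%N -> exists c, nuclear (op_word x xs s) c.
Proof.
case: s => // p s _.
have hb : forall s, exists2 b, 0 <= b & bounded_by (op_word x xs s) b.
  elim=> [|q r [b b0 hb]]; first by exists 1 => //; exact: bounded_by_id.
  have [[xc _] _] := (xtc q.1, tt); have [d d0 hd] := continuous_bounded xc.
  exists (d * b); first by rewrite mulr_ge0.
  case E : q.2; rewrite /op_word /= E.
    exact: (@bounded_by_comp _ _ (xs q.1) _ _ _ d0 (adj_bounded (xadj _) d0 hd) hb).
  exact: (@bounded_by_comp _ _ (x q.1) _ _ _ d0 hd hb).
have [b b0 hbs] := hb s; have [c hc] := trace_class_nuclear (xtc p.1).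
have hn : nuclear (if p.2 then xs p.1 else x p.1) c.
  by case: p.2 => //; exact: nuclear_adj (xadj _) hc.
by exists (b * c); apply: (nuclear_compr b0 (op_word_flip s) hbs hn).
Qed.

Lemma star_word_D s : (0 < size s)%N -> D (star_word star a s).
Proof.
elim: s => // p s IH _; rewrite /star_word big_cons -/(star_word star a s).
have hp : D (if p.2 then star (a p.1) else a p.1) by case: p.2; [apply: dom_star|]; exact: aD.
case: s IH => [|q s] IH; first by rewrite /star_word big_nil mulr1.
by apply: domM => //; exact: IH.
Qed.

(** [z] and [T] are given by the same linear combination of nonempty words, in the
    [a i] and in the [x i].  A relation, as different combinations for [z] may
    give different operators. *)
Definition represents (z : Alg) (T : H -> H) := exists L : seq (C * seq (I * bool)),
  [/\ all (fun p => (0 < size p.2)%N) L, z = \sum_(p <- L) p.1 *: star_word star a p.2 &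
   forall v, T v = \sum_(p <- L) p.1 *: op_word x xs p.2 v].

Lemma eq_represents z T T' : T =1 T' -> represents z T -> represents z T'.
Proof. by move=> /funext ->. Qed.

Lemma represents_gen i : represents (a i) (x i).
Proof.
exists [:: (1, [:: (i, false)])]; split=> //.
  by rewrite big_seq1 scale1r /star_word big_seq1.
by move=> v; rewrite big_seq1 scale1r.
Qed.

Lemma represents0 : represents 0 (fun=> 0).
Proof. by exists [::]; split=> // [|v]; rewrite big_nil. Qed.

Lemma representsD z T w U : represents z T -> represents w U -> represents (z + w) (fun v => T v + U v).
Proof.
move=> [L [l1 l2 l3]] [M [m1 m2 m3]]; exists (L ++ M); split.
- by rewrite all_cat l1.
- by rewrite l2 m2 big_cat.
- by move=> v; rewrite l3 m3 big_cat.
Qed.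

Lemma representsZ (c : C) z T : represents z T -> represents (c *: z) (fun v => c *: T v).
Proof.
move=> [L [l1 l2 l3]]; exists [seq (c * p.1, p.2) | p <- L]; split.
- by rewrite all_map.
- by rewrite l2 big_map scaler_sumr; apply: eq_bigr => p _; rewrite scalerA.
- by move=> v; rewrite l3 big_map scaler_sumr; apply: eq_bigr => p _; rewrite scalerA.
Qed.

Lemma represents_sum (J : Type) (r : seq J) (F : J -> Alg) (T : J -> H -> H) :
  (forall i, represents (F i) (T i)) -> represents (\sum_(i <- r) F i) (fun v => \sum_(i <- r) T i v).
Proof.
move=> h; elim: r => [|i r IH].
  by rewrite big_nil; apply: eq_represents represents0 => v; rewrite big_nil.
by rewrite big_cons; apply: eq_represents (representsD (h i) IH) => v; rewrite big_cons.
Qed.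

Lemma representsM z T w U : represents z T -> represents w U -> represents (z * w) (T \o U).
Proof.
move=> [L [l1 l2 l3]] [M [m1 m2 m3]].
exists [seq (p.1 * q.1, p.2 ++ q.2) | p <- L, q <- M]; split.
- apply/allP => r /allpairsP[[p q] /= [pL qM ->]] /=.
  by rewrite size_cat addn_gt0 (allP l1 p pL).
- rewrite l2 m2 big_allpairs_dep mulr_suml; apply: eq_bigr => p _.
  rewrite mulr_sumr; apply: eq_bigr => q _ /=.
  by rewrite /star_word big_cat /= -scalerAl -scalerAr scalerA.
- move=> v; rewrite /= l3 big_allpairs_dep; apply: eq_bigr => p _.
  rewrite m3 (adj_sum (op_word_flip p.2)) scaler_sumr; apply: eq_bigr => q _ /=.
  by rewrite (adj_Z (op_word_flip p.2)) scalerA op_word_cat.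
Qed.

Lemma represents_star z T : represents z T -> exists2 T', is_adjoint T T' & represents (star z) T'.
Proof.
move=> [L [l1 l2 l3]].
exists (fun v => \sum_(p <- L) Num.conj p.1 *: op_word x xs (adjoint_word p.2) v).
  move=> u v; rewrite l3 dot_suml dot_sumr; apply: eq_bigr => p _.
  by rewrite dotZl dotZr conjCK op_word_flip.
exists [seq (Num.conj p.1, adjoint_word p.2) | p <- L]; split.
- rewrite all_map; apply: sub_all l1 => p /=.
  by rewrite /adjoint_word size_rev size_map.
- by rewrite l2 star_sum big_map; apply: eq_bigr => p _; rewrite starZ star_word_flip.
- by move=> v; rewrite big_map.
Qed.

Lemma represents_ind (P : Alg -> (H -> H) -> Prop) :
  (forall z T T', T =1 T' -> P z T -> P z T') -> P 0 (fun=> 0) ->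
  (forall s, (0 < size s)%N -> P (star_word star a s) (op_word x xs s)) ->
  (forall (c : C) z T w U, P z T -> P w U -> P (c *: z + w) (fun v => c *: T v + U v)) ->
  forall z T, represents z T -> P z T.
Proof.
move=> Peq P0 Pw PD z T [L [l1 l2 l3]].
rewrite l2; apply: (Peq _ (fun v => \sum_(p <- L) p.1 *: op_word x xs p.2 v)).
  by move=> v; rewrite l3.
elim: L l1 {l2 l3} => [_|p L IH /= /andP[hp hL]].
  by rewrite big_nil; apply: Peq P0 => v; rewrite big_nil.
rewrite big_cons; apply: Peq (PD _ _ _ _ _ (Pw _ hp) (IH hL)) => v.
by rewrite big_cons.
Qed.

(** Everything here holds for words and is linear.  In particular the trace of [T]
    is the weight of [z], in every basis. *)
Lemma represents_props z T : represents z T ->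
  [/\ D z, exists2 b, 0 <= b & bounded_by T b, exists c, trace_bounded T c &
      forall e, orthonormal_basis e -> tends_to (fun N => \sum_(k < N) '[T (e k), e k]) (omega z)].
Proof.
move: z T; apply: represents_ind => [z T T' /funext -> //||s s0|c z T w U].
- split; first exact: dom0.
  + by exists 0 => // v; rewrite nm0 mul0r.
  + by exists 0; exact: trace_bounded0.
  + move=> e he; rewrite omega0; apply: eq_tends_to (tends_to_cst _) => N.
    by rewrite big1 // => k _; rewrite dot0l.
- have [c hc] := op_word_nuclear s0; split.
  + exact: star_word_D.
  + by exists c; [exact: nuclear_ge0 hc | exact: nuclear_bounded hc].
  + by exists c; exact: nuclear_trace_bounded.
  + move=> e he; have /is_traceP[f hf ht] := xtr s0.
    exact: nuclear_trace hc hf he ht.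
- move=> [Dz [b b0 hb] [d hd] ht] [Dw [b' b0' hb'] [d' hd'] ht']; split.
  + exact: domZD.
  + exists (nm c * b + b'); first by rewrite addr_ge0 // mulr_ge0 ?nm_ge0.
    move=> v; rewrite (le_trans (nmD _ _)) // mulrDl lerD // nmZ -mulrA.
    by rewrite ler_wpM2l ?nm_ge0.
  + by exists (nm c * d + d'); apply: trace_boundedD => //; exact: trace_boundedZ.
  + move=> e he; rewrite omegaZD //.
    apply: eq_tends_to (tends_toD (tends_toMl c (ht e he)) (ht' e he)) => N.
    rewrite mulr_sumr -big_split; apply: eq_bigr => k _.
    by rewrite dotDl dotZl.
Qed.

Section Matrices.
Variable n : nat.
Hypothesis n0 : (0 < n)%N.
Variable e0 : nat -> H.
Hypothesis he0 : orthonormal_basis e0.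

Definition mx_represents (M : 'M[Alg]_n) (X : 'I_n -> 'I_n -> H -> H) :=
  forall i j, represents (M i j) (X i j).

Definition opmx_mul (X Y : 'I_n -> 'I_n -> H -> H) i j (v : H) := \sum_l X i l (Y l j v).

Lemma represents_adjoint z T : represents z T -> exists T', is_adjoint T T'.
Proof. by case/represents_star => T' h _; exists T'. Qed.

Lemma mx_representsM M X N Y : mx_represents M X -> mx_represents N Y -> mx_represents (M * N) (opmx_mul X Y).
Proof.
move=> hM hN i j; rewrite mxE; apply: represents_sum => l.
exact: representsM.
Qed.

Lemma opmx_comp M X N Y (v : hilbert_sum H n) : mx_represents M X -> mx_represents N Y ->
  opmx X (opmx Y v) = opmx (opmx_mul X Y) v.
Proof.
move=> hM hN; apply/ffunP => i; rewrite !ffunE.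
transitivity (\sum_l \sum_j X i l (Y l j (v j))).
  apply: eq_bigr => l _; rewrite ffunE; have [T' h] := represents_adjoint (hM i l).
  by rewrite (adj_sum h).
by rewrite exchange_big.
Qed.

(** The matrix of operators realizes [M] on the Hilbert sum: words in [M] and its
    star are represented by the corresponding words of operators, and their traces
    are read off the diagonal. *)
Theorem mx_represents_trace_class (M : 'M[Alg]_n) X : mx_represents M X ->
  trace_class (mx_star star) (mx_dom D) (mx_weight omega) (fun _ : unit => M).
Proof.
move=> hM; split; first by move=> _ i j; case: (represents_props (hM i j)).
have /choice[Xs' hXs] : forall i : 'I_n * 'I_n, exists T', is_adjoint (X i.2 i.1) T' /\ represents (star (M i.2 i.1)) T'.
  by move=> [i j]; have [T' h1 h2] := represents_star (hM j i); exists T'.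
pose Xs i j := Xs' (i, j).
have XA i j : is_adjoint (X i j) (Xs j i) by case: (hXs (j, i)).
have hMs : mx_represents (mx_star star M) Xs.
  by move=> i j; rewrite !mxE; case: (hXs (i, j)).
have ad := opmx_adj XA.
pose Y := linear_of (adj_lin ad); pose Ys := linear_of (adj_lin (adjC ad)).
exists (hilbert_sum H n), (fun=> Y).
have hb i : exists b, 0 <= b /\ bounded_by (X i.1 i.2) b.
  by case: (represents_props (hM i.1 i.2)) => _ [b b0 h] _ _; exists b.
have {hb}[b hb] := choice hb.
have hc i : exists c, trace_bounded (X i.1 i.2) c by case: (represents_props (hM i.1 i.2)).
have {hc}[c hc] := choice hc.
split.
  move=> _; apply: (@trace_bounded_trace_class _ _ Y Ys (\sum_i \sum_j b (i, j)) (\sum_i \sum_j c (i, j)) (onb_sum n0 e0) _ _ ad).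
  - by apply: sumr_ge0 => i _; apply: sumr_ge0 => j _; case: (hb (i, j)).
  - by apply: (opmx_bounded (b := fun i j => b (i, j))) => i j; case: (hb (i, j)).
  - by apply: (opmx_trace_bounded (c := fun i j => c (i, j))) => i j; exact: (hc (i, j)).
  - exact: onb_sumP.
exists (fun=> Ys) => [_|s s0]; first exact: ad.
have [Z [hZ1 hZ2]] : exists Z, mx_represents (star_word (mx_star star) (fun _ : unit => M) s) Z /\
    forall v, op_word (fun=> Y) (fun=> Ys) s v = opmx Z v.
  elim: s s0 => // p s IH _.
  have [Z0 [h1 h2]] : exists Z, mx_represents (if p.2 then mx_star star M else M) Z /\
     forall v, (if p.2 then Ys else Y) v = opmx Z v.
    by case: p.2; [exists Xs | exists X].
  rewrite /star_word big_cons -/(star_word _ _ s).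
  case: s IH => [|q s] IH.
    by exists Z0; rewrite /star_word big_nil mulr1.
  have [//|Z [h3 h4]] := IH.
  exists (opmx_mul Z0 Z); split; first exact: mx_representsM.
  move=> v; rewrite -(opmx_comp _ h1 h3) -h4 -h2 /=.
  by case: p.2.
have := @opmx_trace _ H n n0 Z (fun i => omega (star_word (mx_star star) (fun _ : unit => M) s i i)) e0.
move=> h; have {}h := h _ he0 _.
have {}h : is_trace (opmx Z) (\sum_i omega (star_word (mx_star star) (fun _ : unit => M) s i i)).
  apply: h => [i j|i]; first by have [T' h'] := represents_adjoint (hZ1 i j); exact: adj_0 h'.
  by case: (represents_props (hZ1 i i)) => _ _ _; apply.
have -> : op_word (fun=> Y) (fun=> Ys) s = opmx Z by apply/funext => v; rewrite hZ2.
rewrite /mx_weight /mxtrace; under eq_bigr do rewrite mxE.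
exact: h.
Qed.

End Matrices.
End Rep.
End Words.

(** * Cyclic monotonicity for matrices *)

Section CyclicMonotone.
Context {R : realType} {Alg : algType R[i]} (star : Alg -> Alg) (tau : {scalar Alg})
  (D : set Alg) (omega : Alg -> R[i]).
Local Notation C := R[i].
Hypothesis homega : tracial_weight star D omega.

Lemma star_alg_sub (X : set Alg) : star_subalgebra star (star_alg star X).
Proof.
split=> [M [[h _ _ _] _] //|c x y hx hy M hM|x y hx hy M hM|x hx M hM];
  have := hM => -[[h1 h2 h3 h4] _].
- exact: h2 (hx M hM) (hy M hM).
- exact: h3 (hx M hM) (hy M hM).
- exact: h4 (hx M hM).
Qed.

Lemma star_alg_gen (X : set Alg) x : X x -> star_alg star X x.
Proof. by move=> h M [_]; exact. Qed.

Lemma subalg_sum (S : set Alg) (J : Type) (r : seq J) (F : J -> Alg) :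
  star_subalgebra star S -> (forall i, S (F i)) -> S (\sum_(i <- r) F i).
Proof.
move=> [h0 h1 _ _] h; elim: r => [|i r IH]; rewrite ?big_nil // big_cons.
by rewrite -[F i]scale1r; exact: h1.
Qed.

Variables S B : set Alg.
Hypotheses (hS : star_subalgebra star S) (SD : S `<=` D).
Hypothesis B1 : B 1.
Hypothesis hmon : cyclically_monotone_alg tau D omega S B.

Definition good_word (l : seq (Alg * Alg)) := forall p, p \in l -> S p.1 /\ B p.2.

Lemma good_nil : good_word [::].
Proof. by []. Qed.

Lemma word_omega l : good_word l -> l != [::] ->
  omega (\prod_(p <- l) (p.1 * p.2)) =
  omega (\prod_(p <- l) p.1) * \prod_(p <- l) tau p.2.
Proof.
move=> hl l0; rewrite !(big_nth (0, 0)) !big_mkord.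
apply: hmon.2 => [|i|i]; first by case: l l0 {hl}.
- by case: (hl _ (mem_nth (0, 0) (ltn_ord i))).
- by case: (hl _ (mem_nth (0, 0) (ltn_ord i))).
Qed.

Lemma word_D b0 l : B b0 -> good_word l -> l != [::] -> D (b0 * \prod_(p <- l) (p.1 * p.2)).
Proof.
move=> hb hl l0; apply: hmon.1.
exists 1%N, (fun=> 1), (fun=> b0 * \prod_(p <- l) (p.1 * p.2)); split; last first.
  by rewrite big_ord1 scale1r.
move=> _; exists (size l), (fun i => (nth (0, 0) l i).1), (fun i => (nth (0, 0) l i).2), b0.
split=> // [|i|i|]; first by case: l l0 {hl}.
- by case: (hl _ (mem_nth (0, 0) (ltn_ord i))).
- by case: (hl _ (mem_nth (0, 0) (ltn_ord i))).
- by rewrite (big_nth (0, 0)) big_mkord.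
Qed.

Lemma good_letters_S l : good_word l -> l != [::] -> S (\prod_(p <- l) p.1).
Proof.
have [_ _ hm _] := hS.
elim: l => // p l IH hl _; rewrite big_cons.
have hp : S p.1 by case: (hl p (mem_head _ _)).
have [->|l0] := eqVneq l [::]; first by rewrite big_nil mulr1.
apply: hm => //; apply: IH => // q ql; apply: hl; by rewrite in_cons ql orbT.
Qed.

Section Matrices.
Variable n : nat.
Implicit Type L : seq ('M[Alg]_n * 'M[Alg]_n).

Definition good_mx L := forall p, p \in L -> forall i j, S (p.1 i j) /\ B (p.2 i j).

Definition mprod L : 'M[Alg]_n := \prod_(p <- L) (p.1 * p.2).
Definition mprod_tau L : 'M[Alg]_n :=
  \prod_(p <- L) (p.1 * scalar_entries Alg (id_tau tau p.2)).

Lemma mprod_cons_entry q L i j (w : Alg) :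
  w * mprod (q :: L) i j = \sum_k \sum_m w * (q.1 i m * q.2 m k) * mprod L k j.
Proof.
rewrite /mprod big_cons -/(mprod L) mxE mulr_sumr; apply: eq_bigr => k _.
rewrite mxE mulr_suml mulr_sumr; apply: eq_bigr => m _.
by rewrite !mulrA.
Qed.

Lemma mprod_tau_cons_entry q L i j (w : Alg) :
  w * mprod_tau (q :: L) i j =
  \sum_k \sum_m tau (q.2 m k) *: (w * q.1 i m * mprod_tau L k j).
Proof.
rewrite /mprod_tau big_cons -/(mprod_tau L) mxE mulr_sumr; apply: eq_bigr => k _.
rewrite mxE mulr_suml mulr_sumr; apply: eq_bigr => m _.
by rewrite !mxE -scalerAr mulr1 -scalerAl -scalerAr mulrA.
Qed.

Lemma good_rcons l (q : 'M[Alg]_n * 'M[Alg]_n) i m k : good_word l ->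
  (forall i j, S (q.1 i j) /\ B (q.2 i j)) ->
  good_word (rcons l (q.1 i m, q.2 m k)).
Proof.
move=> hl hq p; rewrite mem_rcons in_cons => /predU1P[->|/hl //] /=.
by split; [case: (hq i m) | case: (hq m k)].
Qed.

Lemma good_mx_cons q L : good_mx (q :: L) -> (forall i j, S (q.1 i j) /\ B (q.2 i j)) /\ good_mx L.
Proof.
by move=> h; split; [apply: h; rewrite mem_head | move=> p pL; apply: h; rewrite in_cons pL orbT].
Qed.

Lemma mprod_D b0 l L i j : B b0 -> good_word l -> good_mx L -> (l != [::]) || (L != [::]) ->
  D (b0 * \prod_(p <- l) (p.1 * p.2) * mprod L i j).
Proof.
move=> hb; elim: L l i => [|q L IH] l i hl hL hn.
  rewrite orbF in hn; rewrite /mprod big_nil mxE; case: eqP => _.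
    by rewrite mulr1; exact: word_D.
  by rewrite mulr0; exact: dom0 homega.
have [hq hL'] := good_mx_cons hL.
rewrite mprod_cons_entry; apply: (dom_sum homega) => k; apply: (dom_sum homega) => m.
have := IH (rcons l (q.1 i m, q.2 m k)) k (@good_rcons l q i m k hl hq) hL'.
rewrite -cats1 big_cat big_seq1 /= mulrA; apply.
by case: l {hl hn}.
Qed.

Lemma mprod_tau_D l L i j : good_word l -> good_mx L -> (l != [::]) || (L != [::]) ->
  D (\prod_(p <- l) p.1 * mprod_tau L i j).
Proof.
elim: L l i => [|q L IH] l i hl hL hn.
  rewrite orbF in hn; rewrite /mprod_tau big_nil mxE; case: eqP => _.
    by rewrite mulr1; apply: SD; exact: good_letters_S.
  by rewrite mulr0; exact: dom0 homega.
have [hq hL'] := good_mx_cons hL.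
rewrite mprod_tau_cons_entry; apply: (dom_sum homega) => k; apply: (dom_sum homega) => m.
apply: (domZ homega).
have := IH (rcons l (q.1 i m, q.2 m k)) k (@good_rcons l q i m k hl hq) hL'.
rewrite -cats1 big_cat big_seq1 /=; apply.
by case: l {hl hn}.
Qed.

(** Expanding the entries of the first pair of [L] lengthens the word [l] by one
    letter pair; the weights of complete words are given by cyclic
    monotonicity. *)
Lemma mprod_omega l L i j : good_word l -> good_mx L -> (l != [::]) || (L != [::]) ->
  omega (\prod_(p <- l) (p.1 * p.2) * mprod L i j) =
  \prod_(p <- l) tau p.2 * omega (\prod_(p <- l) p.1 * mprod_tau L i j).
Proof.
elim: L l i => [|q L IH] l i hl hL hn.
  rewrite orbF in hn; rewrite /mprod /mprod_tau !big_nil mxE; case: eqP => _.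
    by rewrite !mulr1 mulrC; exact: word_omega.
  by rewrite !mulr0 (omega0 homega) mulr0.
have [hq hL'] := good_mx_cons hL.
have good k m := @good_rcons l q i m k hl hq.
have ne k m : (rcons l (q.1 i m, q.2 m k) != [::]) || (L != [::]) by case: l {hl hn good}.
have hD k m : D (\prod_(p <- l) (p.1 * p.2) * (q.1 i m * q.2 m k) * mprod L k j).
  have := mprod_D k j B1 (good k m) hL' (ne k m).
  by rewrite -cats1 big_cat big_seq1 /= mul1r.
have hDt k m : D (\prod_(p <- l) p.1 * q.1 i m * mprod_tau L k j).
  have := mprod_tau_D k j (good k m) hL' (ne k m).
  by rewrite -cats1 big_cat big_seq1 /=.
rewrite mprod_cons_entry mprod_tau_cons_entry.
rewrite (omega_sum homega) => [|k]; last by apply: (dom_sum homega).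
rewrite (omega_sum homega) => [|k]; last by apply: (dom_sum homega) => m; exact: (domZ homega).
rewrite mulr_sumr; apply: eq_bigr => k _.
rewrite (omega_sum homega) // (omega_sum homega) => [|m]; last exact: (domZ homega).
rewrite mulr_sumr; apply: eq_bigr => m _.
have := IH _ k (good k m) hL' (ne k m).
rewrite -cats1 !big_cat !big_seq1 /= => ->.
by rewrite (omegaZ homega) // mulrA.
Qed.

Lemma mprod_weight L : good_mx L -> L != [::] ->
  mx_weight omega (mprod L) = mx_weight omega (mprod_tau L).
Proof.
move=> hL L0; rewrite /mx_weight /mxtrace; apply: eq_bigr => i _; rewrite !mxE.
have := @mprod_omega [::] L i i good_nil hL; by rewrite L0 orbT !big_nil !mul1r => /(_ isT).
Qed.

Lemma mx_weightC (X Y : 'M[Alg]_n) : mx_dom D X -> mx_dom D Y ->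
  mx_weight omega (X * Y) = mx_weight omega (Y * X).
Proof.
move=> hX hY; have [_ [_ hc _ _]] := homega.
have E (U V : 'M[Alg]_n) : mx_dom D U -> mx_dom D V ->
    mx_weight omega (U * V) = \sum_i \sum_j omega (U i j * V j i).
  move=> hU hV; rewrite /mx_weight /mxtrace; apply: eq_bigr => i _; rewrite !mxE.
  rewrite (omega_sum homega) // => j; exact: (domM homega (hU _ _) (hV _ _)).
rewrite !E // exchange_big; apply: eq_bigr => i _; apply: eq_bigr => j _.
exact: hc.
Qed.

Lemma mprod_cat L L' : mprod (L ++ L') = mprod L * mprod L'.
Proof. exact: big_cat. Qed.

Lemma mprod_pow L m : mprod (flatten (nseq m L)) = mprod L ^+ m.
Proof.
elim: m => [|m IH]; first by rewrite /mprod big_nil.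
by rewrite /= mprod_cat IH exprS.
Qed.

Lemma mprod_tau_pow L m : mprod_tau (flatten (nseq m L)) = mprod_tau L ^+ m.
Proof.
elim: m => [|m IH]; first by rewrite /mprod_tau big_nil.
by rewrite /= {1}/mprod_tau big_cat -!/(mprod_tau _) IH exprS.
Qed.

Lemma good_flatten L m : good_mx L -> good_mx (flatten (nseq m L)).
Proof.
by move=> h p /flattenP[L' /nseqP[-> _]]; exact: h.
Qed.

Lemma good_cat L L' : good_mx L -> good_mx L' -> good_mx (L ++ L').
Proof. by move=> h h' p; rewrite mem_cat => /orP[/h|/h']. Qed.

(** For [m >= 2] the moment is the weight of a product of [B0 G B0] with
    [G (B0 G)^(m-2)], where [G = mprod L].  Both factors have entries in the
    domain, so they may be exchanged, which gives [(G B0)^m]. *)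
Lemma rotated_moments (B0 : 'M[Alg]_n) L L1 m : (forall i j, B (B0 i j)) ->
  good_mx L -> L != [::] -> good_mx L1 -> L1 != [::] ->
  mprod L1 = mprod L * B0 -> (2 <= m)%N ->
  mx_weight omega ((B0 * mprod L) ^+ m) = mx_weight omega (mprod_tau L1 ^+ m).
Proof.
move=> hB0 hL L0 hL1 L10 E; case: m => [|[|m]] // _.
set G := mprod L in E *.
have comm k : G * (B0 * G) ^+ k = (G * B0) ^+ k * G.
  elim: k => [|k IH]; first by rewrite !expr0 mulr1 mul1r.
  by rewrite exprSr mulrA IH [in RHS]exprSr !mulrA.
have -> : (B0 * G) ^+ m.+2 = (B0 * G * B0) * (G * (B0 * G) ^+ m).
  by rewrite exprS exprS !mulrA.
rewrite mx_weightC.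
- have -> : G * (B0 * G) ^+ m * (B0 * G * B0) = (G * B0) ^+ m.+2.
    by rewrite comm !exprSr !mulrA.
  rewrite -E -mprod_pow -mprod_tau_pow mprod_weight //; first exact: good_flatten.
  by case: L1 L10 {hL1 E}.
- move=> i j; rewrite -mulrA -E mxE; apply: (dom_sum homega) => k.
  have := @mprod_D (B0 i k) [::] L1 k j (hB0 _ _) good_nil hL1.
  by rewrite big_nil mulr1 L10 orbT => /(_ isT).
- move=> i j; rewrite comm -E -mprod_pow -mprod_cat.
  have := @mprod_D 1 [::] (flatten (nseq m L1) ++ L) i j B1 good_nil (good_cat (@good_flatten L1 m hL1) hL).
  rewrite big_nil !mul1r; apply.
  by rewrite eqxx orFb -size_eq0 size_cat addn_eq0 negb_and !size_eq0 L0 orbT.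
Qed.

End Matrices.
End CyclicMonotone.

(* Only A 1, ..., A k and B 0, ..., B k matter. *)
Theorem theorem12 (R : realType) (Alg : algType R[i]) (star : Alg -> Alg)
  (tau : {scalar Alg}) (D : set Alg) (omega : Alg -> R[i])
  (hstar : is_star star) (htau : tracial_state tau)
  (homega : tracial_weight star D omega)
  (n k : nat) (hn : (1 <= n)%N) (hk : (1 <= k)%N)
  (A B : nat -> 'M[Alg]_n)
  (hAD : forall p, (1 <= p <= k)%N -> mx_dom D (A p))
  (hA : trace_class star D omega
          (fun t : 'I_k * 'I_n * 'I_n => A t.1.1.+1 t.1.2 t.2))
  (hAB : cyclically_monotone star tau D omega
     [set a | exists p i j, (1 <= p <= k)%N /\ a = A p i j]
     [set b | exists q i j, (q <= k)%N /\ b = B q i j])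
  (hBA : trace_class (mx_star star) (mx_dom D) (mx_weight omega)
     (fun _ : unit => B 0%N * \prod_(1 <= p < k.+1) (A p * B p))) :
  exists mu : R[i] -> nat,
    is_EV (mx_star star) (mx_dom D) (mx_weight omega)
      (B 0%N * \prod_(1 <= p < k.+1) (A p * B p)) mu /\
    is_EV (mx_star star) (mx_dom D) (mx_weight omega)
      (\prod_(1 <= p < k) (A p * scalar_entries Alg (id_tau tau (B p)))
         * A k * scalar_entries Alg (id_tau tau (B k * B 0%N))) mu.
Proof.
set M := B 0%N * _; set N := _ * scalar_entries _ _.
pose SX := star_alg star [set a | exists p i j, (1 <= p <= k)%N /\ a = A p i j].
pose BY := star_alg star ([set 1] `|` [set b | exists q i j, (q <= k)%N /\ b = B q i j]).
have hSX : star_subalgebra star SX by exact: star_alg_sub.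
have hBY : star_subalgebra star BY by exact: star_alg_sub.
have SXD : SX `<=` D.
  move=> z; apply; split; first by case: homega.
  by move=> _ [p [i [j [hp ->]]]]; exact: hAD.
have BY1 : BY 1 by apply: star_alg_gen; left.
have SXA p i j : (1 <= p <= k)%N -> SX (A p i j).
  by move=> hp; apply: star_alg_gen; exists p, i, j.
have BYB q i j : (q <= k)%N -> BY (B q i j).
  by move=> hq; apply: star_alg_gen; right; exists q, i, j.
pose L := [seq (A p, B p) | p <- index_iota 1 k.+1].
(* [B_0] is absorbed by the last factor *)
pose L1 := rcons [seq (A p, B p) | p <- index_iota 1 k] (A k, B k * B 0%N).
have hL : good_mx SX BY L.
  move=> q /mapP[p]; rewrite mem_index_iota => /andP[p1 p2] -> i j /=.
  by split; [apply: SXA; rewrite p1 | apply: BYB].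
have hL1 : good_mx SX BY L1.
  move=> q; rewrite mem_rcons in_cons => /predU1P[->|/mapP[p]] /=.
    move=> i j; split; first by apply: SXA; rewrite hk leqnn.
    rewrite mxE; apply: (subalg_sum _ hBY) => l.
    by have [_ _ h _] := hBY; apply: h; exact: BYB.
  rewrite mem_index_iota => /andP[p1 p2] -> i j /=.
  by split; [apply: SXA; rewrite p1 ltnW | apply: BYB; rewrite ltnW].
have EL : mprod L = \prod_(1 <= p < k.+1) (A p * B p) by rewrite /mprod big_map.
have EL1 : mprod L1 = mprod L * B 0%N.
  by rewrite EL big_nat_recr //= /mprod /L1 -cats1 big_cat big_map big_seq1 /= !mulrA.
have EN : mprod_tau tau L1 = N.
  by rewrite /mprod_tau /L1 -cats1 big_cat big_map big_seq1 /= mulrA.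
have moments m : (2 <= m)%N -> mx_weight omega (M ^+ m) = mx_weight omega (N ^+ m).
  move=> m2; rewrite /M -EL -EN.
  apply: (rotated_moments homega hSX SXD BY1 hAB _ hL _ hL1 _ EL1 m2).
  - by move=> i j; exact: BYB.
  - by rewrite -size_eq0 size_map size_iota subn1 -lt0n.
  - by rewrite /L1; case: [seq _ | _ <- _].
have hN : trace_class (mx_star star) (mx_dom D) (mx_weight omega) (fun _ : unit => N).
  have [aD [H [x [xtc [xs xadj xtr]]]]] := hA.
  (* some operator of the family, to obtain an orthonormal basis of [H] *)
  pose i0 : 'I_k * 'I_n * 'I_n := (Ordinal hk, Ordinal hn, Ordinal hn).
  have [_ [_ [_ [_ _ _ [_ [e0 he0 _]]]]]] := xtc i0.
  pose able z := exists T, represents star (fun t : 'I_k * 'I_n * 'I_n => A t.1.1.+1 t.1.2 t.2) x xs z T.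
  have ableA p i j : (1 <= p <= k)%N -> able (A p i j).
    case: p => // p /= hp; exists (x (Ordinal hp, i, j)).
    exact: (@represents_gen _ _ star _ _ _ x xs (Ordinal hp, i, j)).
  have able_sum (F : 'I_n -> Alg) : (forall i, able (F i)) -> able (\sum_i F i).
    by move=> /choice[T hT]; exists (fun v => \sum_i T i v); exact: represents_sum.
  have ableM (X Y : 'M[Alg]_n) : (forall i j, able (X i j)) -> (forall i j, able (Y i j)) ->
      forall i j, able ((X * Y) i j).
    move=> hX hY i j; rewrite mxE; apply: able_sum => l.
    by have [T hT] := hX i l; have [U hU] := hY l j; exists (T \o U); exact: representsM.
  have ableS (X : 'M[Alg]_n) (c : 'M[R[i]]_n) : (forall i j, able (X i j)) ->
      forall i j, able ((X * scalar_entries Alg c) i j).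
    move=> hX i j; rewrite mxE; apply: able_sum => l.
    have [T hT] := hX i l; exists (fun v => c l j *: T v).
    by rewrite mxE -scalerAr mulr1; exact: representsZ.
  have ableN i j : able (N i j).
    rewrite -EN /mprod_tau /L1.
    have : forall p, p \in index_iota 1 k -> (1 <= p <= k)%N.
      by move=> p; rewrite mem_index_iota => /andP[-> /ltnW ->].
    elim: (index_iota 1 k) i j => [|p r IH] i j hr.
      by rewrite big_seq1; apply: ableS => i' j'; apply: ableA; rewrite hk leqnn.
    rewrite big_cons; apply: ableM => i' j'.
      by apply: ableS => i'' j''; apply: ableA; apply: hr; rewrite mem_head.
    by apply: IH => q qr; apply: hr; rewrite in_cons qr orbT.
  have /choice[X hX] : forall i, exists T : 'I_n -> H -> H, forall j,
      represents star (fun t : 'I_k * 'I_n * 'I_n => A t.1.1.+1 t.1.2 t.2) x xs (N i j) (T j).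
    by move=> i; have [T hT] := choice (ableN i); exists T.
  exact: (mx_represents_trace_class hstar homega aD xtc xadj xtr hn he0 (X := X)).
have pow (Z : 'M[Alg]_n) (H : separable_hilbert R) (x : {linear H -> H}) :
    realizes (mx_star star) (mx_weight omega) (fun _ : unit => Z) (fun _ : unit => x) ->
    trace_class_op x /\ forall m, (2 <= m)%N -> is_trace (iter m x) (mx_weight omega (Z ^+ m)).
  move=> [h1 [xs _ h2]]; split; first exact: (h1 tt).
  move=> m m2; have := h2 (nseq m (tt, false)); rewrite size_nseq (ltn_trans _ m2) // => /(_ isT).
  have -> : op_word (fun=> x) xs (nseq m (tt, false)) = iter m x.
    by apply/funext => v; elim: m {m2} => //= m ->.
  suff -> : star_word (mx_star star) (fun=> Z) (nseq m (tt, false)) = Z ^+ m by [].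
  rewrite /star_word; elim: m {m2} => [|m IH]; first by rewrite big_nil.
  by rewrite /= big_cons IH exprS.
have [_ [H0 [x0 hx0]]] := hBA.
have {}hx0 : realizes (mx_star star) (mx_weight omega) (fun _ : unit => M) (fun _ : unit => x0 tt).
  by rewrite (_ : (fun _ : unit => x0 tt) = x0) //; apply/funext => -[].
have [tc0 tr0] := pow _ _ _ hx0.
have [xs0 [b0 [c0 [ad0 _ _ nuc0]]]] := trace_class_data tc0.
(* the multiplicities are read off the operator that realizes [M] *)
have /choice[s hs] : forall l : R[i], exists s, l != 0 -> max_eigenflag (x0 tt) l s.
  move=> l; have [->|l0] := eqVneq l 0; first by exists [::].
  by have [s hs] := max_eigenflag_exists ad0 nuc0 l0; exists s.
exists (fun l => size (s l)); split; split.
- exact: hBA.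
- move=> H x hx l l0; have [tc tr] := pow M H x hx.
  exact: (trace_moments_mult tc0 tc tr0 tr l0 (hs l l0)).
- exact: hN.
- move=> H x hx l l0; have [tc tr] := pow N H x hx.
  apply: (trace_moments_mult tc0 tc tr0 _ l0 (hs l l0)) => m m2.
  by rewrite moments //; exact: tr.
Qed.
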